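(* Every pseudocompact C$^*$-algebra is unital, has real rank zero, has stable rank one, is stably finite, and admits a tracial state.
   Context: $M_n$ denotes the C$^*$-algebra of complex $n\times n$ matrices, $n\ge 1$. Finite-dimensional C$^*$-algebras are, up to isomorphism, the (nonempty) finite direct sums of matrix algebras $M_n$. Continuous logic for C$^*$-algebras: atomic formulae are norms $\|P(x_1,\dots,x_k)\|$ of $*$-polynomials with complex coefficients (a constant $I$ for the identity may be used when the algebras are unital); formulae are built from these by applying continuous real-valued functions to finitely many formulae and by taking $\sup$ or $\inf$ of a variable over the closed unit ball. A sentence is a formula without free variables; $\varphi^A\in\mathbb{R}$ is its value in $A$. $A\equiv B$ (elementarily equivalent) if $\varphi^A=\varphi^B$ for every sentence $\varphi$. For an ultrafilter $\mathcal{U}$ on a set $I$, the ultraproduct $\prod_{\mathcal{U}}A_i$ is the C$^*$-algebra of bounded families $(a_i)_{i\in I}$ modulo those with $\lim_{\mathcal{U}}\|a_i\|=0$. A C$^*$-algebra is pseudocompact if it is elementarily equivalent to an ultraproduct of finite-dimensional C$^*$-algebras. Real rank zero: self-adjoint elements with finite spectrum are dense in the self-adjoint elements. Stable rank one (for unital algebras): the invertible elements are dense. Stably finite: for every $n$, $M_n(A)$ is finite (every isometry is a unitary). *)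

(* Defs.v *)
From HB Require Import structures.
From mathcomp Require Import all_boot all_order all_algebra.
From mathcomp Require Import all_classical all_reals all_analysis.
From mathcomp Require Import complex.
From mathcomp Require Import lra.

Set Implicit Arguments.
Unset Strict Implicit.
Unset Printing Implicit Defensive.

Import Order.TTheory GRing.Theory Num.Theory numFieldNormedType.Exports.

Local Open Scope classical_set_scope.
Local Open Scope ring_scope.
Local Open Scope complex_scope.
Local Open Scope quotient_scope.

Reserved Notation "x ** y" (at level 40, left associativity).

(* C*-algebras, not assumed unital and possibly zero. MathComp rings all have a
   unit, hence the separate product. The norm of a normed module over R[i]
   takes its (real nonnegative) values in R[i]. *)
HB.mixin Record CompleteNormedModule_isCStarAlgebra (R : realType) A
    & CompleteNormedModule R[i] A := {
  cs_mul : A -> A -> A;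
  star : A -> A;
  cs_mulA : associative cs_mul;
  cs_mulDl : left_distributive cs_mul +%R;
  cs_mulDr : right_distributive cs_mul +%R;
  cs_mulZl : forall (k : R[i]) (x y : A),
    cs_mul (k *: x) y = k *: cs_mul x y;
  cs_mulZr : forall (k : R[i]) (x y : A),
    cs_mul x (k *: y) = k *: cs_mul x y;
  starK : involutive star;
  starD : {morph star : x y / x + y};
  starZ : forall (k : R[i]) (x : A), star (k *: x) = conjc k *: star x;
  starM : forall x y : A, star (cs_mul x y) = cs_mul (star y) (star x);
  cs_normM : forall x y : A, `|cs_mul x y| <= `|x| * `|y|;
  cs_normE : forall x : A, `|cs_mul (star x) x| = `|x| ^+ 2
}.

#[short(type="cstarAlgType")]
HB.structure Definition CStarAlgebra (R : realType) :=
  {A of CompleteNormedModule R[i] A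
      & CompleteNormedModule_isCStarAlgebra R A}.

Notation "x ** y" := (cs_mul x y) : ring_scope.

Definition rnorm (R : realType) (A : normedModType R[i]) (x : A) : R :=
  complex.Re `|x|.

Section RealNorm.
Variable R : realType.
Implicit Type A : normedModType R[i].

Lemma rnormE A (x : A) : `|x| = (rnorm x)%:C.
Proof. by rewrite /rnorm RRe_real// normr_real. Qed.

Lemma rnorm_ge0 A (x : A) : 0 <= rnorm x.
Proof. by rewrite -ler0c -rnormE normr_ge0. Qed.

Lemma rnorm0 A : rnorm (0 : A) = 0.
Proof. by rewrite /rnorm normr0. Qed.

Lemma rnorm0_eq0 A (x : A) : rnorm x = 0 -> x = 0.
Proof. by move=> x0; apply/eqP; rewrite -normr_eq0 rnormE x0. Qed.

Lemma rnormD A (x y : A) : rnorm (x + y) <= rnorm x + rnorm y.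
Proof. by rewrite -lecR rmorphD/= -!rnormE ler_normD. Qed.

Lemma rnormN A (x : A) : rnorm (- x) = rnorm x.
Proof. by rewrite /rnorm normrN. Qed.

Lemma rnormB A (x y : A) : rnorm (x - y) = rnorm (y - x).
Proof. by rewrite -rnormN opprB. Qed.

Lemma rnormZ A (k : R[i]) (x : A) : rnorm (k *: x) = complex.Re `|k| * rnorm x.
Proof.
by apply: (@complexI R); rewrite rmorphM/= -!rnormE normrZ.
Qed.

Lemma rnorm_dist A (x y : A) : `|rnorm x - rnorm y| <= rnorm (x - y).
Proof.
have h (u v : A) : rnorm u - rnorm v <= rnorm (u - v).
  by rewrite lerBlDr; have := rnormD (u - v) v; rewrite subrK.
by rewrite ler_norml h andbT lerNl opprB rnormB h.
Qed.

End RealNorm.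

Section CStarNorm.
Variables (R : realType) (A : cstarAlgType R).
Implicit Types x y : A.

Lemma rnormM x y : rnorm (x ** y) <= rnorm x * rnorm y.
Proof. by rewrite -lecR rmorphM/= -!rnormE cs_normM. Qed.

Lemma rnorm_cstar x : rnorm (star x ** x) = rnorm x ^+ 2.
Proof. by apply: (@complexI R); rewrite rmorphXn/= -!rnormE cs_normE. Qed.

Lemma rnorm_star x : rnorm (star x) = rnorm x.
Proof.
have h y : rnorm y <= rnorm (star y).
  have [->|y0] := eqVneq (rnorm y) 0; first exact: rnorm_ge0.
  have {}y0 : 0 < rnorm y by rewrite lt_neqAle eq_sym y0 rnorm_ge0.
  by rewrite -(ler_pM2r y0) -expr2 -rnorm_cstar rnormM.
by apply/eqP; rewrite eq_le h andbT -{2}(starK x) h.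
Qed.

Lemma cs_mulBl x y z : (x - y) ** z = x ** z - y ** z.
Proof. by rewrite cs_mulDl -scaleN1r cs_mulZl scaleN1r. Qed.

Lemma cs_mulBr x y z : z ** (x - y) = z ** x - z ** y.
Proof. by rewrite cs_mulDr -scaleN1r cs_mulZr scaleN1r. Qed.

Lemma starB x y : star (x - y) = star x - star y.
Proof. by rewrite starD -scaleN1r starZ rmorphN1 scaleN1r. Qed.

End CStarNorm.

Section UltraLimit.
Variables (R : realType) (I : Type) (U : set_system I) (UU : UltraFilter U).

Lemma ultra_fmap (T : Type) (f : I -> T) : UltraFilter (f @ U).
Proof.
split=> [|G PG UG]; first exact: fmap_proper_filter.
apply/seteqP; split=> // S GS.
have [//|nS] := @in_ultra_setVsetC _ U (f @^-1` S) UU.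
have GnS : G (~` S) := UG _ nS.
exfalso; apply: (@filter_not_empty _ G PG).
by rewrite -(setICr S); apply: filterI.
Qed.

Lemma ultra_lim_cvg (f : I -> R) (M : R) :
  (forall i, 0 <= f i <= M) -> f i @[i --> U] --> lim (f i @[i --> U]).
Proof.
move=> fM; have := @segment_compact R 0 M; rewrite compact_ultra => h.
have [|l [_ fl]] := h _ (ultra_fmap f).
  by apply: nearW => i; rewrite /= in_itv /= fM.
by apply: cvgP fl.
Qed.

End UltraLimit.

Section BoundedFamilies.
Variables (R : realType) (I : Type) (B : I -> cstarAlgType R).

Record bounded_family := BoundedFamily {
  bfun :> forall i, B i;
  bfunP : exists M : R, forall i, rnorm (bfun i) <= M
}.

HB.instance Definition _ := gen_eqMixin bounded_family.
HB.instance Definition _ := gen_choiceMixin bounded_family.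

Implicit Types a b : bounded_family.

Lemma bfamP a b : (forall i, a i = b i) -> a = b.
Proof.
case: a b => [f fP] [g gP] /= fg; have {}fg : f = g by apply: functional_extensionality_dep.
by subst g; congr BoundedFamily; exact: Prop_irrelevance.
Qed.

Fact bf0P : exists M : R, forall i, rnorm (0 : B i) <= M.
Proof. by exists 0 => i; rewrite rnorm0. Qed.
Definition bf0 := BoundedFamily bf0P.

Fact bfNP a : exists M : R, forall i, rnorm (- a i) <= M.
Proof. by have [M aM] := bfunP a; exists M => i; rewrite rnormN. Qed.
Definition bfN a := BoundedFamily (bfNP a).

Fact bfDP a b : exists M : R, forall i, rnorm (a i + b i) <= M.
Proof.
have [M aM] := bfunP a; have [N bN] := bfunP b; exists (M + N) => i.
by rewrite (le_trans (rnormD _ _))// lerD.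
Qed.
Definition bfD a b := BoundedFamily (bfDP a b).

Fact bfZP (k : R[i]) a : exists M : R, forall i, rnorm (k *: a i) <= M.
Proof.
have [M aM] := bfunP a; exists (complex.Re `|k| * M) => i.
by rewrite rnormZ ler_wpM2l// (rnorm_ge0 (k : R[i]^o)).
Qed.
Definition bfZ k a := BoundedFamily (bfZP k a).

Fact bfMP a b : exists M : R, forall i, rnorm (a i ** b i) <= M.
Proof.
have [M aM] := bfunP a; have [N bN] := bfunP b; exists (M * N) => i.
by rewrite (le_trans (rnormM _ _))// ler_pM ?rnorm_ge0.
Qed.
Definition bfM a b := BoundedFamily (bfMP a b).

Fact bf_starP a : exists M : R, forall i, rnorm (star (a i)) <= M.
Proof. by have [M aM] := bfunP a; exists M => i; rewrite rnorm_star. Qed.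
Definition bf_star a := BoundedFamily (bf_starP a).

Fact bfDA : associative bfD.
Proof. by move=> a b c; apply: bfamP => i /=; rewrite addrA. Qed.
Fact bfDC : commutative bfD.
Proof. by move=> a b; apply: bfamP => i /=; rewrite addrC. Qed.
Fact bf0D : left_id bf0 bfD.
Proof. by move=> a; apply: bfamP => i /=; rewrite add0r. Qed.
Fact bfND : left_inverse bf0 bfN bfD.
Proof. by move=> a; apply: bfamP => i /=; rewrite addNr. Qed.
HB.instance Definition _ :=
  GRing.isZmodule.Build bounded_family bfDA bfDC bf0D bfND.

Fact bfZA (k l : R[i]) a : bfZ k (bfZ l a) = bfZ (k * l) a.
Proof. by apply: bfamP => i /=; rewrite scalerA. Qed.
Fact bf1Z : left_id 1 bfZ.
Proof. by move=> a; apply: bfamP => i /=; rewrite scale1r. Qed.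
Fact bfZDr : right_distributive bfZ +%R.
Proof. by move=> k a b; apply: bfamP => i /=; rewrite scalerDr. Qed.
Fact bfZDl a : {morph bfZ^~ a : k l / k + l}.
Proof. by move=> k l; apply: bfamP => i /=; rewrite scalerDl. Qed.
HB.instance Definition _ :=
  GRing.Zmodule_isLmodule.Build R[i] bounded_family bfZA bf1Z bfZDr bfZDl.

End BoundedFamilies.

Section Ultraproduct.
Variables (R : realType) (I : Type) (U : set_system I) (UU : UltraFilter U).
Variable B : I -> cstarAlgType R.
Local Notation bf := (bounded_family B).
Implicit Types a b c : bf.

Definition bf_null : {pred bf} :=
  fun a => `[< rnorm (a i) @[i --> U] --> (0 : R) >].

Lemma bf_nullP a :
  reflect (rnorm (a i) @[i --> U] --> (0 : R)) (a \in bf_null).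
Proof. exact: asboolP. Qed.

Lemma bf_null_le a (f : I -> R) : f i @[i --> U] --> (0 : R) ->
  (forall i, rnorm (a i) <= f i) -> a \in bf_null.
Proof.
move=> f0 af; apply/bf_nullP; apply: (squeeze_cvgr _ (cvg_cst 0) f0).
by apply: nearW => i; rewrite rnorm_ge0 af.
Qed.

Fact bf_null_zmod_closed : zmod_closed bf_null.
Proof.
split=> [|a b /bf_nullP a0 /bf_nullP b0].
  by apply: (@bf_null_le _ (fun=> 0)) => [|i]; [exact: cvg_cst|rewrite /= rnorm0].
apply: (@bf_null_le _ (fun i => rnorm (a i) + rnorm (b i))) => [|i].
  by rewrite -(addr0 0); exact: cvgD.
by rewrite (le_trans (rnormD _ _))// rnormN.
Qed.

Definition bf_null_zmod : zmodClosed bf :=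
  HB.pack bf_null (GRing.isZmodClosed.Build bf bf_null bf_null_zmod_closed).

Definition ultraproduct := Quotient.quot bf_null_zmod.

HB.instance Definition _ := GRing.Zmodule.on ultraproduct.

Implicit Types x y z : ultraproduct.

Definition uclass a : ultraproduct := \pi_(Quotient.quot bf_null_zmod) a.
Definition urepr x : bf := repr (x : Quotient.quot bf_null_zmod).

Lemma ureprK x : uclass (urepr x) = x. Proof. exact: reprK. Qed.

Lemma uclassD a b : uclass (a + b) = uclass a + uclass b.
Proof. by rewrite /uclass Quotient.pi_add. Qed.

Lemma uclassN a : uclass (- a) = - uclass a.
Proof. by rewrite /uclass Quotient.pi_opp. Qed.

Lemma uclassB a b : uclass (a - b) = uclass a - uclass b.
Proof. by rewrite uclassD uclassN. Qed.

Lemma uclassP a b : reflect (uclass a = uclass b) (a - b \in bf_null).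
Proof.
apply: (iffP idP) => [ab|/eqP]; first by apply/eqP; rewrite piE.
by rewrite piE.
Qed.

Lemma urepr_uclass a : urepr (uclass a) - a \in bf_null.
Proof. by apply/uclassP; rewrite ureprK. Qed.

Definition bf_norm a : R := lim (rnorm (a i) @[i --> U]).

Definition unorm x : R := bf_norm (urepr x).
Definition uscale (k : R[i]) x := uclass (k *: urepr x).
Definition umul x y := uclass (bfM (urepr x) (urepr y)).
Definition ustar x := uclass (bf_star (urepr x)).

Lemma bf_norm_cvg a : rnorm (a i) @[i --> U] --> bf_norm a.
Proof.
have [M aM] := bfunP a; apply: (@ultra_lim_cvg _ _ _ _ _ M) => i.
by rewrite rnorm_ge0 aM.
Qed.
Arguments bf_norm_cvg : clear implicits.

Lemma bf_norm_lim a (l : R) : rnorm (a i) @[i --> U] --> l -> bf_norm a = l.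
Proof. exact: cvg_lim. Qed.

Lemma unormE a : unorm (uclass a) = bf_norm a.
Proof.
apply: bf_norm_lim; have /bf_nullP d0 := urepr_uclass a.
set b := urepr _ in d0 *.
have h : rnorm (b i) - rnorm (a i) @[i --> U] --> (0 : R).
  apply/norm_cvg0P; apply: (squeeze_cvgr _ (cvg_cst 0) d0).
  by apply: nearW => i; rewrite normr_ge0 rnorm_dist.
rewrite -[bf_norm a]add0r.
have -> : (fun i => rnorm (b i))
    = (fun i => rnorm (b i) - rnorm (a i)) + (fun i => rnorm (a i)).
  by apply/funext => i; rewrite -[RHS]/(_ - _ + _) subrK.
exact: cvgD h (bf_norm_cvg a).
Qed.

Lemma ultra_cvg_le (f g : I -> R) (l m : R) :
  f i @[i --> U] --> l -> g i @[i --> U] --> m -> (forall i, f i <= g i) ->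
  l <= m.
Proof.
move=> fl gm fg; rewrite -subr_ge0; apply: (cvgr_to_ge (cvgB gm fl)).
by apply: nearW => i; rewrite subr_ge0 fg.
Qed.

Lemma bf_norm_le a (M : R) : (forall i, rnorm (a i) <= M) -> bf_norm a <= M.
Proof.
by move=> aM; exact: (ultra_cvg_le (bf_norm_cvg a) (cvg_cst M)).
Qed.

Lemma uclassZ k a : uclass (k *: a) = uscale k (uclass a).
Proof.
apply/uclassP; rewrite -scalerBr; have /bf_nullP := urepr_uclass a.
set b := urepr _ => d0.
apply: (@bf_null_le _ (fun i => complex.Re `|k| * rnorm ((b - a) i))) => [|i].
  by rewrite -(mulr0 (complex.Re `|k|)); apply: cvgM; [exact: cvg_cst|].
by rewrite rnormZ ler_wpM2l ?(rnorm_ge0 (k : R[i]^o))// rnormB.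
Qed.

Lemma uclassM a b : uclass (bfM a b) = umul (uclass a) (uclass b).
Proof.
apply/esym/uclassP.
have /bf_nullP := urepr_uclass a; have /bf_nullP := urepr_uclass b.
set a' := urepr (uclass a); set b' := urepr (uclass b) => b0 a0.
have [M aM] := bfunP a'; have [N bN] := bfunP b.
apply: (@bf_null_le _
  (fun i => M * rnorm ((b' - b) i) + rnorm ((a' - a) i) * N)) => [|i].
  rewrite -(addr0 0) -{1}(mulr0 M) -{2}(mul0r N).
  by apply: cvgD; apply: cvgM => //; exact: cvg_cst.
have -> : (bfM a' b' - bfM a b) i
    = a' i ** (b' - b) i + (a' - a) i ** b i.
  by rewrite /= cs_mulBr cs_mulBl addrA subrK.
rewrite (le_trans (rnormD _ _))// lerD// (le_trans (rnormM _ _))//.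
  by rewrite ler_wpM2r ?rnorm_ge0.
by rewrite ler_wpM2l ?rnorm_ge0.
Qed.

Lemma uclass_star a : uclass (bf_star a) = ustar (uclass a).
Proof.
apply/esym/uclassP; have /bf_nullP := urepr_uclass a.
set b := urepr _ => d0; apply: (bf_null_le d0) => i.
by rewrite -(rnorm_star ((b - a) i)) /= starB.
Qed.

Lemma uclass_ind (P : ultraproduct -> Prop) :
  (forall a, P (uclass a)) -> forall x, P x.
Proof. by move=> h x; rewrite -(ureprK x). Qed.

Fact uscaleA k l x : uscale k (uscale l x) = uscale (k * l) x.
Proof. by elim/uclass_ind: x => a; rewrite -!uclassZ scalerA. Qed.
Fact uscale1 : left_id 1 uscale.
Proof. by elim/uclass_ind => a; rewrite -!uclassZ scale1r. Qed.
Fact uscaleDr : right_distributive uscale +%R.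
Proof.
move=> k; elim/uclass_ind=> a; elim/uclass_ind => b.
by rewrite -uclassD -!uclassZ scalerDr uclassD.
Qed.
Fact uscaleDl x : {morph uscale^~ x : k l / k + l}.
Proof.
by elim/uclass_ind: x => a k l; rewrite /= -!uclassZ scalerDl uclassD.
Qed.
HB.instance Definition _ := GRing.Zmodule_isLmodule.Build R[i] ultraproduct
  uscaleA uscale1 uscaleDr uscaleDl.

Fact unorm_ge0 x : 0 <= unorm x.
Proof.
apply: (ultra_cvg_le (cvg_cst 0) (bf_norm_cvg (urepr x))) => i.
exact: rnorm_ge0.
Qed.

Fact unormD x y : unorm (x + y) <= unorm x + unorm y.
Proof.
elim/uclass_ind: x => a; elim/uclass_ind: y => b.
rewrite -uclassD !unormE.
apply: (ultra_cvg_le (bf_norm_cvg _) (cvgD (bf_norm_cvg a) (bf_norm_cvg b))) => i.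
exact: rnormD.
Qed.

Fact unormZ k x : unorm (k *: x) = complex.Re `|k| * unorm x.
Proof.
elim/uclass_ind: x => a; rewrite -[k *: _]uclassZ !unormE.
apply: bf_norm_lim; under eq_fun do rewrite rnormZ.
by apply: cvgM; [exact: cvg_cst|exact: bf_norm_cvg].
Qed.

Fact unorm0_eq0 x : unorm x = 0 -> x = 0.
Proof.
elim/uclass_ind: x => a; rewrite unormE => a0.
have -> : 0 = uclass 0 by rewrite -(subrr (0 : bf)) uclassB subrr.
apply/uclassP; rewrite subr0; apply/bf_nullP.
by rewrite -a0; exact: bf_norm_cvg.
Qed.

Definition unormC x : R[i] := (unorm x)%:C.

Fact unormC_D x y : unormC (x + y) <= unormC x + unormC y.
Proof. by rewrite -rmorphD/= lecR unormD. Qed.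
Fact unormC_Z k x : unormC (k *: x) = `|k| * unormC x.
Proof.
by rewrite /unormC unormZ rmorphM; congr (_ * _).
Qed.
Fact unormC0_eq0 x : unormC x = 0 -> x = 0.
Proof. by move=> /complexI; exact: unorm0_eq0. Qed.

HB.instance Definition _ := Lmodule_isNormed.Build R[i] ultraproduct
  unormC_D unormC_Z unormC0_eq0.

Lemma u_rnormE x : rnorm x = unorm x. Proof. by []. Qed.

Lemma unorm_lift x (M : R) : unorm x < M ->
  exists2 a : bf, uclass a = x & forall i, rnorm (a i) <= M.
Proof.
elim/uclass_ind: x => a; rewrite unormE => aM.
have M0 : 0 <= M by rewrite (le_trans _ (ltW aM))// -unormE unorm_ge0.
pose f i : B i := if rnorm (a i) <= M then a i else 0.
have fM i : rnorm (f i) <= M by rewrite /f; case: ifP => //; rewrite rnorm0.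
pose b := BoundedFamily (ex_intro _ M fM).
exists b => //; apply/uclassP/bf_nullP.
apply: cvg_near_cst; near=> i.
have h : rnorm (a i) <= M by apply/ltW; near: i; exact: cvgr_lt (bf_norm_cvg a) _ aM.
by rewrite /= /f h subrr rnorm0.
Unshelve. all: by end_near. Qed.

Fact umulA : associative umul.
Proof.
elim/uclass_ind=> a; elim/uclass_ind => b; elim/uclass_ind => c.
rewrite -!uclassM; congr uclass; apply: bfamP => i; exact: cs_mulA.
Qed.
Fact umulDl : left_distributive umul +%R.
Proof.
elim/uclass_ind=> a; elim/uclass_ind => b; elim/uclass_ind => c.
rewrite -uclassD -!uclassM -uclassD; congr uclass; apply: bfamP => i.
exact: cs_mulDl.
Qed.
Fact umulDr : right_distributive umul +%R.
Proof.
elim/uclass_ind=> a; elim/uclass_ind => b; elim/uclass_ind => c.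
rewrite -uclassD -!uclassM -uclassD; congr uclass; apply: bfamP => i.
exact: cs_mulDr.
Qed.
Fact umulZl (k : R[i]) x y : umul (k *: x) y = k *: umul x y.
Proof.
elim/uclass_ind: x => a; elim/uclass_ind: y => b.
rewrite -[k *: uclass a]uclassZ -!uclassM -[RHS]uclassZ.
congr uclass; apply: bfamP => i; exact: cs_mulZl.
Qed.
Fact umulZr (k : R[i]) x y : umul x (k *: y) = k *: umul x y.
Proof.
elim/uclass_ind: x => a; elim/uclass_ind: y => b.
rewrite -[k *: uclass b]uclassZ -!uclassM -[RHS]uclassZ.
congr uclass; apply: bfamP => i; exact: cs_mulZr.
Qed.
Fact ustarK : involutive ustar.
Proof.
elim/uclass_ind=> a; rewrite -!uclass_star; congr uclass.
apply: bfamP => i; exact: starK.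
Qed.
Fact ustarD : {morph ustar : x y / x + y}.
Proof.
elim/uclass_ind=> a; elim/uclass_ind=> b.
rewrite -uclassD -!uclass_star -uclassD; congr uclass.
apply: bfamP => i; exact: starD.
Qed.
Fact ustarZ (k : R[i]) x : ustar (k *: x) = conjc k *: ustar x.
Proof.
elim/uclass_ind: x => a.
rewrite -[k *: _]uclassZ -!uclass_star -[RHS]uclassZ; congr uclass.
apply: bfamP => i; exact: starZ.
Qed.
Fact ustarM x y : ustar (umul x y) = umul (ustar y) (ustar x).
Proof.
elim/uclass_ind: x => a; elim/uclass_ind: y => b.
rewrite -uclassM -!uclass_star -uclassM; congr uclass.
apply: bfamP => i; exact: starM.
Qed.
Fact unormM x y : `|umul x y| <= `|x| * `|y|.
Proof.
rewrite !rnormE !u_rnormE -rmorphM lecR.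
elim/uclass_ind: x => a; elim/uclass_ind: y => b.
rewrite -uclassM !unormE.
apply: (ultra_cvg_le (bf_norm_cvg _) (cvgM (bf_norm_cvg a) (bf_norm_cvg b))) => i.
exact: rnormM.
Qed.
Fact unorm_cstar x : `|umul (ustar x) x| = `|x| ^+ 2.
Proof.
rewrite !rnormE !u_rnormE -rmorphXn; congr (_%:C).
elim/uclass_ind: x => a; rewrite -uclass_star -uclassM !unormE.
apply: bf_norm_lim; under eq_fun do rewrite rnorm_cstar expr2.
by rewrite expr2; apply: cvgM; exact: bf_norm_cvg.
Qed.

End Ultraproduct.

Section UltraproductComplete.
Variables (R : realType) (I : Type) (U : set_system I) (UU : UltraFilter U).
Variable B : I -> cstarAlgType R.
Local Notation ultra := (ultraproduct UU B).

Lemma ball_rnorm (A : normedModType R[i]) (x y : A) (e : R[i]) : 0 < e ->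
  ball x e y <-> rnorm (x - y) < complex.Re e.
Proof.
move=> e0; have -> : ball x e y = (`|x - y| < e) by rewrite -ball_normE.
by rewrite -{1}(RRe_real (gtr0_real e0)) rnormE ltcR.
Qed.

Let e n : R := 2^-1 ^+ n.

Let e_gt0 n : 0 < e n. Proof. by rewrite exprn_gt0. Qed.

Let eS n : e n = e n.+1 + e n.+1.
Proof. by rewrite /e exprS; lra. Qed.

Let e_lt (d : R) : 0 < d -> exists n, e n < d.
Proof.
move=> d0; have [n _ /(_ _ (leqnn n))] := near_infty_natSinv_expn_lt (PosNum d0).
by move=> /=; rewrite mul1r -exprVn; exists n.
Qed.

Section Telescope.
Variables (A : cstarAlgType R) (y : nat -> A).
Hypothesis yS : forall n, rnorm (y n.+1 - y n) <= e n + e n.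

Let y_dist n k : rnorm (y (n + k)%N - y n) <= 4 * e n - 4 * e (n + k)%N.
Proof.
elim: k => [|k ih]; first by rewrite addn0 !subrr rnorm0.
rewrite addnS -(subrK (y (n + k)%N) (y _.+1)) -addrA.
rewrite (le_trans (rnormD _ _))// (le_trans (lerD (yS _) ih))//.
by rewrite (eS (n + k)); lra.
Qed.

Lemma telescope_lim : exists z : A, forall n, rnorm (z - y n) <= 4 * e n.
Proof.
have y4 n m : (n <= m)%N -> rnorm (y m - y n) <= 4 * e n.
  move=> /subnKC <-; rewrite (le_trans (y_dist _ _))//.
  by have := e_gt0 (n + (m - n)); lra.
have yc : cvg (y n @[n --> \oo]).
  apply: cauchy_cvg; apply: cauchy_exP => d d0.
  have d0' : 0 < complex.Re d / 4.
    by move: d0; rewrite ltcE => /andP[_ /= h]; rewrite divr_gt0.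
  have [n en] := e_lt d0'; exists (y n); exists n => // m /= nm.
  apply/ball_rnorm => //; rewrite rnormB (le_lt_trans (y4 _ _ nm))//.
  by move: en; rewrite ltr_pdivlMr// mulrC.
exists (lim (y n @[n --> \oo])) => n; set z := lim _.
apply/ler_addgt0Pr => d d0.
have dC0 : 0 < d%:C by rewrite ltcR.
have /cvgrPdist_lt/(_ _ dC0)[N _ zN] := yc.
have := zN (maxn n N) (leq_maxr _ _); rewrite /= rnormE ltcR => zm.
rewrite -(subrK (y (maxn n N)) z) -addrA (le_trans (rnormD _ _))// [leRHS]addrC.
by rewrite lerD ?y4 ?leq_maxl// ltW.
Qed.

End Telescope.

Fact ultraproduct_complete (F : set_system ultra) :
  ProperFilter F -> cauchy F -> cvg F.
Proof.
move=> FF /cauchyP Fc.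
have /choice[x Fx] n : exists x : ultra, F (ball x (e n)%:C).
  by apply: Fc; rewrite ltcR.
have xS n : unorm (x n.+1 - x n) < e n + e n.
  have [w [/ball_rnorm wn /ball_rnorm wS]] :=
    @filter_ex _ F _ _ (filterI (Fx n) (Fx n.+1)).
  have {}wn : rnorm (x n - w) < e n by apply: wn; rewrite ltcR.
  have {}wS : rnorm (x n.+1 - w) < e n.+1 by apply: wS; rewrite ltcR.
  rewrite -u_rnormE -(subrK w (x n.+1)) -addrA (le_lt_trans (rnormD _ _))//.
  rewrite (rnormB w) addrC ltrD// (lt_trans wS)// (eS n).
  by rewrite ltrDl.
have /choice[d dP] n : exists d : bounded_family B,
    uclass UU d = x n.+1 - x n /\ forall i, rnorm (d i) <= e n + e n.
  by have [d ? ?] := unorm_lift (xS n); exists d.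
pose y n : bounded_family B := urepr (x 0%N) + \sum_(k < n) d k.
have yS n : y n.+1 = y n + d n by rewrite /y big_ord_recr /= addrA.
have xy n : uclass UU (y n) = x n.
  elim: n => [|n ih]; first by rewrite /y big_ord0 addr0 ureprK.
  by rewrite yS uclassD ih (dP n).1 addrC subrK.
have zex i : exists z : B i, forall n, rnorm (z - y n i) <= 4 * e n.
  apply: telescope_lim => n; rewrite yS.
  by rewrite [_ - _](_ : _ = d n i) ?(dP n).2//= addrC addKr.
pose z i := projT1 (cid (zex i)).
have zP i n : rnorm (z i - y n i) <= 4 * e n := projT2 (cid (zex i)) n.
have zB : exists M : R, forall i, rnorm (z i) <= M.
  have [M yM] := bfunP (y 0%N); exists (4 * e 0%N + M) => i.
  by rewrite -(subrK (y 0%N i) (z i)) (le_trans (rnormD _ _))// lerD.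
pose zb := BoundedFamily zB.
have zx n : unorm (uclass UU zb - x n) <= 4 * e n.
  by rewrite -xy -uclassB unormE; apply: bf_norm_le => i; exact: zP.
apply/cvg_ex; exists (uclass UU zb); apply/cvg_ballP => r r0.
have r0' : 0 < complex.Re r / 5.
  by move: r0; rewrite ltcE => /andP[_ /= h]; rewrite divr_gt0.
have [n en] := e_lt r0'; apply: filterS (Fx n) => w /ball_rnorm wn.
have {}wn : rnorm (x n - w) < e n by apply: wn; rewrite ltcR.
apply/ball_rnorm => //; rewrite -(subrK (x n) (uclass UU zb)) -addrA.
rewrite (le_lt_trans (rnormD _ _))//.
have := zx n; rewrite -u_rnormE => h.
by move: en; rewrite ltr_pdivlMr// => en; lra.
Qed.

HB.instance Definition _ := Uniform_isComplete.Build ultra ultraproduct_complete.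

HB.instance Definition _ := CompleteNormedModule_isCStarAlgebra.Build R ultra
  (@umulA _ _ _ UU B) (@umulDl _ _ _ UU B) (@umulDr _ _ _ UU B)
  (@umulZl _ _ _ UU B) (@umulZr _ _ _ UU B) (@ustarK _ _ _ UU B)
  (@ustarD _ _ _ UU B) (@ustarZ _ _ _ UU B) (@ustarM _ _ _ UU B)
  (@unormM _ _ _ UU B) (@unorm_cstar _ _ _ UU B).

End UltraproductComplete.

(* The language has no constant for an identity element, so the *-polynomials
   below have no constant term. *)
Inductive starpoly (R : realType) (n : nat) : Type :=
| SPvar of 'I_n
| SPadd of starpoly R n & starpoly R n
| SPscale of R[i] & starpoly R n
| SPmul of starpoly R n & starpoly R n
| SPstar of starpoly R n.

(* [formula R n] is the type of formulae with free variables among n given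
   ones. A quantifier binds the variable of index 0 of its body and shifts the
   others. *)
Inductive formula (R : realType) : nat -> Type :=
| Fnorm n of starpoly R n : formula R n
| Fconn n k (f : 'rV[R]_k -> R) of continuous f & ('I_k -> formula R n) :
    formula R n
| Fsup n of formula R n.+1 : formula R n
| Finf n of formula R n.+1 : formula R n.

Definition sentence (R : realType) := formula R 0.

Section Semantics.
Variables (R : realType) (A : cstarAlgType R).

Fixpoint starpoly_eval n (v : 'I_n -> A) (P : starpoly R n) : A :=
  match P with
  | SPvar i => v i
  | SPadd P Q => starpoly_eval v P + starpoly_eval v Q
  | SPscale k P => k *: starpoly_eval v P
  | SPmul P Q => starpoly_eval v P ** starpoly_eval v Q
  | SPstar P => star (starpoly_eval v P)
  end.

Definition vcons n (a : A) (v : 'I_n -> A) : 'I_n.+1 -> A :=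
  fun i => oapp v a (unlift ord0 i).

Fixpoint formula_eval n (phi : formula R n) : ('I_n -> A) -> R :=
  match phi with
  | Fnorm _ P => fun v => rnorm (starpoly_eval v P)
  | Fconn _ _ f _ psi => fun v => f (\row_j formula_eval (psi j) v)
  | Fsup _ psi => fun v =>
      sup [set formula_eval psi (vcons a v) | a in [set a : A | rnorm a <= 1]]
  | Finf _ psi => fun v =>
      inf [set formula_eval psi (vcons a v) | a in [set a : A | rnorm a <= 1]]
  end.

Definition sentence_value (phi : sentence R) : R :=
  formula_eval phi (fun=> 0).

End Semantics.

Definition elementarily_equivalent (R : realType) (A B : cstarAlgType R) :=
  forall phi : sentence R, sentence_value A phi = sentence_value B phi.

Definition finite_dimensional (R : realType) (A : cstarAlgType R) :=
  exists (n : nat) (b : 'I_n -> A), forall x : A,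
    exists c : 'I_n -> R[i], x = \sum_(i < n) c i *: b i.

(* The zero algebra is excluded: finite-dimensional C*-algebras are the nonempty
   direct sums of algebras M_n with n >= 1. *)
Definition pseudocompact (R : realType) (A : cstarAlgType R) :=
  exists (I : Type) (U : set_system I) (UU : UltraFilter U)
         (B : I -> cstarAlgType R),
    (forall i, finite_dimensional (B i) /\ exists x : B i, x != 0) /\
    elementarily_equivalent A (ultraproduct UU B).

Section UnitalNotions.
Variables (R : realType) (A : cstarAlgType R).

Definition is_identity (e : A) := forall x : A, e ** x = x /\ x ** e = x.

(* The notions below are those of the unital algebra A with identity e. *)
Variable e : A.

Definition invertible (x : A) := exists y : A, x ** y = e /\ y ** x = e.

Definition spectrum (x : A) : set R[i] :=
  [set z | ~ invertible (x - z *: e)].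

Definition real_rank_zero :=
  [set a : A | star a = a] `<=`
  closure [set b : A | star b = b /\ finite_set (spectrum b)].

Definition stable_rank_one := dense [set x : A | invertible x].

Section Matrices.
Variable n : nat.
Implicit Types V W : 'M[A]_n.

Definition mx_mul V W : 'M[A]_n := \matrix_(i, j) \sum_(k < n) V i k ** W k j.

Definition mx_star V : 'M[A]_n := \matrix_(i, j) star (V j i).

Definition mx_id : 'M[A]_n := \matrix_(i, j) (if i == j then e else 0).

Definition mx_finite :=
  forall V, mx_mul (mx_star V) V = mx_id -> mx_mul V (mx_star V) = mx_id.

End Matrices.

Definition stably_finite := forall n : nat, mx_finite n.

Definition tracial_state (tau : {scalar A}) :=
  [/\ forall a : A, 0 <= tau (star a ** a),
      tau e = 1
    & forall a b : A, tau (a ** b) = tau (b ** a)].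

End UnitalNotions.

(* Main.v *)
Require Import Defs.
From HB Require Import structures.
From mathcomp Require Import all_boot all_order all_algebra.
From mathcomp Require Import all_classical all_reals all_analysis.
From mathcomp Require Import complex.
From mathcomp Require Import ring lra.
From mathcomp Require separable.

Set Implicit Arguments.
Unset Strict Implicit.
Unset Printing Implicit Defensive.

Import Order.TTheory GRing.Theory Num.Theory numFieldNormedType.Exports.

Local Open Scope classical_set_scope.
Local Open Scope ring_scope.
Local Open Scope complex_scope.

(** Every property is obtained from bounds on sentences of continuous logic.
By the theorem of Los ([los]), a bound that a sentence satisfies in all nonzero
finite-dimensional C*-algebras passes to their ultraproducts, and therefore to
every pseudocompact algebra ([pseudocompact_transfer]). Formulae cannot name
the identity e; they see it through an additional variable z of the unit ball,
the distance of x to e being the supremum of the norms of x z - z.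

The finite-dimensional algebras have to satisfy bounds that do not depend on
the dimension. Two tools produce them: the spectral theorem for self-adjoint
elements ([fd_spectral]), which gives a functional calculus whose norm is the
supremum norm, and the normalized trace of the regular representation
([fd_trace]), a faithful tracial state.

A sentence only yields approximate statements in a pseudocompact algebra A, and
each property has its own way to make them exact.
- Identity: the elements of the unit ball that act as an identity up to 2^-n
  form a Cauchy sequence ([pseudocompact_unital]).
- Real rank zero: let q be the polynomial with simple roots at the points of a
  fine net of [-1, 1]. In finite dimension, rounding the eigenvalues gives zeros
  of q close to any self-adjoint contraction, so that A has self-adjoint
  elements b close to it with q(b) as small as desired. Newton's method turns b
  into a zero of q ([newton_zero]), whose spectrum consists of roots of q.
- Stable rank one: if u |b| is the polar decomposition of an invertible matrix,
  then u (|b| + d) is close to it and has an inverse of norm at most 1/d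
  ([fd_invertible_approx]). In A this gives elements with approximate inverses,
  and these elements are invertible by a Neumann series.
- Stable finiteness: for matrices V over a finite-dimensional algebra, the
  defect of V from being a coisometry is at most a constant times its defect
  from being an isometry ([fd_matrix_estimate]); hence in A the former vanishes
  when the latter does.
- Tracial state: by the finite-dimensional traces, e has distance at least 1 to
  the cone spanned by the commutators, the skew-adjoint elements and the
  opposites of the elements star u u. A functional that separates e from this
  cone ([cone_separation]) is the real part of a tracial state. *)

(** * Norms and real parts *)

Section ReNorm.
Variable R : realType.
Implicit Types w z : R[i].

Lemma renormE z : `|z| = (complex.Re `|z|)%:C.
Proof. by rewrite RRe_real// normr_real. Qed.

Lemma renormM w z : complex.Re `|w * z| = complex.Re `|w| * complex.Re `|z|.
Proof. by apply: (@complexI R); rewrite rmorphM -!renormE normrM. Qed.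

Lemma renorm1 : complex.Re `|1 : R[i]| = 1.
Proof. by rewrite normr1. Qed.

Lemma renormX z n : complex.Re `|z ^+ n| = complex.Re `|z| ^+ n.
Proof.
by elim: n => [|n ih]; rewrite ?expr0 ?renorm1// !exprS renormM ih.
Qed.

Lemma renorm_ge0 z : 0 <= complex.Re `|z|.
Proof. exact: (rnorm_ge0 (z : R[i]^o)). Qed.

Lemma renormR (t : R) : complex.Re `|t%:C| = `|t|.
Proof. by rewrite normc_def/= expr0n/= addr0 sqrtr_sqr. Qed.

End ReNorm.

Lemma rnormZr (R : realType) (A : normedModType R[i]) (t : R) (x : A) :
  rnorm (t%:C *: x) = `|t| * rnorm x.
Proof. by rewrite rnormZ renormR. Qed.

Lemma rnorm_sum (R : realType) (V : normedModType R[i]) (I : Type) (r : seq I) (F : I -> V) :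
  rnorm (\sum_(i <- r) F i) <= \sum_(i <- r) rnorm (F i).
Proof.
elim/big_ind2: _ => [|x1 x2 y1 y2 h1 h2|//]; first by rewrite rnorm0.
by rewrite (le_trans (rnormD _ _))// lerD.
Qed.

Lemma ler_sum2 (R : numDomainType) (I J : finType) (F : I -> J -> R) i j :
  (forall i j, 0 <= F i j) -> F i j <= \sum_i \sum_j F i j.
Proof.
move=> F0; rewrite (bigD1 i)//= (bigD1 j)//= -addrA lerDl addr_ge0 ?sumr_ge0//.
by move=> k _; exact: sumr_ge0.
Qed.

(** By Bernoulli's inequality a constant factor cannot
compensate an exponential gap between powers. The exponents are powers of two
because the C*-identity computes the norms of these powers only. *)
Lemma le_of_pow2_bound (R : realType) (x y m : R) : 0 <= x -> 0 <= y ->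
  (forall k, x ^+ (2 ^ k)%N <= m * y ^+ (2 ^ k)%N) -> x <= y.
Proof.
move=> x0 y0 xy; rewrite leNgt; apply/negP => yx.
have x_gt0 : 0 < x := le_lt_trans y0 yx.
case: (eqVneq y 0) xy yx => [->|yn0] xy yx.
  by have := xy 0%N; rewrite !expr1 mulr0 leNgt x_gt0.
have y_gt0 : 0 < y by rewrite lt_neqAle eq_sym yn0.
pose d := x / y - 1.
have d0 : 0 < d by rewrite subr_gt0 ltr_pdivlMr// mul1r.
have bern N : 1 + d *+ N <= (x / y) ^+ N.
  elim: N => [|N ih]; first by rewrite mulr0n addr0.
  have xy1 : 0 <= x / y by rewrite divr_ge0.
  rewrite exprS (le_trans _ (ler_wpM2l xy1 ih))//.
  have -> : x / y = 1 + d by rewrite /d addrC subrK.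
  have : 0 <= d * (d *+ N) by rewrite mulr_ge0 ?mulrn_wge0 ?ltW.
  by rewrite mulrS; set D := d *+ N => dD; lra.
have mbound k : d *+ k <= m.
  have : (x / y) ^+ (2 ^ k) <= m.
    by rewrite expr_div_n ler_pdivrMr ?exprn_gt0// xy.
  apply: le_trans; apply: le_trans (bern _).
  rewrite -[leLHS]add0r lerD//.
  by rewrite ler_pMn2l// ltnW// ltn_expl.
have [k mk] : exists k : nat, m / d < k%:R.
  exists (Num.bound `|m / d|); apply: le_lt_trans (ler_norm _) _.
  by rewrite archi_boundP.
by have := mbound k; rewrite leNgt -mulr_natl -ltr_pdivrMr// mk.
Qed.

Lemma le0_of_geometric (R : realType) (t K : R) :
  (forall n, t <= K * 2^-1 ^+ n) -> t <= 0.
Proof.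
move=> tK; apply/ler_addgt0Pl => d d0; rewrite addr0.
have K1 : 0 < `|K| + 1 by rewrite ltr_pwDr.
have d' : 0 < d / (`|K| + 1) by rewrite divr_gt0.
have [n _ /(_ _ (leqnn n))] := near_infty_natSinv_expn_lt (PosNum d').
rewrite /= mul1r -exprVn ltr_pdivlMr// mulrC => nd.
apply: le_trans (tK n) _; apply: le_trans (ltW nd).
rewrite ler_wpM2r ?exprn_ge0//.
by rewrite (le_trans (ler_norm K))// lerDl.
Qed.

Lemma scale_to_ball (R : realType) (A : cstarAlgType R) (x : A) (K : R) : 0 < K ->
  rnorm x <= K -> exists2 y : A, rnorm y <= 1 & x = K%:C *: y.
Proof.
move=> K0 xK; exists (K^-1%:C *: x).
  by rewrite rnormZr ger0_norm ?invr_ge0 ?(ltW K0)// ler_pdivrMl// mulr1.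
by rewrite scalerA -rmorphM mulfV ?gt_eqF// rmorph1 scale1r.
Qed.

Lemma nbhs_rnorm (R : realType) (A : normedModType R[i]) (a : A) (B : set A) : nbhs a B ->
  exists2 r : R, 0 < r & forall b, rnorm (a - b) < r -> B b.
Proof.
move=> /nbhs_ballP[r /= r0 aB]; exists (complex.Re r).
  by move: r0; rewrite ltcE => /andP[].
by move=> b ab; apply: aB; apply/ball_rnorm.
Qed.

Section Star.
Variables (R : realType) (A : cstarAlgType R).

Lemma cstar0 : star (0 : A) = 0.
Proof. by rewrite -(scale0r (0 : A)) starZ rmorph0 !scale0r. Qed.

Lemma cs_mul0l (x : A) : 0 ** x = 0.
Proof. by rewrite -(scale0r (0 : A)) cs_mulZl !scale0r. Qed.

Lemma cs_mul0r (x : A) : x ** 0 = 0.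
Proof. by rewrite -(scale0r (0 : A)) cs_mulZr !scale0r. Qed.

Lemma star_cs_mul_eq0 (x : A) : star x ** x = 0 -> x = 0.
Proof.
move=> x0; apply: rnorm0_eq0; apply/eqP; rewrite -sqrf_eq0.
by rewrite -rnorm_cstar x0 rnorm0.
Qed.

End Star.

Section RealImaginaryParts.
Variables (R : realType) (A : cstarAlgType R).
Local Notation C := R[i].
Implicit Types x : A.

Definition repart (x : A) : A := 2^-1 *: (x + star x).
Definition impart (x : A) : A := (- 'i%C / 2) *: (x - star x).

Lemma conj_half : conjc (2^-1 : C) = 2^-1.
Proof. by rewrite fmorphV rmorph_nat. Qed.

Lemma star_repart x : star (repart x) = repart x.
Proof. by rewrite starZ conj_half starD starK addrC. Qed.

Lemma star_impart x : star (impart x) = impart x.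
Proof.
rewrite starZ starB starK -(opprB x) scalerN -scaleNr; congr (_ *: _).
have conjM (z w : C) : conjc (z * w) = conjc z * conjc w by exact: rmorphM.
rewrite conjM conj_half -mulNr; congr (_ * _). by simpc.
Qed.

Lemma repartD_impart x : x = repart x + 'i%C *: impart x.
Proof.
rewrite /repart /impart scalerA.
have -> : 'i%C * (- 'i%C / 2) = 2^-1 :> C.
  by rewrite mulrA mulrN -expr2 sqr_i opprK mul1r.
rewrite -scalerDr addrACA subrr addr0.
have -> : x + x = 2 *: x by rewrite scaler_nat mulr2n.
by rewrite scalerA mulVf ?scale1r// pnatr_eq0.
Qed.

Lemma repart_sa x : star x = x -> repart x = x.
Proof.
move=> sx; rewrite /repart sx.
have -> : x + x = 2 *: x by rewrite scaler_nat mulr2n.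
by rewrite scalerA mulVf ?scale1r// pnatr_eq0.
Qed.

Lemma rnorm_repart x : rnorm (repart x) <= rnorm x.
Proof.
rewrite rnormZ.
have -> : complex.Re `|2^-1 : C| = 2^-1.
  have -> : (2^-1 : C) = (2^-1 : R)%:C by rewrite fmorphV rmorph_nat.
  by rewrite renormR ger0_norm.
rewrite ler_pdivrMl//; apply: le_trans (rnormD _ _) _.
by rewrite rnorm_star; lra.
Qed.

End RealImaginaryParts.

(** * The theorem of Los *)

Section Los.
Variable R : realType.

Lemma starpoly_bounded n (P : starpoly R n) (M : R) :
  exists C : R, forall (A : cstarAlgType R) (v : 'I_n -> A),
    (forall i, rnorm (v i) <= M) -> rnorm (starpoly_eval v P) <= C.
Proof.
elim: P => [i|P [C PC] Q [D QD]|k P [C PC]|P [C PC] Q [D QD]|P [C PC]].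
- by exists M => A v vM; exact: vM.
- exists (C + D) => A v vM /=.
  by rewrite (le_trans (rnormD _ _))// lerD ?PC ?QD.
- exists (complex.Re `|k| * C) => A v vM /=.
  by rewrite rnormZ ler_wpM2l ?PC// (rnorm_ge0 (k : R[i]^o)).
- exists (C * D) => A v vM /=.
  by rewrite (le_trans (rnormM _ _))// ler_pM ?rnorm_ge0 ?PC ?QD.
- by exists C => A v vM /=; rewrite rnorm_star PC.
Qed.

Lemma vcons_bounded n (A : cstarAlgType R) (a : A) (v : 'I_n -> A) (M : R) :
  rnorm a <= 1 -> (forall i, rnorm (v i) <= M) ->
  forall i, rnorm (vcons a v i) <= Num.max 1 M.
Proof.
move=> a1 vM i; rewrite /vcons le_max.
by case: unlift => [j|] /=; rewrite ?vM ?a1 ?orbT.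
Qed.

Lemma sup_norm_le (T : Type) (D : set T) (f : T -> R) (C : R) :
  D !=set0 -> (forall x, D x -> `|f x| <= C) ->
  has_sup [set f x | x in D] /\ `|sup [set f x | x in D]| <= C.
Proof.
move=> [x0 Dx0] fC.
have ub : ubound [set f x | x in D] C.
  by move=> _ [x Dx <-]; rewrite (le_trans (ler_norm _))// fC.
have hs : has_sup [set f x | x in D].
  by split; [exists (f x0), x0 | exists C].
split=> //; rewrite ler_norml ge_sup ?andbT//; last by case: hs.
have := fC _ Dx0; rewrite ler_norml => /andP[+ _] => /le_trans; apply.
by apply: ub_le_sup; [case: hs | exists x0].
Qed.

Lemma image_oppr (T : Type) (D : set T) (f : T -> R) :
  [set - y | y in [set f x | x in D]] = [set - f x | x in D].
Proof. by rewrite image_comp. Qed.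

Lemma inf_norm_le (T : Type) (D : set T) (f : T -> R) (C : R) :
  D !=set0 -> (forall x, D x -> `|f x| <= C) ->
  has_inf [set f x | x in D] /\ `|inf [set f x | x in D]| <= C.
Proof.
move=> D0 fC; rewrite /inf -has_inf_supN image_oppr normrN.
by apply: sup_norm_le => // x Dx; rewrite normrN fC.
Qed.

Lemma ball_nonempty (A : cstarAlgType R) : [set a : A | rnorm a <= 1] !=set0.
Proof. by exists 0; rewrite /= rnorm0. Qed.

(** The bound is uniform over all algebras, so that the values
of a formula along a bounded family stay bounded. For a connective it comes from
the compactness of the box that contains the values of the subformulae. *)
Lemma formula_bounded n (phi : formula R n) (M : R) :
  exists C : R, forall (A : cstarAlgType R) (v : 'I_n -> A),
    (forall i, rnorm (v i) <= M) -> `|formula_eval phi v| <= C.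
Proof.
elim: phi M => {n} [n P|n k f fc psi ih|n psi ih|n psi ih] M.
- have [C PC] := starpoly_bounded P M; exists C => A v vM /=.
  by rewrite ger0_norm ?rnorm_ge0 ?PC.
- have /choice[C psiC] := fun j => ih j M.
  pose K := [set w : 'rV[R]_k | forall j, `[- C j, C j]%classic (w ord0 j)].
  have cK : compact K.
    exact: (rV_compact (A := fun j => `[- C j, C j]%classic))
      (fun j => @segment_compact _ _ _).
  have : compact (f @` K).
    by apply: continuous_compact cK; exact: continuous_subspaceT.
  move=> /compact_bounded[D [_ fD]]; exists (D + 1) => A v vM /=.
  apply: (fD (D + 1)); first by rewrite ltrDl.
  eexists; last by reflexivity.
  move=> j /=; rewrite mxE in_itv/= -ler_norml.
  exact: psiC.
- have [C psiC] := ih (Num.max 1 M); exists C => A v vM /=.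
  apply: (sup_norm_le (ball_nonempty A) _).2 => a a1.
  by apply: psiC => i; exact: vcons_bounded.
- have [C psiC] := ih (Num.max 1 M); exists C => A v vM /=.
  apply: (inf_norm_le (ball_nonempty A) _).2 => a a1.
  by apply: psiC => i; exact: vcons_bounded.
Qed.

Section Ultra.
Variables (I : Type) (U : set_system I) (UU : UltraFilter U).
Variable B : I -> cstarAlgType R.
Local Notation ultra := (ultraproduct UU B).

(** Shrinking the members of norm larger than M does not change
the class, since their norms tend to a limit which is at most M. This is what
lets a quantifier over the closed unit ball of the ultraproduct be read
componentwise. *)
Lemma unorm_lift_le (x : ultra) (M : R) : 0 < M -> unorm x <= M ->
  exists2 a : bounded_family B, uclass UU a = x & forall i, rnorm (a i) <= M.
Proof.
move=> M0; elim/uclass_ind: x => a; rewrite unormE => aM.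
pose m i := Num.max M (rnorm (a i)).
have mM i : M <= m i by rewrite /m le_max lexx.
have m0 i : 0 < m i := lt_le_trans M0 (mM i).
pose k i := M / m i.
have fM i : rnorm ((k i)%:C *: a i) <= M.
  rewrite rnormZr ger0_norm; last by rewrite divr_ge0 ?ltW.
  rewrite mulrAC ler_pdivrMr//.
  by rewrite ler_wpM2l ?(ltW M0)// /m le_max lexx orbT.
pose b := BoundedFamily (ex_intro _ M fM).
exists b => //; apply/uclassP/bf_nullP.
have rcvg : `|rnorm (a i) - bf_norm U a| @[i --> U] --> (0 : R).
  apply/norm_cvg0P; rewrite -(subrr (bf_norm U a)).
  by apply: cvgB; [exact: bf_norm_cvg|exact: cvg_cst].
apply: (squeeze_cvgr _ (cvg_cst 0) rcvg).
apply: nearW => i; rewrite rnorm_ge0/=.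
  rewrite [X in rnorm X](_ : _ = (k i)%:C *: a i - a i)//.
  rewrite -[X in _ - X]scale1r -scalerBl.
  have -> : (k i)%:C - 1 = (k i - 1)%:C by rewrite rmorphB.
  rewrite rnormZr; have k1 : k i - 1 <= 0 by rewrite subr_le0 ler_pdivrMr ?mul1r.
  rewrite ler0_norm// opprB.
  apply: (@le_trans _ _ (m i - M)).
  have -> : m i - M = (1 - k i) * m i.
    by rewrite mulrBl mul1r /k divfK// gt_eqF.
  apply: ler_wpM2l; first by rewrite subr_ge0 -subr_le0.
  by rewrite /m le_max lexx orbT.
rewrite /m; case: (leP M (rnorm (a i))) => _; last by rewrite subrr normr_ge0.
by apply: le_trans (ler_norm _); rewrite lerB.
Qed.

(** The limit of the suprema is attained up to d by a family of
almost optimal points, which is itself a point of the ultraproduct. *)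
Lemma ultra_sup (F : forall i, B i -> R) (G : ultra -> R) (C : R) :
  (forall i (a : B i), rnorm a <= 1 -> `|F i a| <= C) ->
  (forall x : ultra, rnorm x <= 1 -> `|G x| <= C) ->
  (forall a : bounded_family B,
     F i (a i) @[i --> U] --> G (uclass UU a)) ->
  sup [set F i a | a in [set a : B i | rnorm a <= 1]] @[i --> U] -->
  sup [set G x | x in [set x : ultra | rnorm x <= 1]].
Proof.
move=> FC GC FG.
pose S i := sup [set F i a | a in [set a : B i | rnorm a <= 1]].
have [SC sF] : (forall i, `|S i| <= C) /\
    (forall i, has_sup [set F i a | a in [set a : B i | rnorm a <= 1]]).
  by split=> i; have [] := sup_norm_le (ball_nonempty (B i)) (FC i).
have [sG _] := sup_norm_le (ball_nonempty ultra) GC.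
have Scvg : cvg (S i @[i --> U]).
  pose L := lim (S i + C @[i --> U]).
  apply/cvg_ex; exists (L - C).
  have h : S i + C @[i --> U] --> L.
    apply: (@ultra_lim_cvg _ _ _ _ _ (C + C)) => i.
    have := SC i; rewrite ler_norml => /andP[h1 h2].
    by apply/andP; split; lra.
  have -> : S = (fun i => S i + C - C) by apply/funext => i; rewrite addrK.
  by apply: cvgB => //; exact: cvg_cst.
suff <- : lim (S i @[i --> U]) = sup [set G x | x in [set x : ultra | rnorm x <= 1]].
  exact: Scvg.
apply/eqP; rewrite eq_le; apply/andP; split; last first.
  apply: ge_sup; first by case: sG.
  move=> _ [x /= x1 <-].
  have [a ax a1] := unorm_lift_le ltr01 x1.
  rewrite -ax; apply: (ultra_cvg_le UU (FG a) Scvg) => i.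
  by apply: ub_le_sup; [case: (sF i) | exists (a i) => //; exact: a1].
apply/ler_addgt0Pr => d d0.
have exa i : exists a : B i, rnorm a <= 1 /\ S i - d <= F i a.
  have [_ [a a1 <-] /ltW ?] := sup_adherent d0 (sF i).
  by exists a.
pose a i := projT1 (cid (exa i)).
have aP i : rnorm (a i) <= 1 /\ S i - d <= F i (a i) := projT2 (cid (exa i)).
have a1 i : rnorm (a i) <= 1 := (aP i).1.
pose b : bounded_family B := BoundedFamily (ex_intro _ 1 a1).
have b1 : rnorm (uclass UU b : ultra) <= 1.
  by rewrite u_rnormE unormE; apply: bf_norm_le => i; case: (aP i).
rewrite -lerBlDr.
have h : S i - d @[i --> U] --> lim (S i @[i --> U]) - d.
  by apply: cvgB Scvg _; exact: cvg_cst.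
apply: (le_trans (ultra_cvg_le UU h (FG b) (fun i => (aP i).2))).
by apply: ub_le_sup; [case: sG | exists (uclass UU b) => //; exact: b1].
Qed.

Lemma starpoly_uclass n (P : starpoly R n) (v : 'I_n -> bounded_family B) :
  exists2 b : bounded_family B,
    starpoly_eval (fun j => uclass UU (v j) : ultra) P = uclass UU b &
    forall i, b i = starpoly_eval (fun j => v j i) P.
Proof.
elim: P => [j|P [a aP ai] Q [b bP bi]|k P [a aP ai]
  |P [a aP ai] Q [b bP bi]|P [a aP ai]] /=.
- by exists (v j).
- by exists (a + b) => [|i]; rewrite ?aP ?bP ?uclassD//= ai bi.
- by exists (k *: a) => [|i]; rewrite ?aP ?uclassZ//= ai.
- by exists (bfM a b) => [|i]; rewrite ?aP ?bP ?uclassM//= ai bi.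
- by exists (bf_star a) => [|i]; rewrite ?aP ?uclass_star//= ai.
Qed.

Lemma vcons_uclass n (a : bounded_family B) (v : 'I_n -> bounded_family B) i :
  (fun j => (oapp v a (unlift ord0 j) : bounded_family B) i) =
  vcons (a i) (fun j => v j i).
Proof. by apply/funext => j; rewrite /vcons; case: unlift. Qed.

(** Atomic formulae are handled by the definition of the operations and of
the norm on classes, connectives by continuity, quantifiers by [ultra_sup]. *)
Theorem los n (phi : formula R n) (v : 'I_n -> bounded_family B) :
  formula_eval phi (fun j => v j i) @[i --> U] -->
  formula_eval phi (fun j => uclass UU (v j) : ultra).
Proof.
have bnd m (w : 'I_m -> bounded_family B) :
    exists M : R, (forall i j, rnorm (w j i) <= M) /\
      (forall j, rnorm (uclass UU (w j) : ultra) <= M).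
  have /choice[M wM] := fun j => bfunP (w j).
  have leM j : M j <= \sum_k `|M k|.
    rewrite (bigD1 j)//= (le_trans (ler_norm _))// lerDl.
    by apply: sumr_ge0 => *; exact: normr_ge0.
  exists (\sum_k `|M k|); split=> [i j|j]; first exact: le_trans (wM j i) _.
  rewrite u_rnormE unormE; apply: bf_norm_le => i.
  exact: le_trans (wM j i) _.
elim: phi v => {n} [n P|n k f fc psi ih|n psi ih|n psi ih] v /=.
- have [b bP bi] := starpoly_uclass P v; rewrite bP u_rnormE unormE.
  by under eq_fun do rewrite -bi; exact: bf_norm_cvg.
- apply: continuous_cvg; first exact: fc.
  apply/cvg_ballP => e e0.
  have : \forall i \near U, forall j, ball
      (formula_eval (psi j) (fun j => uclass UU (v j) : ultra)) e
      (formula_eval (psi j) (fun j => v j i)).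
    by apply: filter_forall => j; move/cvg_ballP: (ih j v) => /(_ e e0).
  by apply: filterS => i h; split=> // j l; rewrite !mxE; exact: h.
- have [M [vM uM]] := bnd _ v.
  have [C psiC] := formula_bounded psi (Num.max 1 M).
  apply: (@ultra_sup _ _ C) => [i a a1|x x1|a].
  + by apply: psiC; apply: vcons_bounded.
  + by apply: psiC; apply: vcons_bounded.
  + have := ih (fun j => oapp v a (unlift ord0 j)).
    under eq_fun do rewrite vcons_uclass.
    congr (_ --> nbhs (formula_eval _ _)).
    by apply/funext => j; rewrite /vcons; case: unlift.
- have [M [vM uM]] := bnd _ v.
  have [C psiC] := formula_bounded psi (Num.max 1 M).
  rewrite /inf image_oppr; under eq_fun do rewrite /inf image_oppr.
  apply: cvgN; apply: (@ultra_sup (fun i a => - formula_eval psi (vcons a (fun j => v j i)))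
    (fun x => - formula_eval psi (vcons x _)) C) => [i a a1|x x1|a].
  + by rewrite normrN; apply: psiC; apply: vcons_bounded.
  + by rewrite normrN; apply: psiC; apply: vcons_bounded.
  + apply: cvgN; have := ih (fun j => oapp v a (unlift ord0 j)).
    under eq_fun do rewrite vcons_uclass.
    congr (_ --> nbhs (formula_eval _ _)).
    by apply/funext => j; rewrite /vcons; case: unlift.
Qed.

Corollary los_sentence (phi : sentence R) :
  sentence_value (B i) phi @[i --> U] --> sentence_value ultra phi.
Proof.
have := @los _ phi (fun=> 0).
by congr (_ --> nbhs (formula_eval _ _)); apply/funext => -[].
Qed.

End Ultra.

Lemma pseudocompact_le (A : cstarAlgType R) (phi : sentence R) (c : R) :
  pseudocompact A ->
  (forall B : cstarAlgType R, finite_dimensional B -> (exists x : B, x != 0) ->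
     sentence_value B phi <= c) ->
  sentence_value A phi <= c.
Proof.
move=> [I [U [UU [B [fdB AB]]]]] phic; rewrite AB.
apply: (ultra_cvg_le UU (@los_sentence _ _ UU B phi) (cvg_cst c)) => i.
by apply: phic; case: (fdB i).
Qed.

End Los.

(** * Definable functions and transfer *)

Section Definability.
Variable R : realType.

(** Terms and formulae are handled through the functions that
they define in all algebras at once, so that their syntax with de Bruijn indices
need not be displayed. *)
Definition term_definable n (G : forall A : cstarAlgType R, ('I_n -> A) -> A) :=
  exists P : starpoly R n, forall A v, starpoly_eval v P = G A v.

Definition definable n (F : forall A : cstarAlgType R, ('I_n -> A) -> R) :=
  exists phi : formula R n, forall A v, formula_eval phi v = F A v.

Lemma term_var n (i : 'I_n) : term_definable (fun A v => v i).
Proof. by exists (SPvar R i). Qed.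

Lemma term_add n (G H : forall A : cstarAlgType R, ('I_n -> A) -> A) :
  term_definable G -> term_definable H ->
  term_definable (fun A v => G A v + H A v).
Proof. by move=> [P PG] [Q QH]; exists (SPadd P Q) => A v /=; rewrite PG QH. Qed.

Lemma term_scale n (k : R[i]) (G : forall A : cstarAlgType R, ('I_n -> A) -> A) :
  term_definable G -> term_definable (fun A v => k *: G A v).
Proof. by move=> [P PG]; exists (SPscale k P) => A v /=; rewrite PG. Qed.

Lemma term_sub n (G H : forall A : cstarAlgType R, ('I_n -> A) -> A) :
  term_definable G -> term_definable H ->
  term_definable (fun A v => G A v - H A v).
Proof.
move=> [P PG] [Q QH]; exists (SPadd P (SPscale (-1) Q)) => A v /=.
by rewrite PG QH scaleN1r.
Qed.

Lemma term_mul n (G H : forall A : cstarAlgType R, ('I_n -> A) -> A) :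
  term_definable G -> term_definable H ->
  term_definable (fun A v => G A v ** H A v).
Proof. by move=> [P PG] [Q QH]; exists (SPmul P Q) => A v /=; rewrite PG QH. Qed.

Lemma term_star n (G : forall A : cstarAlgType R, ('I_n -> A) -> A) :
  term_definable G -> term_definable (fun A v => star (G A v)).
Proof. by move=> [P PG]; exists (SPstar P) => A v /=; rewrite PG. Qed.

Lemma term_zero n : term_definable (fun A (v : 'I_n.+1 -> A) => 0).
Proof. by exists (SPscale 0 (SPvar R ord0)) => A v /=; rewrite scale0r. Qed.

Lemma term_sum n (T : Type) (r : seq T)
    (G : T -> forall A : cstarAlgType R, ('I_n.+1 -> A) -> A) :
  (forall t, term_definable (G t)) ->
  term_definable (fun A v => \sum_(t <- r) G t A v).
Proof.
move=> Gdef; elim: r => [|t r [P Pr]].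
  by have [P P0] := term_zero n; exists P => A v; rewrite big_nil P0.
have [Q Qt] := Gdef t; exists (SPadd Q P) => A v /=.
by rewrite big_cons Pr Qt.
Qed.

Lemma definable_norm n (G : forall A : cstarAlgType R, ('I_n -> A) -> A) :
  term_definable G -> definable (fun A v => rnorm (G A v)).
Proof. by move=> [P PG]; exists (Fnorm P) => A v /=; rewrite PG. Qed.

Lemma definable_scale n (F : forall A : cstarAlgType R, ('I_n -> A) -> R)
    (c : R) : definable F -> definable (fun A v => c * F A v).
Proof.
move=> [phi phiF].
have fc : continuous (fun w : 'rV[R]_1 => c * w ord0 ord0).
  move=> w; have wF : Filter (nbhs w) := nbhs_filter w.
  exact: (cvgM (cvg_cst c) (@coord_continuous _ _ _ _ _ w)).
exists (Fconn fc (fun=> phi)) => A v /=.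
by rewrite mxE phiF.
Qed.

Lemma definable_add n (F G : forall A : cstarAlgType R, ('I_n -> A) -> R) :
  definable F -> definable G -> definable (fun A v => F A v + G A v).
Proof.
move=> [phi phiF] [psi psiG].
have fc : continuous (fun w : 'rV[R]_2 => w ord0 ord0 + w ord0 ord_max).
  move=> w; have wF : Filter (nbhs w) := nbhs_filter w.
  apply: (@cvgD _ _ _ (nbhs w) wF _ _ _ _ _ (@coord_continuous _ _ _ _ _ w)).
  exact: coord_continuous.
exists (Fconn fc (fun j => if j == ord0 then phi else psi)) => A v /=.
by rewrite !mxE /= phiF psiG.
Qed.

Lemma definable_const n (c : R) :
  definable (fun (A : cstarAlgType R) (v : 'I_n -> A) => c).
Proof.
have fc : continuous (fun w : 'rV[R]_0 => c) by move=> w; apply: cst_continuous.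
by exists (Fconn fc (fun j => match (valP j) : false with end)).
Qed.

Lemma definable_sum n (T : Type) (r : seq T)
    (F : T -> forall A : cstarAlgType R, ('I_n -> A) -> R) :
  (forall t, definable (F t)) ->
  definable (fun A v => \sum_(t <- r) F t A v).
Proof.
move=> Fdef; elim: r => [|t r Pr].
  by have [P P0] := definable_const n 0; exists P => A v; rewrite big_nil P0.
have [P PF] := definable_add (Fdef t) Pr; exists P => A v.
by rewrite big_cons PF.
Qed.

Definition sup_ball (A : cstarAlgType R) (f : A -> R) : R :=
  sup [set f a | a in [set a : A | rnorm a <= 1]].

Definition inf_ball (A : cstarAlgType R) (f : A -> R) : R :=
  inf [set f a | a in [set a : A | rnorm a <= 1]].

Lemma definable_sup n (F : forall A : cstarAlgType R, ('I_n.+1 -> A) -> R) :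
  definable F -> definable (fun A v => sup_ball (fun a => F A (vcons a v))).
Proof.
move=> [phi phiF]; exists (Fsup phi) => A v /=; rewrite /sup_ball.
by congr sup; apply: eq_imagel => a _; rewrite phiF.
Qed.

Lemma definable_inf n (F : forall A : cstarAlgType R, ('I_n.+1 -> A) -> R) :
  definable F -> definable (fun A v => inf_ball (fun a => F A (vcons a v))).
Proof.
move=> [phi phiF]; exists (Finf phi) => A v /=; rewrite /inf_ball.
by congr inf; apply: eq_imagel => a _; rewrite phiF.
Qed.

Lemma definable_ball_bounded n
    (F : forall A : cstarAlgType R, ('I_n.+1 -> A) -> R)
    (A : cstarAlgType R) (v : 'I_n -> A) :
  definable F -> exists C, forall a, rnorm a <= 1 -> `|F A (vcons a v)| <= C.
Proof.
move=> [phi phiF]; pose M : R := \sum_j rnorm (v j).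
have [C phiC] := formula_bounded phi (Num.max 1 M).
exists C => a a1; rewrite -phiF; apply: phiC; apply: vcons_bounded => // i.
rewrite /M (bigD1 i)//= lerDl; apply: sumr_ge0 => j _; exact: rnorm_ge0.
Qed.

Lemma sup_ball_leP n (F : forall A : cstarAlgType R, ('I_n.+1 -> A) -> R)
    (A : cstarAlgType R) (v : 'I_n -> A) (c : R) : definable F ->
  sup_ball (fun a => F A (vcons a v)) <= c <->
  forall a, rnorm a <= 1 -> F A (vcons a v) <= c.
Proof.
move=> /(definable_ball_bounded v)[C FC].
have [hs _] := sup_norm_le (ball_nonempty A) FC.
split=> [supc a a1|Fc]; last first.
  by apply: ge_sup => [|_ [a a1 <-]]; [case: hs | exact: Fc].
by rewrite (le_trans _ supc)//; apply: ub_le_sup; [case: hs | exists a].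
Qed.

Lemma inf_ball_leP n (F : forall A : cstarAlgType R, ('I_n.+1 -> A) -> R)
    (A : cstarAlgType R) (v : 'I_n -> A) (c : R) : definable F ->
  inf_ball (fun a => F A (vcons a v)) <= c <->
  forall e, 0 < e -> exists2 a, rnorm a <= 1 & F A (vcons a v) <= c + e.
Proof.
move=> /(definable_ball_bounded v)[C FC].
have [hi _] := inf_norm_le (ball_nonempty A) FC.
split=> [infc e e0|Fc].
  have [_ [a a1 <-] /ltW Fa] := inf_adherent e0 hi.
  by exists a => //; rewrite (le_trans Fa)// lerD2r.
apply/ler_addgt0Pr => e e0; have [a a1] := Fc e e0; apply: le_trans.
by apply: ge_inf; [case: hi | exists a].
Qed.

Lemma vcons0 n (A : cstarAlgType R) (a : A) (v : 'I_n -> A) :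
  vcons a v ord0 = a.
Proof. by rewrite /vcons unlift_none. Qed.

Lemma vconsS n (A : cstarAlgType R) (a : A) (v : 'I_n -> A) i :
  vcons a v (lift ord0 i) = v i.
Proof. by rewrite /vcons liftK. Qed.

Lemma vcons_head_tail n (A : cstarAlgType R) (v : 'I_n.+1 -> A) :
  vcons (v ord0) (fun i => v (lift ord0 i)) = v.
Proof.
apply/funext => i; case: (unliftP ord0 i) => [j ->|->].
  by rewrite vconsS.
by rewrite vcons0.
Qed.

(** Quantifying the free variables by suprema turns a
bound over the unit balls into a bound on a sentence. *)
Lemma pseudocompact_transfer (A : cstarAlgType R) n
    (F : forall A : cstarAlgType R, ('I_n -> A) -> R) (c : R) :
  pseudocompact A -> definable F ->
  (forall B : cstarAlgType R, finite_dimensional B -> (exists x : B, x != 0) ->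
     forall v : 'I_n -> B, (forall i, rnorm (v i) <= 1) -> F B v <= c) ->
  forall v : 'I_n -> A, (forall i, rnorm (v i) <= 1) -> F A v <= c.
Proof.
move=> Apc; elim: n F => [|n ih] F Fdef Fc v v1.
  have [phi phiF] := Fdef; rewrite -phiF.
  have -> : v = (fun=> 0) by apply/funext => -[].
  apply: pseudocompact_le => // B fdB B0; rewrite /sentence_value phiF.
  by apply: Fc => // -[].
rewrite -(vcons_head_tail v); apply: (sup_ball_leP _ _ Fdef).1 (v1 ord0).
apply: (ih _ (definable_sup Fdef)) => [B fdB B0 w w1|i]; last exact: v1.
apply/sup_ball_leP => // a a1; apply: Fc => // i.
case: (unliftP ord0 i) => [j ->|->]; first by rewrite vconsS.
by rewrite vcons0.
Qed.

End Definability.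

(** * Unital C*-algebras as algebras over the complex numbers *)

Section UnitalAlg.
Variables (R : realType) (A : cstarAlgType R) (e : A).
Hypotheses (e1 : is_identity e) (e0 : e != 0).

(** A copy of A that carries a structure of algebra over the complex
numbers, which gives access to the evaluation of polynomials and to the product
of matrices. It depends on a proof that e is nonzero because polynomials are
evaluated in nontrivial rings only. *)
Definition unital_alg & is_identity e & e != 0 : Type := A.
Local Notation U := (unital_alg e1 e0).

HB.instance Definition _ := CStarAlgebra.copy U A.

Fact unital_mul1 : left_id (e : U) (@cs_mul R U).
Proof. by move=> x; case: (e1 x). Qed.
Fact unital_mulr1 : right_id (e : U) (@cs_mul R U).
Proof. by move=> x; case: (e1 x). Qed.

HB.instance Definition _ := GRing.Zmodule_isNzRing.Build U
  (@cs_mulA R U) unital_mul1 unital_mulr1 (@cs_mulDl R U) (@cs_mulDr R U) e0.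

Fact unital_scaleAl (k : R[i]) (x y : U) : k *: (x * y) = (k *: x) * y.
Proof. by rewrite -[RHS]/((k *: x) ** y) cs_mulZl. Qed.
Fact unital_scaleAr (k : R[i]) (x y : U) : k *: (x * y) = x * (k *: y).
Proof. by rewrite -[RHS]/(x ** (k *: y)) cs_mulZr. Qed.

HB.instance Definition _ := GRing.Lmodule_isLalgebra.Build R[i] U unital_scaleAl.
HB.instance Definition _ := GRing.Lalgebra_isAlgebra.Build R[i] U unital_scaleAr.

Implicit Types x y : U.

Lemma cs_mulE x y : x ** y = x * y. Proof. by []. Qed.

Lemma star0 : star (0 : U) = 0.
Proof. exact: cstar0. Qed.

Lemma ustarM x y : star (x * y) = star y * star x.
Proof. by rewrite -!cs_mulE starM. Qed.

Lemma star1 : star (1 : U) = 1.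
Proof. by rewrite -[LHS]mulr1 -{2}(starK (1 : U)) -ustarM mulr1 starK. Qed.

Lemma starX n x : star (x ^+ n) = star x ^+ n.
Proof. by elim: n => [|n ih]; rewrite ?expr0 ?star1// exprS exprSr ustarM ih. Qed.

Lemma star_sum (T : Type) (r : seq T) (P : pred T) (F : T -> U) :
  star (\sum_(t <- r | P t) F t) = \sum_(t <- r | P t) star (F t).
Proof. exact: (big_morph _ (@starD _ U) star0). Qed.

Lemma urnormM x y : rnorm (x * y) <= rnorm x * rnorm y.
Proof. by rewrite -cs_mulE rnormM. Qed.

Lemma urnorm_cstar x : rnorm (star x * x) = rnorm x ^+ 2.
Proof. by rewrite -cs_mulE rnorm_cstar. Qed.

Lemma star_mul_eq0 x : star x * x = 0 -> x = 0.
Proof. exact: star_cs_mul_eq0. Qed.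

Lemma rnorm_gt0 x : (0 < rnorm x) = (x != 0).
Proof.
rewrite lt_neqAle rnorm_ge0 andbT eq_sym; congr (~~ _); apply/eqP/eqP => [|->].
  exact: rnorm0_eq0.
exact: rnorm0.
Qed.

Lemma rnorm1 : rnorm (1 : U) = 1.
Proof.
have n0 : rnorm (1 : U) != 0 by rewrite gt_eqF// rnorm_gt0 oner_neq0.
apply: (mulfI n0); rewrite mulr1 -expr2 -urnorm_cstar.
by rewrite star1 mulr1.
Qed.

End UnitalAlg.

Section NeumannSeries.
Variables (R : realType) (A : cstarAlgType R) (e : A).
Hypotheses (e1 : is_identity e) (e0 : e != 0).
Local Notation U := (unital_alg e1 e0).

(** Neumann series. *)
Lemma near_one_invertible (x : U) : rnorm (1 - x) <= 2^-1 -> exists y, x * y = 1 /\ y * x = 1.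
Proof.
set w := 1 - x => w2; have xE : x = 1 - w by rewrite /w opprB addrCA subrr addr0.
pose y n : U := \sum_(k < n) w ^+ k.
have wn n : rnorm (w ^+ n) <= 2^-1 ^+ n.
  elim: n => [|n ih]; first by rewrite !expr0 rnorm1.
  by rewrite !exprS (le_trans (urnormM _ _))// ler_pM ?rnorm_ge0.
have [|z zy] := @telescope_lim R U y.
  move=> n; rewrite /y big_ord_recr /= addrAC subrr add0r.
  by rewrite (le_trans (wn n))// lerDl exprn_ge0.
have xy n : x * y n = 1 - w ^+ n /\ y n * x = 1 - w ^+ n.
  have h1 : x * y n = 1 - w ^+ n.
    by rewrite xE /y -[1 - w]opprB -[RHS]opprB mulNr subrX1.
  split=> //; rewrite -h1 /y mulr_sumr mulr_suml; apply: eq_bigr => k _.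
  by rewrite xE mulrBl mulrBr mul1r mulr1 -exprS -exprSr.
have lim1 (v : U) (M : R) : (forall n, rnorm (v - 1) <= M * 2^-1 ^+ n) -> v = 1.
  move=> vM; apply/eqP; rewrite -subr_eq0; apply/eqP/rnorm0_eq0/eqP.
  by rewrite eq_le rnorm_ge0 andbT; exact: (@le0_of_geometric _ _ M).
exists z; split; apply: (lim1 _ (rnorm x * 4 + 1)) => n; have [h1 h2] := xy n.
- have -> : x * z - 1 = x * (z - y n) + - w ^+ n.
    by rewrite mulrBr h1 opprB addrA addrAC addrK.
  rewrite (le_trans (rnormD _ _))// rnormN [in leRHS]mulrDl mul1r lerD//.
  by rewrite (le_trans (urnormM _ _))// -mulrA ler_wpM2l ?rnorm_ge0//; exact: zy.
- have -> : z * x - 1 = (z - y n) * x + - w ^+ n.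
    by rewrite mulrBl h2 opprB addrA addrAC addrK.
  rewrite (le_trans (rnormD _ _))// rnormN [in leRHS]mulrDl mul1r lerD//.
  by rewrite (le_trans (urnormM _ _))// mulrC -mulrA ler_wpM2l ?rnorm_ge0//; exact: zy.
Qed.

End NeumannSeries.

(** * Spectral theorem for algebraic self-adjoint elements *)

Section Resolutions.
Variables (R : realType) (A : cstarAlgType R) (e : A).
Hypotheses (e1 : is_identity e) (e0 : e != 0).
Local Notation U := (unital_alg e1 e0).
Implicit Types a : U.

Lemma horner_algZ a k (f : {poly R[i]}) :
  horner_alg a (k *: f) = k *: horner_alg a f.
Proof. by rewrite linearZ /= mulr_algl. Qed.

(** The polynomial q - q(c) is divisible by X - c, so
a - c divides the nonzero scalar - q(c). *)
Lemma invertible_of_nonroot a (q : {poly R[i]}) (c : R[i]) :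
  horner_alg a q = 0 -> q.[c] != 0 ->
  exists y, (a - c%:A) * y = 1 /\ y * (a - c%:A) = 1.
Proof.
move=> qa qc; have /factor_theorem[g gE] : root (q - (q.[c])%:P) c.
  by rewrite /root !hornerE subrr.
have agE : horner_alg a g * (a - c%:A) = - q.[c]%:A.
  have := congr1 (horner_alg a) gE.
  by rewrite rmorphB rmorphM rmorphB /= qa !horner_algC horner_algX sub0r => ->.
have comm : horner_alg a g * (a - c%:A) = (a - c%:A) * horner_alg a g.
  have -> : a - c%:A = horner_alg a ('X - c%:P).
    by rewrite rmorphB /= horner_algX horner_algC.
  by rewrite -!rmorphM mulrC.
exists (- q.[c]^-1 *: horner_alg a g); split.
- by rewrite -scalerAr -comm agE scaleNr scalerN opprK scalerA mulVf// scale1r.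
- by rewrite -scalerAl agE scaleNr scalerN opprK scalerA mulVf// scale1r.
Qed.

Lemma rnorm_sa_pow2 a k : star a = a ->
  rnorm (a ^+ (2 ^ k)) = rnorm a ^+ (2 ^ k).
Proof.
move=> sa; elim: k => [|k ih]; first by rewrite !expr1.
rewrite expnSr !exprM -ih -urnorm_cstar starX sa.
by rewrite -expr2.
Qed.

(** For self-adjoint elements the norm of the power 2^k is the
power of the norm, hence nilpotent ones vanish. Normality of x makes star x * x
nilpotent. *)
Lemma normal_nilpotent (x : U) N : star x * x = x * star x -> x ^+ N = 0 -> x = 0.
Proof.
move=> xx xN; apply: star_mul_eq0; apply: rnorm0_eq0; apply/eqP.
have sa : star (star x * x) = star x * x by rewrite ustarM starK.
have h0 : (star x * x) ^+ (2 ^ N) = 0.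
  rewrite -(subnKC (ltnW (ltn_expl N (ltnSn 1)))) exprD.
  by rewrite exprMn_comm// xN mulr0 mul0r.
have := rnorm_sa_pow2 N sa; rewrite h0 rnorm0 => /esym/eqP.
by rewrite expf_eq0 => /andP[].
Qed.

Definition resolution n (p : 'I_n -> U) :=
  [/\ forall i j, p i * p j = if i == j then p i else 0,
      forall i, star (p i) = p i,
      forall i, p i != 0
    & \sum_i p i = 1].

(** The functional calculus of a resolution of the identity: c i is the
value on the i-th spectral projection. *)
Definition diag n (p : 'I_n -> U) (c : 'I_n -> R[i]) : U := \sum_i c i *: p i.

Section Diag.
Variables (n : nat) (p : 'I_n -> U).
Hypothesis pres : resolution p.
Implicit Types c d : 'I_n -> R[i].

Lemma diagD c d : diag p c + diag p d = diag p (fun i => c i + d i).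
Proof. by rewrite -big_split; apply: eq_bigr => i _; rewrite scalerDl. Qed.

Lemma diagZ k c : k *: diag p c = diag p (fun i => k * c i).
Proof. by rewrite scaler_sumr; apply: eq_bigr => i _; rewrite scalerA. Qed.

Lemma diagB c d : diag p c - diag p d = diag p (fun i => c i - d i).
Proof. by rewrite -sumrB; apply: eq_bigr => i _; rewrite scalerBl. Qed.

Lemma diagMp c i : diag p c * p i = c i *: p i.
Proof.
have [pp _ _ _] := pres; rewrite mulr_suml (bigD1 i)//= big1 => [|j ji].
  by rewrite addr0 -scalerAl pp eqxx.
by rewrite -scalerAl pp (negPf ji) scaler0.
Qed.

Lemma diagM c d : diag p c * diag p d = diag p (fun i => c i * d i).
Proof.
rewrite [X in _ * X]/diag mulr_sumr; apply: eq_bigr => i _.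
by rewrite -scalerAr diagMp scalerA mulrC.
Qed.

Lemma diag1 : diag p (fun=> 1) = 1.
Proof.
by have [_ _ _ <-] := pres; apply: eq_bigr => i _; rewrite scale1r.
Qed.

Lemma diagX c m : diag p c ^+ m = diag p (fun i => c i ^+ m).
Proof.
elim: m => [|m ih]; first by rewrite expr0 diag1.
by rewrite exprS ih diagM; apply: eq_bigr => i _; rewrite exprS.
Qed.

Lemma diag_star c : star (diag p c) = diag p (fun i => conjc (c i)).
Proof.
have [_ sp _ _] := pres; rewrite star_sum; apply: eq_bigr => i _.
by rewrite starZ sp.
Qed.

Lemma diag_horner c f : horner_alg (diag p c) f = diag p (fun i => f.[c i]).
Proof.
elim/poly_ind: f => [|f k ih].
  by rewrite rmorph0 /diag big1// => i _; rewrite horner0 scale0r.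
rewrite rmorphD rmorphM /= horner_algX horner_algC ih diagM -diag1 diagZ diagD.
by apply: eq_bigr => i _; rewrite /= hornerMXaddC mulr1.
Qed.

Lemma rnorm_proj i : rnorm (p i) = 1.
Proof.
have [pp sp p0 _] := pres.
have n0 : rnorm (p i) != 0 by rewrite gt_eqF// rnorm_gt0.
apply: (mulfI n0); rewrite -expr2 -urnorm_cstar sp pp eqxx.
by rewrite mulr1.
Qed.

Lemma diag_norm_ge c i : complex.Re `|c i| <= rnorm (diag p c).
Proof.
have := urnormM (diag p c) (p i).
by rewrite diagMp rnormZ !rnorm_proj !mulr1.
Qed.

(** The triangle inequality gives this bound with the additional
factor n. Applied to large powers, it gives the bound itself by
[le_of_pow2_bound]. *)
Lemma diag_norm_le c (t : R) : 0 <= t ->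
  (forall i, complex.Re `|c i| <= t) -> rnorm (diag p c) <= t.
Proof.
move=> t0 ct; rewrite -ler_sqr ?nnegrE ?rnorm_ge0// -urnorm_cstar.
rewrite diag_star diagM; set h := diag p _.
have sh : star h = h.
  rewrite diag_star; apply: eq_bigr => i _.
  by rewrite rmorphM /= mulrC conjcK.
apply: (@le_of_pow2_bound _ _ _ n%:R) => [||k]; rewrite ?rnorm_ge0 ?sqr_ge0//.
rewrite -rnorm_sa_pow2// diagX /diag.
have nsum (F : 'I_n -> U) : rnorm (\sum_i F i) <= \sum_i rnorm (F i).
  elim/big_ind2: _ => [|x1 x2 y1 y2 h1 h2|//]; first by rewrite rnorm0.
  by rewrite (le_trans (rnormD _ _))// lerD.
rewrite (le_trans (nsum _))//.
apply: (@le_trans _ _ (\sum_(i < n) (t ^+ 2) ^+ (2 ^ k))); last first.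
  by rewrite sumr_const card_ord mulr_natl.
apply: ler_sum => i _; rewrite rnormZ rnorm_proj mulr1.
have -> : complex.Re `|(conjc (c i) * c i) ^+ (2 ^ k)| =
    (complex.Re `|c i| ^+ 2) ^+ (2 ^ k).
  rewrite renormX renormM expr2; congr ((_ * _) ^+ _).
  by rewrite norm_conjC.
by rewrite lerXn2r ?nnegrE ?sqr_ge0// lerXn2r ?nnegrE ?renorm_ge0.
Qed.

End Diag.

(** The element a is killed by a polynomial with simple
roots: the product of X - x over the roots x of q without repetition has a
nilpotent value at a, which is normal and thus 0. A shortest such list of roots
makes all Lagrange idempotents p i nonzero. Comparing both ways to evaluate
star (p i) * a * p j shows that the eigenvalues are real and that star (p i)
is orthogonal to p j for distinct i and j, whence p i is self-adjoint. *)
Theorem spectral_decomposition a (q : {poly R[i]}) : star a = a -> q != 0 ->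
  horner_alg a q = 0 ->
  exists n (l : 'I_n -> R) (p : 'I_n -> U),
    resolution p /\ a = diag p (fun i => (l i)%:C).
Proof.
move=> sa q0 qa.
pose Q (s : seq R[i]) := \prod_(x <- s) ('X - x%:P).
pose P m := `[< exists s : seq R[i], [/\ uniq s, size s = m & horner_alg a (Q s) = 0] >].
have exP : exists m, P m.
  have [r qE] := closed_field_poly_normal q.
  exists (size (undup r)); apply/asboolP; exists (undup r); split => //.
    exact: undup_uniq.
  apply: (@normal_nilpotent _ (size r)).
    have starh f : star (horner_alg a f) = horner_alg a (map_poly conjc f).
      elim/poly_ind: f => [|f k ih]; first by rewrite !rmorph0 star0.
      rewrite !rmorphD !rmorphM /= map_polyX map_polyC/= !horner_algX !horner_algC.
      rewrite starD ustarM ih sa starZ star1 -[X in X + _]/(_ * _).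
      by rewrite -{1}(horner_algX a) -rmorphM mulrC rmorphM /= horner_algX.
    by rewrite starh -!rmorphM mulrC.
  rewrite -rmorphXn /=.
  have : q %| Q (undup r) ^+ size r.
    rewrite qE dvdpZl ?lead_coef_eq0//.
    have : {subset r <= undup r} by move=> x; rewrite mem_undup.
    elim: {1 3 5}r => [|x r' ih] sub; first by rewrite big_nil dvd1p.
    rewrite big_cons exprS dvdp_mul ?ih// => [|y yr']; last by rewrite sub// inE yr' orbT.
    have xr : x \in undup r by rewrite sub// mem_head.
    by rewrite /Q (big_rem _ xr) /= dvdp_mulr.
  by move=> /dvdpP[g ->]; rewrite rmorphM /= qa mulr0.
have [m /asboolP[s [us sm Qs]] mmin] := ex_minnP exP.
have vanish (f : {poly R[i]}) : {in s, forall x, f.[x] = 0} -> horner_alg a f = 0.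
  move=> fs; have /dvdpP[g ->] : Q s %| f.
    by apply: uniq_roots_dvdp; rewrite ?uniq_rootsE//; apply/allP => x /fs /rootP.
  by rewrite rmorphM /= Qs mulr0.
have agree (f g : {poly R[i]}) : {in s, forall x, f.[x] = g.[x]} -> horner_alg a f = horner_alg a g.
  move=> fg; apply/eqP; rewrite -subr_eq0 -rmorphB; apply/eqP/vanish => x xs.
  by rewrite hornerD hornerN fg// subrr.
pose Qr x := Q (rem x s).
have Qr_eq0 x y : y \in s -> ((Qr x).[y] == 0) = (y != x).
  move=> ys; rewrite /Qr /Q horner_prod.
  rewrite (eq_bigr (fun z => y - z)) => [|z _]; last by rewrite hornerXsubC.
  rewrite prodf_seq_eq0; apply/hasP/idP.
    move=> [z]; rewrite mem_rem_uniq// inE => /andP[zx zs].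
    by rewrite subr_eq0 => /eqP ->.
  move=> yx; exists y; last by rewrite /= subrr.
  by rewrite mem_rem_uniq// inE yx.
pose L x := ((Qr x).[x])^-1 *: Qr x.
have LE x y : x \in s -> y \in s -> (L x).[y] = (y == x)%:R.
  move=> xs ys; rewrite hornerZ; case: eqVneq => [->|yx].
    by rewrite mulVf// Qr_eq0// eqxx.
  by move: (Qr_eq0 x y ys); rewrite yx => /eqP ->; rewrite mulr0.
pose l (i : 'I_m) := s`_i.
have ls i : l i \in s by rewrite mem_nth// sm.
have linj i j : (l i == l j) = (i == j) by rewrite nth_uniq ?sm.
pose p i : U := horner_alg a (L (l i)).
have pp i j : p i * p j = if i == j then p i else 0.
  rewrite -rmorphM /=; case: eqVneq => [<-|ij].
    by apply: agree => x xs; rewrite hornerM !LE//; case: eqVneq; rewrite ?mulr1 ?mulr0.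
  apply: vanish => x xs; rewrite hornerM !LE//.
  by case: eqVneq => [->|]; rewrite ?mul0r// linj (negPf ij) mulr0.
have p0 i : p i != 0.
  apply/eqP => pi0.
  have : horner_alg a (Qr (l i)) = 0.
    have Qn0 : (Qr (l i)).[l i] != 0 by rewrite Qr_eq0// eqxx.
    move: pi0; rewrite /p horner_algZ => /eqP.
    by rewrite scaler_eq0 invr_eq0 (negPf Qn0) => /eqP.
  move=> Q0; have : P m.-1.
    apply/asboolP; exists (rem (l i) s); split=> //; first exact: rem_uniq.
    by rewrite size_rem// sm.
  move=> /mmin; rewrite leqNgt ltn_predL; case/negP.
  by rewrite (leq_ltn_trans _ (ltn_ord i)).
have sum1 (F : {poly R[i]}) : horner_alg a F = \sum_i F.[l i] *: p i.
  rewrite /p -[RHS](_ : horner_alg a (\sum_i F.[l i] *: L (l i)) = _); last first.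
    by rewrite rmorph_sum; apply: eq_bigr => i _; rewrite [LHS]horner_algZ.
  apply: agree => x xs; rewrite horner_sum.
  have im : (index x s < m)%N by rewrite -sm index_mem.
  have lx : l (Ordinal im) = x by rewrite /l nth_index.
  rewrite (bigD1 (Ordinal im))//= big1 => [|j ji].
    by rewrite hornerZ LE// lx eqxx mulr1 addr0.
  by rewrite hornerZ LE// -lx linj eq_sym (negPf ji) mulr0.
have psum : \sum_i p i = 1.
  transitivity (horner_alg a 1); last by rewrite rmorph1.
  by rewrite sum1; apply: eq_bigr => i _; rewrite hornerC scale1r.
have aE : a = \sum_i l i *: p i.
  transitivity (horner_alg a 'X); first by rewrite horner_algX.
  by rewrite sum1; apply: eq_bigr => i _; rewrite hornerX.
have ap i : a * p i = l i *: p i.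
  rewrite aE mulr_suml (bigD1 i)//= big1 => [|j ji].
    by rewrite -scalerAl pp eqxx addr0.
  by rewrite -scalerAl pp (negPf ji) scaler0.
have spa i : star (p i) * a = conjc (l i) *: star (p i).
  by rewrite -{1}sa -ustarM ap starZ.
have offd i j : (conjc (l i) - l j) *: (star (p i) * p j) = 0.
  by rewrite scalerBl scalerAl -spa -mulrA ap -scalerAr subrr.
have lreal i : conjc (l i) = l i.
  have /eqP := offd i i; rewrite scaler_eq0 subr_eq0 => /orP[/eqP//|/eqP].
  by move=> /star_mul_eq0 /eqP; rewrite (negPf (p0 i)).
have spp i j : i != j -> star (p i) * p j = 0.
  move=> ij; have /eqP := offd i j.
  by rewrite scaler_eq0 lreal subr_eq0 linj (negPf ij) => /eqP.
have spE i : star (p i) = star (p i) * p i.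
  rewrite -{1}(mulr1 (star (p i) : U)) -psum mulr_sumr (bigD1 i)//= big1 ?addr0// => j ji.
  by rewrite spp// eq_sym.
have sp i : star (p i) = p i.
  by rewrite -{2}(starK (p i)) {2}spE ustarM starK -spE.
exists m, (fun i => complex.Re (l i)), p; split=> //.
rewrite aE; apply: eq_bigr => i _; congr (_ *: _).
by rewrite RRe_real// CrealE; apply/eqP; exact: lreal.
Qed.

End Resolutions.

(** * Finite-dimensional C*-algebras *)

Section FiniteDimensional.
Variables (R : realType) (A : cstarAlgType R).
Local Notation C := R[i].

Definition cs_mulr (a x : A) : A := x ** a.

Fact cs_mul_linear (a : A) : linear (cs_mul a).
Proof. by move=> k x y; rewrite cs_mulDr cs_mulZr. Qed.
Fact cs_mulr_linear (a : A) : linear (cs_mulr a).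
Proof. by move=> k x y; rewrite /cs_mulr cs_mulDl cs_mulZl. Qed.

HB.instance Definition _ (a : A) :=
  GRing.isLinear.Build C A A *:%R (cs_mul a) (cs_mul_linear a).
HB.instance Definition _ (a : A) :=
  GRing.isLinear.Build C A A *:%R (cs_mulr a) (cs_mulr_linear a).

Definition coordinates d (r : {linear A -> 'rV[C]_d}) (s : {linear 'rV[C]_d -> A}) :=
  cancel r s /\ cancel s r.

(** A spanning family of least cardinality is a basis. *)
Lemma fd_coordinates : finite_dimensional A ->
  exists d (r : {linear A -> 'rV[C]_d}) (s : {linear 'rV[C]_d -> A}),
    coordinates r s.
Proof.
pose P n := `[< exists b : 'I_n -> A, forall x : A,
    exists c : 'I_n -> C, x = \sum_(i < n) c i *: b i >].
move=> [n0 Pn0]; have exP : exists n, P n by exists n0; apply/asboolP.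
have [n /asboolP[b bspan] nmin] := ex_minnP exP.
pose f (v : 'rV[C]_n) : A := \sum_i v ord0 i *: b i.
have flin : linear f.
  move=> k v w; rewrite /f scaler_sumr -big_split; apply: eq_bigr => i _.
  by rewrite !mxE scalerDl scalerA.
pose s : {linear 'rV[C]_n -> A} := HB.pack f (GRing.isLinear.Build C _ A *:%R f flin).
have s_inj v : s v = 0 -> v = 0.
  move=> v0; apply/rowP => k; rewrite mxE; apply/eqP/negPn/negP => vk.
  case: n => [|n] in b bspan nmin f flin s v v0 k vk *; first by case: k vk.
  have : P n.
    apply/asboolP; exists (fun j => b (lift k j)) => x.
    have [c ->] := bspan x.
    exists (fun j => c (lift k j) - c k / v ord0 k * v ord0 (lift k j)).
    have -> : \sum_i c i *: b i = \sum_i c i *: b i - (c k / v ord0 k) *: s v.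
      by rewrite v0 scaler0 subr0.
    rewrite /= /f scaler_sumr -sumrB (bigD1_ord k)//= scalerA divfK// subrr add0r.
    by apply: eq_bigr => j _; rewrite scalerA -scalerBl.
  by move=> /nmin; rewrite ltnn.
have /choice[g gE] x : exists v, s v = x.
  have [c ->] := bspan x; exists (\row_i c i); rewrite /= /f.
  by apply: eq_bigr => i _; rewrite mxE.
have sB v w : s (v - w) = s v - s w by exact: raddfB.
have sP k v w : s (k *: v + w) = k *: s v + s w by exact: linearP.
have sK : cancel s g.
  by move=> v; apply/eqP; rewrite -subr_eq0; apply/eqP/s_inj; rewrite sB gE subrr.
have glin : linear g.
  by move=> k x y; rewrite -(sK (k *: g x + g y)) sP !gE.
pose r : {linear A -> 'rV[C]_n} := HB.pack g (GRing.isLinear.Build C A _ *:%R g glin).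
by exists n, r, s.
Qed.

Section Coordinates.
Variables (d : nat) (r : {linear A -> 'rV[C]_d}) (s : {linear 'rV[C]_d -> A}).
Hypothesis rs : coordinates r s.

(** Columns over A form a finite-dimensional space, on which an
injective linear map is onto. *)
Lemma fd_column_surj n (V : 'M[A]_n) :
  (forall z : 'I_n -> A, (forall i, \sum_k V i k ** z k = 0) ->
     forall k, z k = 0) ->
  forall y : 'I_n -> A, exists z : 'I_n -> A,
    forall i, \sum_k V i k ** z k = y i.
Proof.
case: rs => rK sK Vinj y.
pose T (X : 'M[C]_(n, d)) : 'M[C]_(n, d) :=
  \matrix_i r (\sum_k V i k ** s (row k X)).
have Tlin : linear T.
  move=> k X Y; apply/row_matrixP => i; rewrite linearP /= !rowK -linearP.
  congr (r _); rewrite scaler_sumr -big_split; apply: eq_bigr => j _ /=.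
  by rewrite !linearP.
pose TL : {linear 'M[C]_(n, d) -> 'M[C]_(n, d)} :=
  HB.pack T (GRing.isLinear.Build C _ _ *:%R T Tlin).
have Tinj X : T X = 0 -> X = 0.
  move=> TX0; apply/row_matrixP => k; rewrite row0 -(sK (row k X)).
  rewrite (Vinj (fun k => s (row k X))) ?raddf0// => i.
  by rewrite -(rK (\sum_k _)) -(rowK (fun i => r (\sum_k V i k ** s (row k X))) i)
     -/(T X) TX0 row0 raddf0.
have Tunit : lin_mx TL \in unitmx.
  rewrite -row_free_unit -kermx_eq0; apply/eqP/row_matrixP => i; rewrite row0.
  apply: (can_inj vec_mxK); rewrite raddf0; apply: Tinj.
  apply: (can_inj mxvecK); rewrite raddf0.
  have -> : T = TL by [].
  by rewrite -mul_vec_lin vec_mxK -row_mul mulmx_ker row0.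
pose Y : 'M[C]_(n, d) := \matrix_i r (y i).
pose X : 'M[C]_(n, d) := vec_mx (mxvec Y *m invmx (lin_mx TL)).
have TX : T X = Y.
  apply: (can_inj mxvecK); have -> : T = TL by [].
  by rewrite -mul_vec_lin /X vec_mxK mulmxKV.
exists (fun k => s (row k X)) => i; apply: (can_inj rK).
have := congr1 (row i) TX; by rewrite !rowK.
Qed.

End Coordinates.

(** Take a self-adjoint a for which the kernel of left multiplication
has the least dimension. If z is a nonzero element of this kernel, then
c = z ** star z is self-adjoint with a ** c = c ** a = 0 and c ** z nonzero, so
a + c has a strictly smaller kernel. Hence left multiplication by a is injective,
thus onto, and an element e such that a ** e = a is a left identity. *)
Lemma fd_unital : finite_dimensional A -> exists e : A, is_identity e.
Proof.
move=> /fd_coordinates[d [r [s rs]]]; have [rK sK] := rs.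
pose L a := lin1_mx (r \o cs_mul a \o s).
have LE a x : r x *m L a = r (a ** x) by rewrite mul_rV_lin1 /= rK.
pose P m := `[< exists2 a, star a = a & (d - \rank (L a))%N = m >].
have exP : exists m, P m.
  exists (d - \rank (L (0 : A)%R))%N; apply/asboolP.
  by exists (0 : A) => //; rewrite cstar0.
have [m /asboolP[a sa am] amin] := ex_minnP exP.
have ainj z : a ** z = 0 -> z = 0.
  move=> az0; apply/eqP/negPn/negP => z0.
  have [c cE] : exists c, c = z ** star z by exists (z ** star z).
  have sc : star c = c by rewrite cE starM starK.
  have ac : a ** c = 0 by rewrite cE cs_mulA az0 cs_mul0l.
  have ca : c ** a = 0 by rewrite -(starK (c ** a)) starM sa sc ac cstar0.
  have cz : c ** z != 0.
    apply: contraNneq z0 => cz0; apply/eqP/star_cs_mul_eq0/star_cs_mul_eq0.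
    by rewrite starM starK -cs_mulA (cs_mulA z) -cE cz0 cs_mul0r.
  have ker_ac y : (a + c) ** y = 0 -> a ** y = 0 /\ c ** y = 0.
    move=> acy; have ay : a ** y = 0.
      apply: star_cs_mul_eq0; rewrite starM sa -cs_mulA (cs_mulA a).
      have -> : (a ** a) ** y = a ** ((a + c) ** y).
        by rewrite cs_mulDl cs_mulDr !cs_mulA ac cs_mul0l addr0.
      by rewrite acy !cs_mul0r.
    by split=> //; move: acy; rewrite cs_mulDl ay add0r.
  have : P (d - \rank (L (a + c)%R))%N.
    by apply/asboolP; exists (a + c) => //; rewrite starD sa sc.
  move=> /amin; rewrite -am -!mxrank_ker leqNgt => /negP; apply.
  apply: rank_ltmx; rewrite ltmxE; apply/andP; split.
    apply/rV_subP => v /sub_kermxP; rewrite -(sK v) LE => h.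
    have {h} : (a + c) ** s v = 0 by apply: (can_inj rK); rewrite h raddf0.
    by move=> /ker_ac[h _]; apply/sub_kermxP; rewrite LE h raddf0.
  apply/negP => /rV_subP/(_ (r z)); rewrite !(sameP sub_kermxP eqP) !LE.
  rewrite az0 raddf0 eqxx => /(_ isT) /eqP h.
  have {h} : (a + c) ** z = 0 by apply: (can_inj rK); rewrite h raddf0.
  by move=> /ker_ac[_]; apply/eqP.
have [e ae] : exists e, a ** e = a.
  have [z|z zE] := @fd_column_surj _ _ _ rs 1 (\matrix_(_, _) a) _ (fun=> a).
    by move=> /(_ 0); rewrite big_ord1 mxE => /ainj z0 k; rewrite ord1.
  by exists (z 0); have := zE 0; rewrite big_ord1 mxE.
have eL z : e ** z = z.
  apply/eqP; rewrite -subr_eq0; apply/eqP/ainj.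
  by rewrite cs_mulBr cs_mulA ae subrr.
have eR z : z ** star e = z by rewrite -{1}(starK z) -starM eL starK.
have se : star e = e by rewrite -{1}(eL (star e)) eR.
by exists e => z; split; [exact: eL | rewrite -{2}(eR z) se].
Qed.

End FiniteDimensional.

(** If P = C R is a rank factorization of an idempotent, then
R C is the identity matrix, whose size is the rank. *)
Lemma mxtrace_idempotent (F : fieldType) d (P : 'M[F]_d) :
  P *m P = P -> \tr P = (\rank P)%:R.
Proof.
move=> PP; rewrite -{1}(mulmx_base P) mxtrace_mulC.
suff -> : row_base P *m col_base P = 1%:M by rewrite mxtrace1.
apply: (row_free_inj (row_base_free P)); rewrite mul1mx.
apply: (row_full_inj (col_base_full P)).
by rewrite mulmxA (mulmxA (col_base P)) mulmx_base -mulmxA mulmx_base.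
Qed.

Section FiniteDimensionalUnital.
Variables (R : realType) (A : cstarAlgType R) (e : A).
Hypotheses (e1 : is_identity e) (e0 : e != 0).
Local Notation U := (unital_alg e1 e0).
Local Notation C := R[i].
Hypothesis fdA : finite_dimensional A.

(** Right multiplications act on row vectors of coordinates in
the order of the product. *)
Lemma fd_representation : exists d (rho : {linear U -> 'M[C]_d.+1}),
  [/\ forall x y, rho (x * y) = rho x *m rho y,
      rho 1 = 1%:M
    & forall x, rho x = 0 -> x = 0].
Proof.
have [d [r [s [rK sK]]]] := fd_coordinates fdA.
pose rho (a : U) : 'M[C]_d := lin1_mx (r \o cs_mulr (a : A) \o s).
have rhoE (x a : U) : r x *m rho a = r (x * a).
  by rewrite mul_rV_lin1 /= rK.
have rho_inj x : rho x = 0 -> x = 0.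
  by move=> x0; apply: (can_inj rK); rewrite -(mul1r x) -rhoE x0 mulmx0 raddf0.
have rhoP (M : 'M[C]_d) a : (forall x : U, r x *m M = r (x * a)) -> rho a = M.
  move=> Ma; apply/row_matrixP => i.
  by rewrite !rowE -(sK (delta_mx 0 i)) rhoE Ma.
have rholin : linear rho.
  move=> k x y; apply: rhoP => z.
  rewrite mulmxDr -scalemxAr !rhoE mulrDr -scalerAr.
  exact/esym/(linearP r).
have rhoM x y : rho (x * y) = rho x *m rho y.
  by apply: rhoP => z; rewrite mulmxA !rhoE mulrA.
have rho1 : rho 1 = 1%:M by apply: rhoP => z; rewrite mulmx1 mulr1.
case: d => [|d] in r s rK sK rho rhoE rho_inj rhoP rholin rhoM rho1 *.
  by have /eqP := rho_inj 1 (flatmx0 _); rewrite oner_eq0.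
pose rhoL : {linear U -> 'M[C]_d.+1} :=
  HB.pack rho (GRing.isLinear.Build C U _ *:%R rho rholin).
by exists d, rhoL.
Qed.

(** Cayley-Hamilton, through the regular representation. *)
Lemma fd_annihilated (a : U) : exists2 q : {poly C}, q != 0 & horner_alg a q = 0.
Proof.
have [d [rho [rhoM rho1 rho_inj]]] := fd_representation.
exists (char_poly (rho a)); first by rewrite monic_neq0// char_poly_monic.
have rhoD x y : rho (x + y) = rho x + rho y by exact: raddfD.
have rhoZ k x : rho (k *: x) = k *: rho x by exact: linearZ.
apply: rho_inj; rewrite -[RHS](Cayley_Hamilton (rho a)).
elim/poly_ind: (char_poly _) => [|f k ih]; first by rewrite !rmorph0 raddf0.
rewrite !rmorphD !rmorphM /= horner_algX horner_algC horner_mx_X horner_mx_C.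
by rewrite rhoD rhoZ rho1 rhoM ih scalemx1.
Qed.

Lemma fd_spectral (a : U) : star a = a ->
  exists n (l : 'I_n -> R) (p : 'I_n -> U),
    resolution p /\ a = diag p (fun i => (l i)%:C).
Proof.
by move=> sa; have [q q0 qa] := fd_annihilated a; exact: spectral_decomposition qa.
Qed.

(** The eigenvalues of a cannot contain all the numbers
- eps / (k + 1). *)
Lemma fd_invertible_shift (a : U) (eps : R) : 0 < eps ->
  exists (t : R) (y : U), [/\ `|t| <= eps, (a + t%:C%:A) * y = 1 & y * (a + t%:C%:A) = 1].
Proof.
move=> eps0; have [q q0 qa] := fd_annihilated a.
pose t (k : nat) : R := eps / k.+1%:R.
have t_inj : injective t.
  move=> j k /(mulfI (lt0r_neq0 eps0)) /invr_inj /eqP.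
  by rewrite eqr_nat => /eqP[].
have [k qk] : exists k, q.[- (t k)%:C] != 0.
  apply: contrapT => /forallNP qt.
  pose ts := [seq - (t k)%:C | k <- iota 0 (size q)].
  move/eqP: q0; apply; apply: (@roots_geq_poly_eq0 _ q ts).
  - apply/allP => _ /mapP[k _ ->]; apply/rootP.
    by apply/eqP/negPn/negP; exact: qt.
  - rewrite map_inj_uniq ?iota_uniq// => j k /oppr_inj /complexI; exact: t_inj.
  - by rewrite size_map size_iota.
have [y []] := invertible_of_nonroot qa qk.
rewrite scaleNr opprK => ay ya; exists (t k), y; split=> //.
rewrite ger0_norm; last by rewrite divr_ge0// ltW.
rewrite ler_pdivrMr ?ltr0n// ler_peMr ?ler1n//.
exact: ltW.
Qed.

(** The normalized trace of the regular representation. It is positive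
on nonzero projections, the trace of an idempotent being its rank, hence on
squares of nonzero self-adjoint elements. If x = h + i k with h and k
self-adjoint, then star x * x = h^2 + k^2 + i (h k - k h) has the same trace
as h^2 + k^2. *)
Lemma fd_trace : exists tau : {scalar U},
  [/\ forall x y, tau (x * y) = tau (y * x),
      tau 1 = 1,
      forall x : U, 0 <= tau (star x * x),
      forall x : U, tau (star x * x) = 0 -> x = 0
    & forall x, complex.Re (tau x) <= rnorm x].
Proof.
have [d [rho [rhoM rho1 rho_inj]]] := fd_representation.
pose tau (x : U) : C := \tr (rho x) / d.+1%:R.
have taulin : scalar tau.
  by move=> k x y; rewrite /tau linearP raddfD /= linearZ /= mulrDl mulrA.
pose tauL : {scalar U} := HB.pack tau (GRing.isLinear.Build C U C *%R tau taulin).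
have tauD x y : tau (x + y) = tau x + tau y by exact: (raddfD tauL).
have tauZ k x : tau (k *: x) = k * tau x by exact: (scalarZ tauL).
have tau_sum (I : finType) (F : I -> U) : tau (\sum_i F i) = \sum_i tau (F i).
  exact: (raddf_sum tauL).
have tauC x y : tau (x * y) = tau (y * x).
  by rewrite /tau !rhoM mxtrace_mulC.
have tau1 : tau 1 = 1 by rewrite /tau rho1 mxtrace1 divff// pnatr_eq0.
have tau_idem x : x * x = x -> x != 0 -> exists2 t : R, 0 < t & tau x = t%:C.
  move=> xx x0; exists ((\rank (rho x))%:R / d.+1%:R).
    rewrite divr_gt0 ?ltr0n// lt0n mxrank_eq0.
    by apply: contra x0 => /eqP/rho_inj ->.
  by rewrite /tau mxtrace_idempotent -?rhoM ?xx// rmorphM fmorphV !rmorph_nat.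
have tau_proj n (p : 'I_n -> U) : resolution p ->
    exists2 w : 'I_n -> R, forall i, 0 < w i & forall c, tau (diag p c) = \sum_i c i * (w i)%:C.
  move=> [pp _ p0 _].
  have /choice[w wP] i : exists t : R, 0 < t /\ tau (p i) = t%:C.
    by have [|t t0 tE] := tau_idem (p i) _ (p0 i); [rewrite pp eqxx|exists t].
  exists w => [i|c]; first by case: (wP i).
  by rewrite /diag tau_sum; apply: eq_bigr => i _; rewrite tauZ (wP i).2.
have tau_sqr (h : U) : star h = h -> exists t : R,
    [/\ 0 <= t, tau (h * h) = t%:C & t = 0 -> h = 0].
  move=> sh; have [n [l [p [pres hE]]]] := fd_spectral sh.
  have [w w0 tw] := tau_proj _ _ pres.
  exists (\sum_i l i ^+ 2 * w i); split.
  - by apply: sumr_ge0 => i _; rewrite mulr_ge0 ?sqr_ge0// ltW.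
  - rewrite hE diagM// tw rmorph_sum; apply: eq_bigr => i _.
    by rewrite expr2 !rmorphM.
  - move=> /eqP; rewrite psumr_eq0 => [/allP l0|i _]; last first.
      by rewrite mulr_ge0 ?sqr_ge0// ltW.
    rewrite hE /diag big1// => i _.
    have := l0 i; rewrite mem_index_enum => /(_ isT).
    rewrite mulf_eq0 sqrf_eq0 (gt_eqF (w0 i)) orbF => /eqP ->.
    by rewrite scale0r.
have tau_star_sqr (x : U) : tau (star x * x) =
    tau (repart x * repart x) + tau (impart x * impart x).
  have -> : star x * x = (repart x - 'i%C *: impart x) * (repart x + 'i%C *: impart x).
    rewrite -repartD_impart; congr (_ * _).
    rewrite {1}(repartD_impart x) starD star_repart starZ star_impart.
    by rewrite -scaleNr; congr (_ + _ *: _); simpc.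
  move: (repart x) (impart x) => h k.
  have -> : (h - 'i%C *: k) * (h + 'i%C *: k) =
      h * h + k * k + 'i%C *: (h * k - k * h).
    rewrite mulrDr [X in X + _]mulrBl [X in _ + X]mulrBl.
    have ii : 'i%C * 'i%C = -1 :> C by rewrite -expr2 sqr_i.
    rewrite -!(scalerAl 'i%C) -!(scalerAr 'i%C) scalerA ii scaleN1r opprK.
    by rewrite scalerBr ['i%C *: _ + k * k]addrC addrACA [- _ + _]addrC.
  by rewrite !tauD tauZ tauD -scaleN1r tauZ (tauC k h) mulN1r subrr mulr0 addr0.
exists tauL; split=> //=.
- move=> x; rewrite tau_star_sqr.
  have [t [t0 -> _]] := tau_sqr _ (star_repart x).
  have [u [u0 -> _]] := tau_sqr _ (star_impart x).
  by rewrite -rmorphD /= lecR addr_ge0.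
- move=> x; rewrite tau_star_sqr.
  have [t [t0 -> ht]] := tau_sqr _ (star_repart x).
  have [u [u0 -> hu]] := tau_sqr _ (star_impart x).
  rewrite -rmorphD /= => /complexI/eqP; rewrite paddr_eq0// => /andP[/eqP/ht h0 /eqP/hu k0].
  by rewrite (repartD_impart x) h0 k0 scaler0 addr0.
- move=> x; rewrite (repartD_impart x) tauD (tauZ 'i%C) -(repartD_impart x).
  apply: le_trans (rnorm_repart x).
  have [n [l [p [pres hE]]]] := fd_spectral (star_repart x).
  have [m [l' [p' [pres' kE]]]] := fd_spectral (star_impart x).
  have [w w0 tw] := tau_proj _ _ pres.
  have [w' w'0 tw'] := tau_proj _ _ pres'.
  have realsum q (f g : 'I_q -> R) :
      \sum_i (f i)%:C * (g i)%:C = (\sum_i f i * g i)%:C :> C.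
    by rewrite rmorph_sum; apply: eq_bigr => i _; rewrite rmorphM.
  rewrite hE kE tw tw' !realsum.
  set s := \sum_i _; set s' := \sum_i _.
  have -> : complex.Re (s%:C + 'i%C * s'%:C) = s by simpc.
  have wsum : \sum_i w i = 1.
    apply: (@complexI R); rewrite rmorph1 -tau1 -(diag1 pres) tw rmorph_sum.
    by apply: eq_bigr => i _; rewrite mul1r.
  apply: (@le_trans _ _ (\sum_i rnorm (diag p (fun i => (l i)%:C)) * w i)).
    apply: ler_sum => i _; apply: ler_wpM2r; first exact: ltW.
    apply: le_trans (ler_norm _) _; rewrite -renormR.
    exact: (diag_norm_ge pres (fun i => (l i)%:C)).
  by rewrite -mulr_sumr wsum mulr1.
Qed.

End FiniteDimensionalUnital.

(** * Estimates independent of the dimension *)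

Section MatrixNorm.
Variables (R : realType) (A : cstarAlgType R) (e : A).
Hypotheses (e1 : is_identity e) (e0 : e != 0).
Local Notation U := (unital_alg e1 e0).

(** A submultiplicative norm, equivalent to the C*-norm of the matrix
algebra with constants that depend on the size only. *)
Definition mxn m n (V : 'M[U]_(m, n)) : R := \sum_i \sum_j rnorm (V i j).
Definition mxstar m n (V : 'M[U]_(m, n)) : 'M[U]_(n, m) := \matrix_(i, j) star (V j i).

Lemma mxn_ge0 m n (V : 'M[U]_(m, n)) : 0 <= mxn V.
Proof. by apply: sumr_ge0 => i _; apply: sumr_ge0 => j _; exact: rnorm_ge0. Qed.

Lemma mxn_ge m n (V : 'M[U]_(m, n)) i j : rnorm (V i j) <= mxn V.
Proof.
by apply: (ler_sum2 (F := fun i j => rnorm (V i j))) => *; exact: rnorm_ge0.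
Qed.

Lemma mxn_eq0 m n (V : 'M[U]_(m, n)) : mxn V = 0 -> V = 0.
Proof.
move=> V0; apply/matrixP => i j; rewrite mxE; apply: rnorm0_eq0.
by apply/eqP; rewrite eq_le rnorm_ge0 -V0 mxn_ge.
Qed.

Lemma mxnD m n (V W : 'M[U]_(m, n)) : mxn (V + W) <= mxn V + mxn W.
Proof.
rewrite -big_split; apply: ler_sum => i _ /=; rewrite -big_split.
by apply: ler_sum => j _ /=; rewrite mxE rnormD.
Qed.

Lemma mxnM m n k (V : 'M[U]_(m, n)) (W : 'M[U]_(n, k)) :
  mxn (V *m W) <= mxn V * mxn W.
Proof.
rewrite /mxn mulr_suml; apply: ler_sum => i _.
apply: (@le_trans _ _ (\sum_j \sum_l rnorm (V i l) * rnorm (W l j))).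
  apply: ler_sum => j _; rewrite mxE; apply: le_trans (rnorm_sum _ _) _.
  by apply: ler_sum => l _; exact: urnormM.
rewrite exchange_big mulr_suml; apply: ler_sum => l _ /=.
rewrite -mulr_sumr ler_wpM2l ?rnorm_ge0// [leRHS](bigD1 l)//= lerDl.
by apply: sumr_ge0 => *; apply: sumr_ge0 => *; exact: rnorm_ge0.
Qed.

Lemma mxn_star m n (V : 'M[U]_(m, n)) : mxn (mxstar V) = mxn V.
Proof.
rewrite /mxn exchange_big; apply: eq_bigr => i _; apply: eq_bigr => j _.
by rewrite mxE rnorm_star.
Qed.

End MatrixNorm.

Section FiniteDimensionalEstimates.
Variables (R : realType) (A : cstarAlgType R) (e : A).
Hypotheses (e1 : is_identity e) (e0 : e != 0).
Local Notation U := (unital_alg e1 e0).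
Hypothesis fdA : finite_dimensional A.

(** Round the eigenvalues of the real part of a to points of G. *)
Lemma fd_quantize (G : seq R) (eps : R) (a : U) : 0 <= eps ->
  (forall t, `|t| <= 1 -> exists2 g, g \in G & `|g - t| <= eps) ->
  {in G, forall g, `|g| <= 1} -> rnorm a <= 1 ->
  exists b : U, [/\ rnorm b <= 1, star b = b,
    horner_alg b (\prod_(g <- G) ('X - (g%:C)%:P)) = 0
    & rnorm (b - repart a) <= eps].
Proof.
move=> eps0 netG G1 a1.
have [n [l [p [pres hE]]]] := fd_spectral fdA (star_repart a : star (repart a : U) = _).
have l1 i : `|l i| <= 1.
  apply: le_trans a1; apply: le_trans (rnorm_repart a).
  rewrite hE -renormR; exact: (diag_norm_ge pres (fun i => (l i)%:C)).
have /choice[g gP] i : exists g, g \in G /\ `|g - l i| <= eps.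
  by have [g ? ?] := netG _ (l1 i); exists g.
exists (diag p (fun i => (g i)%:C)); split.
- apply: diag_norm_le => // i; rewrite renormR; apply: G1; exact: (gP i).1.
- rewrite diag_star//; apply: eq_bigr => i _; by rewrite conjc_real.
- rewrite diag_horner// /diag big1// => i _.
  rewrite horner_prod (big_rem _ (gP i).1) /= !hornerE subrr mul0r.
  by rewrite scale0r.
- rewrite [X in _ - X]hE diagB; apply: diag_norm_le => // i.
  by rewrite -rmorphB renormR (gP i).2.
Qed.

(** A small shift b of a is invertible. If u |b| is its
polar decomposition, then x = u (|b| + d) has distance d to b and its inverse
has norm at most 1/d. In terms of the functional calculus D of |b|, this x is
b times the value of 1 + d / t, which avoids u. *)
Lemma fd_invertible_approx (a : U) (eps : R) : 0 < eps ->
  exists x y : U, [/\ x * y = 1, y * x = 1, rnorm (x - a) <= eps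
    & rnorm y <= 2 / eps].
Proof.
move=> eps0; pose d := eps / 2; have d0 : 0 < d by rewrite divr_gt0.
have [t [y [td by1 yb1]]] := fd_invertible_shift fdA a d0.
set b := a + _ in by1 yb1.
have sbb : star (star b * b) = star b * b by rewrite ustarM starK.
have [n [l [p [pres bbE]]]] := fd_spectral fdA sbb.
have [tau [tauC _ tau_ge0 tau_eq0 _]] := fd_trace e1 e0 fdA.
have [pp sp p0 _] := pres.
have bp i : star (b * p i) * (b * p i) = (l i)%:C *: p i.
  rewrite ustarM sp -mulrA (mulrA (star b)) bbE diagMp// -scalerAr pp eqxx.
  by [].
have bp0 i : b * p i != 0.
  apply: contra (p0 i) => /eqP bpi; apply/eqP.
  by rewrite -(mul1r (p i)) -yb1 -mulrA bpi mulr0.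
(* the trace of star (b * p i) * (b * p i) is l i times the one of p i *)
have l0 i : 0 < l i.
  have tp : 0 < tau (p i).
    have := tau_ge0 (p i); rewrite sp pp eqxx le_eqVlt => /orP[/eqP t0|//].
    have := tau_eq0 (p i); rewrite sp pp eqxx => /(_ (esym t0)) /eqP.
    by rewrite (negPf (p0 i)).
  have : 0 < tau (star (b * p i) * (b * p i)).
    rewrite lt_neqAle tau_ge0 andbT eq_sym; apply: contra (bp0 i) => /eqP.
    by move=> /tau_eq0 ->.
  by rewrite bp linearZ /= pmulr_lgt0// ltcR.
pose m i := Num.sqrt (l i).
have m0 i : 0 < m i by rewrite sqrtr_gt0.
have mm i : m i * m i = l i by rewrite -expr2 sqr_sqrtr ?ltW.
have md0 i : 0 < m i + d by rewrite addr_gt0.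
pose D (f : R -> R) : U := diag p (fun i => (f (m i))%:C).
have DM f g : D f * D g = D (fun t => f t * g t).
  by rewrite /D diagM//; apply: eq_bigr => i _; rewrite rmorphM.
have Dext f g : (forall i, f (m i) = g (m i)) -> D f = D g.
  by move=> fg; apply: eq_bigr => i _; rewrite fg.
have D1 : D (fun=> 1) = 1 by rewrite -(diag1 pres).
have Dstar f : star (D f) = D f.
  by rewrite /D diag_star//; apply: eq_bigr => i _; rewrite conjc_real.
have bbD : star b * b = D (fun t => t * t).
  by rewrite bbE; apply: eq_bigr => i _; rewrite mm.
have yyD : y * star y = D (fun t => (t * t)^-1).
  have ybb : y * star y * (star b * b) = 1.
    by rewrite mulrA -(mulrA y) -ustarM by1 star1 mulr1 yb1.
  rewrite -[LHS]mulr1 -D1 (@Dext (fun=> 1) (fun t => (t * t) * (t * t)^-1)).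
    by rewrite -DM mulrA -bbD ybb mul1r.
  by move=> i; rewrite divff// mulf_neq0// lt0r_neq0.
pose x := b * D (fun t => 1 + d / t).
pose z := D (fun t => t / (t + d)) * y.
have xz : D (fun t => 1 + d / t) * D (fun t => t / (t + d)) = 1.
  rewrite DM -D1; apply: Dext => i.
  by field; rewrite !lt0r_neq0.
have zx : D (fun t => t / (t + d)) * D (fun t => 1 + d / t) = 1.
  by rewrite -xz !DM; apply: Dext => i; rewrite mulrC.
exists x, z; split.
- by rewrite /x /z mulrA -(mulrA b) xz mulr1.
- by rewrite /x /z -mulrA (mulrA y) yb1 mul1r.
- have -> : x - a = b * D (fun t => d / t) + t%:C%:A.
    rewrite /x; have -> : D (fun t => 1 + d / t) = 1 + D (fun t => d / t).
      by rewrite -D1 /D diagD//; apply: eq_bigr => i _; rewrite rmorphD.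
    by rewrite mulrDr mulr1 {1}/b addrAC [a + _]addrC addrK addrC.
  apply: le_trans (rnormD _ _) _.
  have -> : eps = d + d by rewrite /d; lra.
  rewrite lerD// ?rnormZ ?rnorm1 ?mulr1 ?renormR//.
  rewrite -ler_sqr ?nnegrE ?rnorm_ge0 ?(ltW d0)// -urnorm_cstar.
  rewrite ustarM Dstar -mulrA (mulrA (star b)) bbD !DM.
  rewrite (@Dext _ (fun=> d * d)) => [|i]; last by field; rewrite lt0r_neq0.
  have -> : D (fun=> d * d) = (d * d)%:C *: 1.
    by rewrite -D1 /D diagZ//; apply: eq_bigr => i _; rewrite mulr1.
  rewrite rnormZ rnorm1 mulr1 renormR ger0_norm ?expr2//; exact: mulr_ge0 (ltW d0) (ltW d0).
- rewrite -(rnorm_star z) -ler_sqr ?nnegrE ?rnorm_ge0 ?divr_ge0 ?(ltW eps0)//.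
  rewrite -urnorm_cstar starK /z ustarM Dstar mulrA -(mulrA _ y) yyD !DM.
  apply: (diag_norm_le pres) => //; first by rewrite sqr_ge0.
  move=> i; rewrite renormR.
  have -> : m i / (m i + d) * (m i * m i)^-1 * (m i / (m i + d)) = ((m i + d)^-1) ^+ 2.
    by field; rewrite !lt0r_neq0.
  rewrite ger0_norm ?sqr_ge0//.
  rewrite lerXn2r ?nnegrE ?invr_ge0 ?divr_ge0 ?(ltW eps0) ?(ltW (md0 i))//.
  have -> : 2 / eps = d^-1 by rewrite /d invf_div.
  by rewrite lef_pV2 ?posrE// lerDr ltW.
Qed.

(** The real part of the trace is at most the norm; it takes
the value 1 at 1 and is nonpositive on the sum. *)
Lemma fd_trace_distance m (x y w u : 'I_m -> U) :
  1 <= rnorm (1 - \sum_i (x i * y i - y i * x i + (w i - star (w i)) - star (u i) * u i)).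
Proof.
have [tau [tauC tau1 tau_ge0 _ tau_norm]] := fd_trace e1 e0 fdA.
apply: le_trans (tau_norm _); rewrite linearB /= tau1 raddf_sum /=.
have taustar z : complex.Re (tau (z - star z)) = 0.
  have tau_sa h : star h = h -> complex.Im (tau h) = 0.
    move=> sh; have [n [l [p [pres hE]]]] := fd_spectral fdA sh.
    rewrite hE /diag raddf_sum /= (big_morph (@complex.Im R) (id1 := 0) (op1 := +%R)).
    + apply: big1 => i _; have [pp sp _ _] := pres; rewrite linearZ /=.
      have := tau_ge0 (p i); rewrite sp pp eqxx lecE => /andP[/eqP + _].
      by case: (tau (p i)) => r s /= ->; simpc.
    + by move=> [? ?] [? ?].
    + by [].
  rewrite -{1}(scale1r (z - _)).
  have -> : z - star z = 'i%C *: (- 'i%C *: (z - star z)).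
    by rewrite scalerA mulrN -expr2 sqr_i opprK scale1r.
  rewrite scale1r linearZ /=; have := tau_sa (- 'i%C *: (z - star z)).
  rewrite starZ starB starK -(opprB z) scalerN -scaleNr.
  have -> : - ((- 'i%C)^* )%C = - 'i%C :> R[i] by simpc.
  by move=> /(_ erefl); case: (tau _) => r s /= ->; simpc.
have -> : complex.Re (1 - \sum_i tau (x i * y i - y i * x i + (w i - star (w i)) - star (u i) * u i))
    = 1 + \sum_i complex.Re (tau (star (u i) * u i)).
  rewrite -sumrN raddfD /= (raddf_sum (@complex.Re R)) /=; congr (_ + _); apply: eq_bigr => i _.
  have -> : tau (x i * y i - y i * x i + (w i - star (w i)) - star (u i) * u i) =
     tau (w i - star (w i)) - tau (star (u i) * u i).
    by rewrite linearB linearD /= linearB /= (tauC (y i)) subrr add0r.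
  by rewrite opprB raddfD /= raddfN /= taustar oppr0 addr0.
rewrite lerDl; apply: sumr_ge0 => i _.
by have := tau_ge0 (u i); rewrite lecE => /andP[].
Qed.

(** Put D = 1 - V' V with V' the adjoint of V. As D is small,
V is injective on columns and has an inverse W. Then W = V' + D W bounds the
norm of W by twice the norm of V, and 1 - V V' = V D W. *)
Lemma fd_matrix_estimate n (V : 'M[U]_n) :
  mxn (1%:M - mxstar V *m V) <= 2^-1 ->
  mxn (1%:M - V *m mxstar V) <= 2 * mxn V ^+ 2 * mxn (1%:M - mxstar V *m V).
Proof.
set S := mxstar V; set D := 1%:M - S *m V => D2.
have inj m (Z : 'M[U]_(n, m)) : V *m Z = 0 -> Z = 0.
  move=> VZ; apply: mxn_eq0; apply/eqP; rewrite eq_le mxn_ge0 andbT.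
  have ZE : Z = D *m Z by rewrite mulmxBl mul1mx -mulmxA VZ mulmx0 subr0.
  have : mxn Z <= 2^-1 * mxn Z.
    by rewrite {1}ZE (le_trans (mxnM _ _))// ler_wpM2r// mxn_ge0.
  by lra.
have [d [r [s rs]]] := fd_coordinates fdA.
have surj (y : 'cV[U]_n) : exists z : 'cV[U]_n, V *m z = y.
  have [z|z zE] := @fd_column_surj _ _ _ _ _ rs n V _ (fun i => y i 0).
    move=> Vz k; have : (\col_k z k : 'cV[U]_n) = 0.
      apply: inj; apply/colP => i; rewrite !mxE -[RHS](Vz i).
      by apply: eq_bigr => j _; rewrite mxE.
    by move=> /colP/(_ k); rewrite !mxE.
  exists (\col_k z k); apply/colP => i; rewrite !mxE -zE.
  by apply: eq_bigr => j _; rewrite mxE.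
have /choice[w wE] := fun j => surj (col j 1%:M).
pose W : 'M[U]_n := \matrix_(i, j) w j i 0.
have VW : V *m W = 1%:M.
  apply/matrixP => i j; have /colP/(_ i) := wE j; rewrite !mxE => <-.
  by apply: eq_bigr => k _; rewrite !mxE.
have WV : W *m V = 1%:M.
  apply/eqP; rewrite -subr_eq0; apply/eqP/inj.
  by rewrite mulmxBr mulmxA VW mul1mx mulmx1 subrr.
have WE : W = S + D *m W.
  by rewrite mulmxBl mul1mx -mulmxA VW mulmx1 addrCA subrr addr0.
have Wn : mxn W <= 2 * mxn V.
  have h : mxn W <= mxn V + 2^-1 * mxn W.
    rewrite {1}WE (le_trans (mxnD _ _))// mxn_star lerD2l.
    by rewrite (le_trans (mxnM _ _))// ler_wpM2r// mxn_ge0.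
  by lra.
have -> : 1%:M - V *m S = V *m D *m W.
  by rewrite mulmxBr mulmx1 mulmxBl VW mulmxA -[V *m S *m V *m W]mulmxA VW mulmx1.
rewrite (le_trans (mxnM _ _))//.
apply: (@le_trans _ _ ((mxn V * mxn D) * (2 * mxn V))).
  by apply: ler_pM; rewrite ?mxn_ge0 ?mxnM.
by rewrite le_eqVlt; apply/orP; left; apply/eqP; ring.
Qed.

End FiniteDimensionalEstimates.

(** * Transfer to pseudocompact algebras *)

Section IdentityTransfer.
Variable R : realType.
Local Notation C := R[i].

Lemma nonzero_identity (A : cstarAlgType R) (e x : A) :
  is_identity e -> x != 0 -> e != 0.
Proof. by move=> e1; apply: contra => /eqP e0; rewrite -(e1 x).1 e0 cs_mul0l. Qed.

Definition unit_defect (A : cstarAlgType R) (v : 'I_2 -> A) : R :=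
  rnorm (v (lift ord0 ord0) ** v ord0 - v ord0) +
  rnorm (v ord0 ** v (lift ord0 ord0) - v ord0).

Lemma definable_unit_defect : definable unit_defect.
Proof.
by apply: definable_add; apply: definable_norm; apply: term_sub;
  do ?apply: term_mul; exact: term_var.
Qed.

(** The element that acts as an identity up to 2^-n is
unique up to an error of the same order: the product of two of them is close to
both. *)
Lemma pseudocompact_unital (A : cstarAlgType R) :
  pseudocompact A -> exists e : A, is_identity e.
Proof.
move=> Apc.
have [Hi Hs] : definable (fun A (v : 'I_0 -> A) => inf_ball (fun a => sup_ball
    (fun z => unit_defect (vcons z (vcons a v))))) /\
    definable (fun A (v : 'I_1 -> A) => sup_ball (fun z => unit_defect (vcons z v))).
  by split; do ?apply: (definable_inf (definable_sup definable_unit_defect));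
    exact: (definable_sup definable_unit_defect).
have /choice[y yP] k : exists e : A, rnorm e <= 1 /\ forall x, rnorm x <= 1 ->
    rnorm (e ** x - x) + rnorm (x ** e - x) <= 2^-1 ^+ k.
  have H : inf_ball (fun a : A => sup_ball (fun z => unit_defect (vcons z
      (vcons a (fun _ : 'I_0 => 0))))) <= 0.
    apply: (pseudocompact_transfer Apc Hi) => [B fdB [b b0] v _|[]//].
    have [e e1] := fd_unital fdB; have e0 := nonzero_identity e1 b0.
    apply/(inf_ball_leP _ _ Hs) => eps eps0.
    exists e; first by rewrite (rnorm1 e1 e0).
    apply/(sup_ball_leP _ _ definable_unit_defect) => x x1.
    rewrite /unit_defect vconsS !vcons0 (e1 x).1 (e1 x).2 subrr rnorm0.
    by rewrite !add0r ltW.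
  have k0 : 0 < 2^-1 ^+ k :> R by rewrite exprn_gt0.
  have [e er] := (inf_ball_leP _ _ Hs).1 H _ k0.
  move=> /(sup_ball_leP _ _ definable_unit_defect) ex; exists e; split=> // x x1.
  by have := ex x x1; rewrite /unit_defect vconsS !vcons0 add0r.
(* both y n and y m are close to y n ** y m *)
have ynm n m : rnorm (y n - y m) <= 2^-1 ^+ n + 2^-1 ^+ m.
  have [yn1 ynP] := yP n; have [ym1 ymP] := yP m.
  rewrite -(subrKA (y n ** y m)) (le_trans (rnormD _ _))// addrC lerD//.
    by rewrite (le_trans _ (ynP _ ym1))// lerDl rnorm_ge0.
  by rewrite rnormB (le_trans _ (ymP _ yn1))// lerDr rnorm_ge0.
have [|e eP] := @telescope_lim _ _ y.
  move=> n; rewrite (le_trans (ynm _ _))// lerD2r /= exprS ler_piMl ?exprn_ge0//.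
  by lra.
exists e => x.
have [x' x'1 ->] : exists2 x' : A, rnorm x' <= 1 & x = (rnorm x + 1)%:C *: x'.
  by apply: scale_to_ball; rewrite ?ltr_wpDl ?rnorm_ge0// lerDl.
rewrite cs_mulZr cs_mulZl.
suff [-> ->] : e ** x' = x' /\ x' ** e = x' by [].
have cv (f : A -> A) : (forall u v, f (u - v) = f u - f v) -> (forall u, rnorm (f u) <= rnorm u) ->
    (forall n, rnorm (f (y n) - x') <= 2^-1 ^+ n) -> f e = x'.
  move=> fB fn fy; apply/eqP; rewrite -subr_eq0; apply/eqP/rnorm0_eq0/eqP.
  rewrite eq_le rnorm_ge0 andbT; apply: (@le0_of_geometric _ _ 5) => n.
  rewrite -(subrKA (f (y n))) (le_trans (rnormD _ _))// -fB.
  have := fn (e - y n); have := eP n; have := fy n => /=.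
  by set q := 2^-1 ^+ n => *; lra.
split.
  apply: (cv (fun u => u ** x')) => [u v|u|n]; first exact: cs_mulBl.
    by rewrite (le_trans (rnormM _ _))// ler_piMr ?rnorm_ge0.
  have [_ ynP] := yP n.
  by rewrite (le_trans _ (ynP _ x'1))// lerDl rnorm_ge0.
apply: (cv (fun u => x' ** u)) => [u v|u|n]; first exact: cs_mulBr.
  by rewrite (le_trans (rnormM _ _))// ler_piMl ?rnorm_ge0.
have [_ ynP] := yP n.
by rewrite (le_trans _ (ynP _ x'1))// lerDr rnorm_ge0.
Qed.

End IdentityTransfer.

Section ApproximationTransfer.
Variable R : realType.
Local Notation C := R[i].

(** The value at b of the polynomial with coefficients s, multiplied by
z. In this form a constant coefficient is a multiple of z and makes sense
without an identity. *)
Definition poly_act (A : cstarAlgType R) (s : seq C) (b z : A) : A :=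
  foldr (fun c w => c *: z + b ** w) 0 s.

Lemma term_poly_act n (s : seq C)
    (G H : forall A : cstarAlgType R, ('I_n.+1 -> A) -> A) :
  term_definable G -> term_definable H ->
  term_definable (fun A v => poly_act s (G A v) (H A v)).
Proof.
move=> Gdef Hdef; elim: s => [|c s ih]; first exact: term_zero.
by apply: term_add; [exact: term_scale | exact: term_mul].
Qed.

Lemma term_repart n (G : forall A : cstarAlgType R, ('I_n -> A) -> A) :
  term_definable G -> term_definable (fun A v => repart (G A v)).
Proof. by move=> Gdef; apply/term_scale/term_add => //; exact: term_star. Qed.

Lemma poly_actE (A : cstarAlgType R) (e : A) (e1 : is_identity e) (e0 : e != 0)
    (f : {poly C}) (b z : unital_alg e1 e0) :
  poly_act f b z = horner_alg b f * z.
Proof.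
rewrite -[in RHS](polyseqK f); elim: (f : seq C) => [|c s ih].
  by rewrite rmorph0 mul0r.
rewrite [LHS]/= ih /= cons_poly_def rmorphD rmorphM /= horner_algX horner_algC.
rewrite mulrDl -scalerAl mul1r addrC; congr (_ + _).
have -> : horner_alg b (Poly s) * b = b * horner_alg b (Poly s).
  transitivity (horner_alg b ('X * Poly s)); last by rewrite rmorphM /= horner_algX.
  by rewrite mulrC rmorphM /= horner_algX.
by rewrite cs_mulE mulrA.
Qed.

(** The large weight N makes a bound on the sum control the
first term much better than the second. *)
Definition quantize_defect (s : seq C) (N : R) (A : cstarAlgType R) (v : 'I_3 -> A) : R :=
  N * rnorm (poly_act s (repart (v (lift ord0 ord0))) (v ord0)) +
  rnorm (repart (v (lift ord0 ord0)) - repart (v (lift ord0 (lift ord0 ord0)))).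

Lemma definable_quantize_defect s N : definable (quantize_defect s N).
Proof.
apply: definable_add.
  apply/definable_scale/definable_norm/term_poly_act; last exact: term_var.
  exact/term_repart/term_var.
by apply/definable_norm/term_sub; exact/term_repart/term_var.
Qed.

Lemma pseudocompact_quantize (A : cstarAlgType R) (G : seq R) (eps N : R) (a : A) :
  pseudocompact A -> 0 < eps ->
  (forall t, `|t| <= 1 -> exists2 g, g \in G & `|g - t| <= eps) ->
  {in G, forall g, `|g| <= 1} -> rnorm a <= 1 ->
  exists2 b : A, rnorm b <= 1 & forall z, rnorm z <= 1 ->
    N * rnorm (poly_act (\prod_(g <- G) ('X - (g%:C)%:P)) (repart b) z) +
    rnorm (repart b - repart a) <= 2 * eps.
Proof.
set f := \prod_(g <- G) _ => Apc eps0 netG G1 a1.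
have Hd := definable_quantize_defect f N.
have Hs := definable_sup Hd; have Hi := definable_inf Hs.
have H : inf_ball (fun b : A => sup_ball (fun z => quantize_defect f N (vcons z
    (vcons b (fun _ : 'I_1 => a))))) <= eps.
  apply: (pseudocompact_transfer Apc Hi) => // B fdB [b b0] v v1.
  have [e e1] := fd_unital fdB; have e0 := nonzero_identity e1 b0.
  apply/(inf_ball_leP _ _ Hs) => d d0.
  have [q [q1 sq fq qv]] := @fd_quantize _ _ _ e1 e0 fdB G eps (v ord0) (ltW eps0) netG G1 (v1 ord0).
  exists q => //.
  apply/(sup_ball_leP _ _ Hd) => z z1; rewrite /quantize_defect !vconsS !vcons0.
  have rq : repart q = q := repart_sa sq.
  have -> : poly_act f (repart (q : B)) z = 0.
    rewrite (rq : repart (q : B) = q); apply: etrans (@poly_actE _ e e1 e0 f q z) _.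
    by rewrite fq mul0r.
  rewrite rnorm0 mulr0 add0r.
  rewrite (rq : repart (q : B) = q).
  by apply: le_trans qv _; rewrite lerDl ltW.
have [b b1 /(sup_ball_leP _ _ Hd) bz] := (inf_ball_leP _ _ Hs).1 H _ eps0.
exists b => // z z1; have := bz z z1.
by rewrite /quantize_defect !vconsS !vcons0 mulr_natl mulr2n.
Qed.

(** The factor K brings an inverse of norm at most K into the
unit ball. *)
Definition inverse_defect (K : R) (A : cstarAlgType R) (v : 'I_4 -> A) : R :=
  let z := v ord0 in let y := v (lift ord0 ord0) in
  let x := v (lift ord0 (lift ord0 ord0)) in
  let a := v (lift ord0 (lift ord0 (lift ord0 ord0))) in
  rnorm (2^-1 *: a - x) +
  (rnorm (K%:C *: (x ** (y ** z)) - z) + rnorm (K%:C *: (y ** (x ** z)) - z)).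

Lemma definable_inverse_defect K : definable (inverse_defect K).
Proof.
apply: definable_add.
  by apply/definable_norm/term_sub; [apply/term_scale|]; exact: term_var.
apply: definable_add; (apply/definable_norm/term_sub; last exact: term_var);
  by apply/term_scale/term_mul/term_mul; exact: term_var.
Qed.

Lemma pseudocompact_invertible_approx (A : cstarAlgType R) (eps : R) (a : A) :
  pseudocompact A -> 0 < eps -> eps <= 2^-1 -> rnorm a <= 1 ->
  exists x y : A, forall z, rnorm z <= 1 ->
    rnorm (2^-1 *: a - x) +
    (rnorm ((2 / eps)%:C *: (x ** (y ** z)) - z) +
     rnorm ((2 / eps)%:C *: (y ** (x ** z)) - z)) <= 3 * eps.
Proof.
move=> Apc eps0 eps2 a1; set K := 2 / eps.
have K0 : 0 < K by rewrite divr_gt0.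
have Hd := definable_inverse_defect K.
have Hs := definable_sup Hd; have Hi := definable_inf Hs; have Hii := definable_inf Hi.
have H : inf_ball (fun x : A => inf_ball (fun y : A => sup_ball (fun z =>
    inverse_defect K (vcons z (vcons y (vcons x (fun _ : 'I_1 => a))))))) <= eps.
  apply: (pseudocompact_transfer Apc Hii) => // B fdB [b b0] v v1.
  have [e e1] := fd_unital fdB; have e0 := nonzero_identity e1 b0.
  have [x [y [xy yx xa yK]]] : exists x y : B, [/\ x ** y = e, y ** x = e,
      rnorm (x - 2^-1 *: v ord0) <= eps & rnorm y <= K].
    exact: (@fd_invertible_approx _ _ _ e1 e0 fdB (2^-1 *: v ord0) _ eps0).
  (* halving a leaves room in the unit ball for the approximant x *)
  have half : rnorm (2^-1 *: v ord0) <= 2^-1.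
    have -> : (2^-1 : C) = (2^-1 : R)%:C by rewrite fmorphV rmorph_nat.
    by rewrite rnormZr ger0_norm// ler_piMr.
  apply/(inf_ball_leP _ _ Hi) => d d0; exists x.
    rewrite -(subrK (2^-1 *: v ord0) x) (le_trans (rnormD _ _))//.
    by have := le_trans xa eps2; move: half; lra.
  apply/(inf_ball_leP _ _ Hs) => d' d'0; exists (K^-1%:C *: y).
    by rewrite rnormZr ger0_norm ?invr_ge0 ?(ltW K0)// ler_pdivrMl// mulr1.
  apply/(sup_ball_leP _ _ Hd) => z z1; rewrite /inverse_defect /= !vconsS !vcons0.
  have KK : K%:C * K^-1%:C = 1 by rewrite -rmorphM mulfV ?gt_eqF// rmorph1.
  rewrite !cs_mulZl !cs_mulZr !scalerA KK !scale1r.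
  have -> : x ** (y ** z) = z by rewrite cs_mulA xy (e1 z).1.
  have -> : y ** (x ** z) = z by rewrite cs_mulA yx (e1 z).1.
  rewrite subrr rnorm0 !addr0 rnormB.
  by apply: le_trans xa _; lra.
have [x x1 /(inf_ball_leP _ _ Hs)/(_ _ eps0)] := (inf_ball_leP _ _ Hi).1 H _ eps0.
move=> [y y1 /(sup_ball_leP _ _ Hd) xyz]; exists x, y => z z1; have := xyz z z1.
rewrite /inverse_defect /= !vconsS !vcons0 => /le_trans; apply.
by lra.
Qed.

End ApproximationTransfer.

Section TraceAndFinitenessTransfer.
Variable R : realType.
Local Notation C := R[i].

(** Tracial states have a nonpositive real part on these elements. *)
Definition cone_elt (A : cstarAlgType R) (x y w u : A) : A :=
  x ** y - y ** x + (w - star w) - star u ** u.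

Lemma term_cone_elt n (x y w u : forall A : cstarAlgType R, ('I_n -> A) -> A) :
  term_definable x -> term_definable y -> term_definable w -> term_definable u ->
  term_definable (fun A v => cone_elt (x A v) (y A v) (w A v) (u A v)).
Proof.
move=> xd yd wd ud; apply: term_sub; last by apply: term_mul => //; exact: term_star.
by apply: term_add; apply: term_sub => //; do ?[exact: term_star|apply: term_mul].
Qed.

Definition cone_var m (j : nat) (i : 'I_m) : 'I_(4 * m).+1 :=
  lift ord0 (mxvec_index (inord j : 'I_4) i).

Definition trace_defect (K : R) m (A : cstarAlgType R) (v : 'I_(4 * m).+1 -> A) : R :=
  rnorm (v ord0 - (\sum_i cone_elt (K%:C *: v (cone_var 0 i))
    (K%:C *: v (cone_var 1 i)) (K%:C *: v (cone_var 2 i))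
    (K%:C *: v (cone_var 3 i))) ** v ord0).

Lemma definable_trace_defect K m : definable (@trace_defect K m).
Proof.
apply/definable_norm/term_sub; first exact: term_var.
apply: term_mul; last exact: term_var.
by apply: term_sum => i; apply: term_cone_elt; apply: term_scale; exact: term_var.
Qed.

(** [fd_trace_distance] holds for elements of
arbitrary norm, whereas the variables of a formula range over the unit ball;
hence one sentence for each bound K on the norms. *)
Lemma pseudocompact_cone_distance (A : cstarAlgType R) (e : A) m
    (x y w u : 'I_m -> A) : pseudocompact A -> is_identity e ->
  1 <= rnorm (e - \sum_i cone_elt (x i) (y i) (w i) (u i)).
Proof.
move=> Apc e1.
pose q (i : 'I_m) := [:: x i; y i; w i; u i].
pose K : R := 1 + \sum_i \sum_(t <- q i) rnorm t.
have K0 : 0 < K.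
  by rewrite ltr_pwDl//; apply: sumr_ge0 => i _; apply: sumr_ge0 => *; exact: rnorm_ge0.
pose M : 'M[A]_(4, m) := \matrix_(j, i) (K^-1%:C *: nth 0 (q i) j).
pose v k := mxvec M 0 k.
have KK : K%:C * K^-1%:C = 1 by rewrite -rmorphM mulfV ?gt_eqF// rmorph1.
have vE j i : (j < 4)%N -> K%:C *: v (mxvec_index (inord j : 'I_4) i) = nth 0 (q i) j.
  by move=> j4; rewrite /v mxvecE mxE scalerA KK scale1r inordK.
have v1 k : rnorm (v k) <= 1.
  rewrite /v; case/mxvec_indexP: k => j i; rewrite mxvecE mxE.
  rewrite rnormZr ger0_norm ?invr_ge0 ?(ltW K0)// ler_pdivrMl// mulr1.
  have tq : nth 0 (q i) j \in q i by rewrite mem_nth.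
  apply: (@le_trans _ _ (\sum_(t <- q i) rnorm t)).
    rewrite (big_rem _ tq) /= lerDl; apply: sumr_ge0 => *; exact: rnorm_ge0.
  rewrite /K (bigD1 i)//= addrCA lerDl addr_ge0//.
  by apply: sumr_ge0 => k _; apply: sumr_ge0 => *; exact: rnorm_ge0.
have Hd := definable_trace_defect K m.
have Hs := definable_sup Hd.
have Ha := definable_add (definable_scale (-1) Hs) (definable_const (4 * m) (1 : R)).
have : -1 * sup_ball (fun z => trace_defect K (vcons z v)) + 1 <= 0.
  apply: (pseudocompact_transfer Apc Ha) => // B fdB [b b0] {vE}v {}v1.
  have [f f1] := fd_unital fdB; have f0 := nonzero_identity f1 b0.
  have h : 1 <= trace_defect K (vcons f v).
    have := @fd_trace_distance _ _ _ f1 f0 fdB m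
       (fun i => K%:C *: v (mxvec_index (inord 0 : 'I_4) i))
       (fun i => K%:C *: v (mxvec_index (inord 1 : 'I_4) i))
       (fun i => K%:C *: v (mxvec_index (inord 2 : 'I_4) i))
       (fun i => K%:C *: v (mxvec_index (inord 3 : 'I_4) i)).
    move=> /le_trans; apply; rewrite /trace_defect vcons0 (f1 _).2.
    under [in leRHS]eq_bigr do rewrite /cone_var !vconsS.
    exact: lexx.
  have f_le : rnorm f <= 1 by rewrite (rnorm1 f1 f0).
  have := (sup_ball_leP v (sup_ball (fun z => trace_defect K (vcons z v))) Hd).1 (lexx _) f f_le.
  by lra.
move=> h; have {h} : 1 <= sup_ball (fun z => trace_defect K (vcons z v)) by lra.
move=> /le_trans; apply; apply/(sup_ball_leP _ _ Hd) => z z1.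
rewrite /trace_defect vcons0.
under eq_bigr do rewrite /cone_var !vconsS !vE//.
rewrite -{1}(e1 z).1 -cs_mulBl (le_trans (rnormM _ _))//.
by rewrite ler_piMr ?rnorm_ge0.
Qed.

Definition gram (K : R) n (A : cstarAlgType R) (v : 'I_n -> 'I_n -> A) i j : A :=
  \sum_k star (K%:C *: v k i) ** (K%:C *: v k j).

Definition cogram (K : R) n (A : cstarAlgType R) (v : 'I_n -> 'I_n -> A) i j : A :=
  \sum_k (K%:C *: v i k) ** star (K%:C *: v j k).

(** The distance of the matrix G to the identity matrix, its
entries being seen through their action on z. *)
Definition identity_defect n (A : cstarAlgType R) (G : 'I_n -> 'I_n -> A) (z : A) : R :=
  \sum_i \sum_j rnorm ((if i == j then z else 0) - G i j ** z).

Definition tail_entries n (A : cstarAlgType R) (v : 'I_(n * n).+1 -> A) i j : A :=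
  v (lift ord0 (mxvec_index i j)).

Lemma definable_identity_defect n
    (G : forall A : cstarAlgType R, ('I_(n * n).+1 -> A) -> 'I_n -> 'I_n -> A) :
  (forall i j, term_definable (fun A v => G A v i j)) ->
  definable (fun A v => identity_defect (G A v) (v ord0)).
Proof.
move=> Gd; apply: definable_sum => i; apply: definable_sum => j.
apply/definable_norm/term_sub; last by apply: term_mul; [exact: Gd|exact: term_var].
by case: (i == j); [exact: term_var | exact: term_zero].
Qed.

Definition isometry_defect K n (A : cstarAlgType R) (v : 'I_(n * n).+1 -> A) : R :=
  identity_defect (gram K (tail_entries v)) (v ord0).

Definition coisometry_defect K n (A : cstarAlgType R) (v : 'I_(n * n).+1 -> A) : R :=
  identity_defect (cogram K (tail_entries v)) (v ord0).

Lemma definable_isometry_defect K n : definable (@isometry_defect K n).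
Proof.
apply: definable_identity_defect => i j; apply: term_sum => k.
by apply: term_mul; [apply: term_star|]; apply: term_scale; exact: term_var.
Qed.

Lemma definable_coisometry_defect K n : definable (@coisometry_defect K n).
Proof.
apply: definable_identity_defect => i j; apply: term_sum => k.
by apply: term_mul; [|apply: term_star]; apply: term_scale; exact: term_var.
Qed.

Lemma tail_entries_cons n (A : cstarAlgType R) (z : A) (v : 'I_(n * n) -> A) :
  tail_entries (vcons z v) = fun i j => v (mxvec_index i j).
Proof. by apply/funext => i; apply/funext => j; rewrite /tail_entries vconsS. Qed.

Lemma identity_defect_le (A : cstarAlgType R) (e : A) (e1 : is_identity e) (e0 : e != 0)
    n (G : 'I_n -> 'I_n -> unital_alg e1 e0) (z : unital_alg e1 e0) : rnorm z <= 1 ->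
  identity_defect G z <= mxn (1%:M - \matrix_(i, j) G i j).
Proof.
move=> z1; apply: ler_sum => i _; apply: ler_sum => j _; rewrite !mxE.
have -> : (if i == j then z else 0) - G i j ** z = ((i == j)%:R - G i j) * z.
  by rewrite mulrBl; case: (i == j); rewrite ?mul1r ?mul0r.
by rewrite (le_trans (urnormM _ _))// ler_piMr ?rnorm_ge0.
Qed.

Lemma identity_defect1 (A : cstarAlgType R) (e : A) (e1 : is_identity e) (e0 : e != 0)
    n (G : 'I_n -> 'I_n -> unital_alg e1 e0) :
  identity_defect G 1 = mxn (1%:M - \matrix_(i, j) G i j).
Proof.
apply: eq_bigr => i _; apply: eq_bigr => j _; rewrite !mxE cs_mulE mulr1.
by case: (i == j).
Qed.

(** The finite-dimensional estimate requires the
first defect to be at most 1/2. Beyond this value the second defect is bounded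
by a constant, so that a linear bound, which is the bound of a sentence, holds
without restriction. *)
Lemma pseudocompact_stably_finite (A : cstarAlgType R) (e : A) :
  pseudocompact A -> is_identity e -> stably_finite e.
Proof.
move=> Apc e1 n V VV.
pose K : R := 1 + \sum_i \sum_j rnorm (V i j).
have K0 : 0 < K.
  by rewrite ltr_pwDl//; apply: sumr_ge0 => i _; apply: sumr_ge0 => *; exact: rnorm_ge0.
pose v k := mxvec (\matrix_(i, j) (K^-1%:C *: V i j)) 0 k.
have KK : K%:C * K^-1%:C = 1 by rewrite -rmorphM mulfV ?gt_eqF// rmorph1.
have vE i j : K%:C *: v (mxvec_index i j) = V i j.
  by rewrite /v mxvecE mxE scalerA KK scale1r.
have v1 k : rnorm (v k) <= 1.
  rewrite /v; case/mxvec_indexP: k => i j; rewrite mxvecE mxE.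
  rewrite rnormZr ger0_norm ?invr_ge0 ?(ltW K0)// ler_pdivrMl// mulr1.
  rewrite /K -[leLHS]add0r lerD//.
  by apply: (ler_sum2 (F := fun i j => rnorm (V i j))) => *; exact: rnorm_ge0.
pose nn : R := (n * n)%:R.
have nn0 : 0 <= nn by rewrite ler0n.
pose c : R := 2 * (nn + (nn * K) ^+ 2).
have c0 : 0 <= c by rewrite mulr_ge0// addr_ge0// sqr_ge0.
have Hg := definable_isometry_defect K n.
have Hc := definable_coisometry_defect K n.
have Ha := definable_add (definable_sup Hc)
  (definable_scale (- c) (definable_sup Hg)).
have : sup_ball (fun z : A => coisometry_defect K (vcons z v)) +
    - c * sup_ball (fun z : A => isometry_defect K (vcons z v)) <= 0.
  apply: (pseudocompact_transfer Apc Ha) => // B fdB [b b0] {vE}v {}v1.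
  have [f f1] := fd_unital fdB; have f0 := nonzero_identity f1 b0.
  pose W : 'M[unital_alg f1 f0]_n := \matrix_(i, j) (K%:C *: v (mxvec_index i j)).
  have gE z : gram K (tail_entries (vcons z v)) = fun i j => (mxstar W *m W) i j.
    apply/funext => i; apply/funext => j; rewrite tail_entries_cons mxE.
    by apply: eq_bigr => k _; rewrite !mxE.
  have cE z : cogram K (tail_entries (vcons z v)) = fun i j => (W *m mxstar W) i j.
    apply/funext => i; apply/funext => j; rewrite tail_entries_cons mxE.
    by apply: eq_bigr => k _; rewrite !mxE.
  have mxid (X : 'M[unital_alg f1 f0]_n) : \matrix_(i, j) X i j = X.
    by apply/matrixP => i j; rewrite mxE.
  set D := mxn (1%:M - mxstar W *m W).
  have hg : D <= sup_ball (fun z : B => isometry_defect K (vcons z v)).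
    have f_le : rnorm f <= 1 by rewrite (rnorm1 f1 f0).
    have := (sup_ball_leP v _ Hg).1 (lexx _) f f_le.
    apply: le_trans; rewrite /isometry_defect vcons0 gE.
    have := @identity_defect1 _ f f1 f0 n (fun i j => (mxstar W *m W) i j).
    by rewrite mxid => idE; rewrite /D -idE.
  have hc : sup_ball (fun z : B => coisometry_defect K (vcons z v))
      <= mxn (1%:M - W *m mxstar W).
    apply/(sup_ball_leP _ _ Hc) => z z1; rewrite /coisometry_defect vcons0 cE.
    have := @identity_defect_le _ f f1 f0 n (fun i j => (W *m mxstar W) i j) z z1.
    by rewrite mxid.
  have Wn : mxn W <= nn * K.
    apply: (@le_trans _ _ (\sum_(i < n) \sum_(j < n) K)).
      apply: ler_sum => i _; apply: ler_sum => j _.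
      by rewrite mxE rnormZr gtr0_norm// ler_piMr// ltW.
    by rewrite !sumr_const card_ord -mulrnA mulr_natl.
  have In : mxn (1%:M : 'M[unital_alg f1 f0]_n) <= nn.
    apply: (@le_trans _ _ (\sum_(i < n) \sum_(j < n) 1)).
      apply: ler_sum => i _; apply: ler_sum => j _.
      by rewrite mxE; case: (i == j); rewrite ?rnorm1 ?rnorm0.
    by rewrite !sumr_const card_ord -mulrnA.
  have D0 : 0 <= D := mxn_ge0 _.
  have W2 : mxn W ^+ 2 <= (nn * K) ^+ 2.
    by rewrite lerXn2r ?nnegrE ?mxn_ge0 ?mulr_ge0// ltW.
  have key : mxn (1%:M - W *m mxstar W) <= c * D.
    have /orP[D2|D2] : (D <= 2^-1) || (2^-1 <= D) := le_total D 2^-1.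
      apply: le_trans (fd_matrix_estimate fdB D2) _; rewrite -/D.
      rewrite ler_wpM2r// /c ler_wpM2l//.
      by rewrite (le_trans W2)// lerDr.
    apply: (@le_trans _ _ (nn + (nn * K) ^+ 2)).
      apply: le_trans (mxnD _ _) _; apply: lerD => //.
      have -> : mxn (- (W *m mxstar W)) = mxn (W *m mxstar W).
        by apply: eq_bigr => i _; apply: eq_bigr => j _; rewrite [X in rnorm X]mxE rnormN.
      by rewrite (le_trans (mxnM _ _))// mxn_star -expr2.
    rewrite /c; have q0 : 0 <= nn + (nn * K) ^+ 2 by rewrite addr_ge0// sqr_ge0.
    by move: q0 D2; set q := nn + _ => q0 D2; nra.
  rewrite mulNr subr_le0.
  by rewrite (le_trans hc)// (le_trans key)// ler_wpM2l.
rewrite mulNr subr_le0 => sup_le.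
have gram0 : sup_ball (fun z : A => isometry_defect K (vcons z v)) <= 0.
  apply/(sup_ball_leP _ _ Hg) => z z1; rewrite /isometry_defect vcons0 tail_entries_cons.
  rewrite /identity_defect big1// => i _; rewrite big1// => j _.
  have -> : gram K (fun i j => v (mxvec_index i j)) i j = mx_id e n i j.
    rewrite -VV !mxE; apply: eq_bigr => k _; by rewrite !vE mxE.
  rewrite mxE; case: (i == j); first by rewrite (e1 z).1 subrr rnorm0.
  by rewrite cs_mul0l subrr rnorm0.
have := le_trans sup_le (ler_wpM2l c0 gram0); rewrite mulr0.
have [e0|e0] := eqVneq e 0.
  move=> _; apply/matrixP => i j.
  by rewrite -[LHS](e1 _).1 -[RHS](e1 _).1 e0 !cs_mul0l.
move=> /(sup_ball_leP _ _ Hc)/(_ e); rewrite (rnorm1 e1 e0) => /(_ (lexx _)).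
rewrite /coisometry_defect vcons0 tail_entries_cons => defect0; apply/matrixP => i j.
have cE : cogram K (fun i j => v (mxvec_index i j)) i j = mx_mul V (mx_star V) i j.
  by rewrite mxE; apply: eq_bigr => k _; rewrite !vE mxE.
apply/esym/eqP; rewrite -subr_eq0; apply/eqP/rnorm0_eq0/eqP.
rewrite eq_le rnorm_ge0 andbT -cE; apply: le_trans defect0.
have := @ler_sum2 _ _ _ (fun i j => rnorm ((if i == j then e else 0) -
  cogram K (fun i j => v (mxvec_index i j)) i j ** e)) i j.
by rewrite mxE (e1 _).2; apply=> *; exact: rnorm_ge0.
Qed.

End TraceAndFinitenessTransfer.

(** * The Hahn-Banach theorem and tracial states *)

Section HahnBanach.
Variables (R : realType) (V : lmodType R[i]).
Implicit Types (p q s : V -> R) (x y : V).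

Definition sublinear p :=
  (forall x y, p (x + y) <= p x + p y) /\
  (forall (r : R) x, 0 < r -> p (r%:C *: x) <= r * p x).

Lemma sublinear0 p : sublinear p -> p 0 = 0.
Proof.
move=> [pD pZ]; apply/eqP; rewrite eq_le; apply/andP; split.
  have := @pZ 2^-1 0; rewrite scaler0 => /(_ _); rewrite invr_gt0 ltr0n => /(_ isT).
  by lra.
by have := pD 0 0; rewrite addr0; lra.
Qed.

Lemma sublinear_ge p x : sublinear p -> - p (- x) <= p x.
Proof.
move=> psub; have [pD _] := psub; have := pD x (- x).
by rewrite subrr sublinear0//; lra.
Qed.

Lemma inf_ge_le (S : set R) (l y : R) : (forall z, S z -> l <= z) -> S y ->
  l <= inf S <= y.
Proof.
move=> Sl Sy; apply/andP; split; first by apply: lb_le_inf => //; exists y.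
by apply: ge_inf => //; exists l.
Qed.

Lemma inf_approx (S : set R) (l y d : R) : (forall z, S z -> l <= z) -> S y ->
  0 < d -> exists2 z, S z & z < inf S + d.
Proof.
move=> Sl Sy d0; apply: inf_adherent => //; split; first by exists y.
by exists l.
Qed.

(** Zorn's lemma: the pointwise infimum of a chain of
sublinear functionals is sublinear. *)
Lemma minimal_sublinear s : sublinear s -> exists p,
  [/\ sublinear p, forall x, p x <= s x &
    forall q, sublinear q -> (forall x, q x <= p x) -> q = p].
Proof.
move=> ssub.
pose T := {p | sublinear p /\ forall x, p x <= s x}.
pose below (p q : T) := `[< forall x, sval q x <= sval p x >].
have T_inj (p q : T) : sval p = sval q -> p = q.
  case: p q => [p pP] [q qP] /= pq; subst q.
  by congr exist; exact: Prop_irrelevance.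
have [||||[p [psub ps]] pmin] := @Zorn T below.
- by move=> p; apply/asboolP.
- move=> p q r /asboolP qp /asboolP rq; apply/asboolP => x.
  exact: le_trans (rq x) (qp x).
- move=> p q /asboolP qp /asboolP pq; apply: T_inj; apply/funext => x.
  by apply/eqP; rewrite eq_le qp pq.
- move=> F Ftot.
  have [[p0 Fp0]|F0] := pselect (exists p : T, F p); last first.
    have sT : sublinear s /\ forall x, s x <= s x by [].
    exists (exist _ s sT) => p Fp.
    by exfalso; apply: F0; exists p.
  pose S x := [set sval (p : T) x | p in F].
  have Sl x z : S x z -> - s (- x) <= z.
    move=> [[p [psub ps]] _ <-] /=.
    by rewrite (le_trans _ (sublinear_ge x psub))// lerN2.
  have S0 x : S x (sval p0 x) by exists p0.
  have Sle x (p : T) : F p -> inf (S x) <= sval p x.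
    by move=> Fp; have /andP[] := @inf_ge_le (S x) _ (sval p x) (Sl x) (imageP _ Fp).
  have msub : sublinear (fun x => inf (S x)).
    split=> [x y|r x r0].
      apply/ler_addgt0Pr => d d0; have d2 : 0 < d / 2 by rewrite divr_gt0.
      have [_ [p Fp <-] px] := inf_approx (Sl x) (S0 x) d2.
      have [_ [q Fq <-] qy] := inf_approx (Sl y) (S0 y) d2.
      have [r [Fr rx ry]] : exists r : T, [/\ F r, sval r x <= sval p x & sval r y <= sval q y].
        by case: (Ftot p q Fp Fq) => /asboolP h; [exists q|exists p]; split.
      apply: le_trans (Sle _ _ Fr) _; have [rD _] := (svalP r).1.
      by apply: le_trans (rD x y) _; lra.
    rewrite -ler_pdivrMl//; apply: lb_le_inf; first by exists (sval p0 x).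
    move=> _ [p Fp <-]; rewrite ler_pdivrMl//; apply: le_trans (Sle _ _ Fp) _.
    by have [_ pZ] := (svalP p).1; exact: pZ.
  have ms x : inf (S x) <= s x by apply: le_trans (Sle x _ Fp0) _; exact: (svalP p0).2.
  have mT : sublinear (fun x => inf (S x)) /\ forall x, inf (S x) <= s x by [].
  exists (exist _ (fun x => inf (S x)) mT) => p Fp.
  by apply/asboolP => x /=; exact: Sle.
exists p; split=> // q qsub qp.
have qs x : q x <= s x := le_trans (qp x) (ps x).
have qT : sublinear q /\ forall x, q x <= s x by [].
by have /(congr1 sval) := pmin (exist _ q qT) (asboolT qp).
Qed.

(** A minimal sublinear functional p is additive. Indeed, for fixed
y, the infimum of p (z + t y) - t p y over t >= 0 is a sublinear function of z
below p, hence it is p, and t = 1 gives p z <= p (z + y) - p y. *)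
Theorem hahn_banach s : sublinear s -> exists p,
  [/\ forall x y, p (x + y) = p x + p y,
      forall (r : R) x, p (r%:C *: x) = r * p x
    & forall x, p x <= s x].
Proof.
move=> /minimal_sublinear[p [psub ps pmin]]; have [pD pZ] := psub.
have pDE x y : p (x + y) = p x + p y.
  apply/eqP; rewrite eq_le pD /=.
  pose S z := [set p (z + t%:C *: y) - t * p y | t in [set t : R | 0 <= t]].
  have Sl z v : S z v -> - p (- z) <= v.
    move=> [t /= t0 <-]; rewrite lerBrDr.
    have ty : t * p y <= p (t%:C *: y).
      have [->|tn0] := eqVneq t 0; first by rewrite mul0r scale0r sublinear0.
      have tp : 0 < t by rewrite lt_neqAle eq_sym tn0.
      have := pZ t^-1 (t%:C *: y); rewrite invr_gt0 => /(_ tp).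
      by rewrite scalerA -rmorphM mulVf// rmorph1 scale1r ler_pdivlMl.
    have := pD (- z) (z + t%:C *: y); rewrite addKr; lra.
  have S0 z : S z (p z) by exists 0; rewrite /= ?scale0r ?addr0 ?mul0r ?subr0.
  have Sle z t : 0 <= t -> inf (S z) <= p (z + t%:C *: y) - t * p y.
    move=> t0; have Sz : S z (p (z + t%:C *: y) - t * p y) by exists t.
    by have /andP[] := inf_ge_le (Sl z) Sz.
  have qp : (fun z => inf (S z)) = p.
    apply: pmin => [|z]; last by have /andP[] := inf_ge_le (Sl z) (S0 z).
    split=> [z1 z2|r z r0].
      apply/ler_addgt0Pr => d d0; have d2 : 0 < d / 2 by rewrite divr_gt0.
      have [_ [t1 /= t10 <-] h1] := inf_approx (Sl z1) (S0 z1) d2.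
      have [_ [t2 /= t20 <-] h2] := inf_approx (Sl z2) (S0 z2) d2.
      apply: le_trans (Sle _ (t1 + t2) (addr_ge0 t10 t20)) _.
      rewrite rmorphD /= scalerDl addrACA mulrDl.
      have := pD (z1 + t1%:C *: y) (z2 + t2%:C *: y); lra.
    rewrite -ler_pdivrMl//; apply: lb_le_inf; first by exists (p z).
    move=> _ [t /= t0 <-]; rewrite ler_pdivrMl//.
    apply: le_trans (Sle _ (r * t) (mulr_ge0 (ltW r0) t0)) _.
    rewrite rmorphM /= -scalerA -scalerDr mulrBr mulrA lerD2r.
    exact: pZ.
  have := Sle x 1 ler01; rewrite -[inf (S x)]/((fun z => inf (S z)) x) qp.
  by rewrite rmorph1 scale1r mul1r; lra.
have p0 := sublinear0 psub.
have pN x : p (- x) = - p x by have := pDE x (- x); rewrite subrr p0; lra.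
have pZE (r : R) x : 0 < r -> p (r%:C *: x) = r * p x.
  move=> r0; apply/eqP; rewrite eq_le pZ//= .
  have := pZ r^-1 (r%:C *: x); rewrite invr_gt0 => /(_ r0).
  by rewrite scalerA -rmorphM mulVf ?gt_eqF// rmorph1 scale1r ler_pdivlMl.
exists p; split=> // r x; have [r0|r0|->] := ltgtP r 0.
- have := @pZE (- r) x; rewrite oppr_gt0 => /(_ r0).
  by rewrite rmorphN /= scaleNr pN; lra.
- exact: pZE.
- by rewrite scale0r p0 mul0r.
Qed.

End HahnBanach.

(** The functional that sends x to the infimum of the norms of
x - t e - n plus t, over real t and n in N, is sublinear; the hypothesis on
distances is what bounds it below. With t = 1 and t = -1 it forces the value 1
at e on the linear functionals below it, with t = 0 nonpositive values on N. *)
Lemma cone_separation (R : realType) (V : normedModType R[i]) (e : V) (N : set V) :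
  N 0 -> (forall x y, N x -> N y -> N (x + y)) ->
  (forall (r : R) x, 0 < r -> N x -> N (r%:C *: x)) ->
  rnorm e <= 1 -> (forall n, N n -> 1 <= rnorm (e - n)) ->
  exists g : V -> R,
    [/\ forall x y, g (x + y) = g x + g y,
        forall (r : R) x, g (r%:C *: x) = r * g x,
        g e = 1
      & forall n, N n -> g n <= 0].
Proof.
move=> N0 ND NZ e1 Nfar.
pose S x := [set v | exists t : R, exists2 n, N n & v = rnorm (x - t%:C *: e - n) + t].
have Sl x v : S x v -> - rnorm x <= v.
  move=> [t [n Nn ->]].
  (* for t < 0 this is the hypothesis on e, divided by - t *)
  have h : - t <= rnorm (t%:C *: e + n).
    have [t0|t0] := leP 0 t; first by rewrite (le_trans _ (rnorm_ge0 _))// oppr_le0.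
    have := Nfar _ (NZ (- t)^-1 n _ Nn); rewrite invr_gt0 oppr_gt0 => /(_ t0).
    rewrite -(ler_pM2l (_ : 0 < - t)) ?oppr_gt0// mulr1 => /le_trans; apply.
    have tt : (- t)%:C * ((- t)^-1)%:C = 1.
      by rewrite -rmorphM mulfV ?oppr_eq0 ?lt_eqF// rmorph1.
    have -> : rnorm (t%:C *: e + n) = rnorm ((- t)%:C *: (e - (- t)^-1%:C *: n)).
      by rewrite scalerBr scalerA tt scale1r rmorphN scaleNr -opprD rnormN.
    by rewrite rnormZr gtr0_norm ?oppr_gt0.
  have := rnormD (t%:C *: e + n - x) x; rewrite subrK.
  by rewrite (rnormB (_ + n)) opprD addrA; lra.
have S0 x : S x (rnorm x).
  by exists 0, 0 => //; rewrite scale0r !subr0 addr0.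
have Sle x t n : N n -> inf (S x) <= rnorm (x - t%:C *: e - n) + t.
  move=> Nn; have Sx : S x (rnorm (x - t%:C *: e - n) + t) by exists t, n.
  by have /andP[] := inf_ge_le (Sl x) Sx.
have ssub : sublinear (fun x => inf (S x)).
  split=> [x y|r x r0].
    apply/ler_addgt0Pr => d d0; have d2 : 0 < d / 2 by rewrite divr_gt0.
    have [_ [t [n Nn ->]] hx] := inf_approx (Sl x) (S0 x) d2.
    have [_ [u [m Nm ->]] hy] := inf_approx (Sl y) (S0 y) d2.
    apply: le_trans (Sle _ (t + u) _ (ND _ _ Nn Nm)) _.
    have -> : x + y - (t + u)%:C *: e - (n + m) =
        (x - t%:C *: e - n) + (y - u%:C *: e - m).
      by rewrite rmorphD /= scalerDl !opprD [RHS]addrACA [x - _ + _]addrACA.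
    by have := rnormD (x - t%:C *: e - n) (y - u%:C *: e - m); lra.
  rewrite -ler_pdivrMl//; apply: lb_le_inf; first by exists (rnorm x).
  move=> _ [t [n Nn ->]]; rewrite ler_pdivrMl//.
  apply: le_trans (Sle _ (r * t) _ (NZ r n r0 Nn)) _.
  rewrite rmorphM /= -scalerA -!scalerBr rnormZr gtr0_norm//.
  by rewrite mulrDr.
have [g [gD gZ gs]] := hahn_banach ssub.
exists g; split=> //.
- have g1 : g e <= 1.
    apply: le_trans (gs e) _; apply: le_trans (Sle e 1 _ N0) _.
    by rewrite rmorph1 scale1r subrr subr0 rnorm0 add0r.
  have gN : g (- e) <= -1.
    apply: le_trans (gs (- e)) _; apply: le_trans (Sle (- e) (-1) _ N0) _.
    by rewrite rmorphN rmorph1 scaleN1r subrr subr0 rnorm0 add0r.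
  have := gZ (-1) e; rewrite rmorphN rmorph1 scaleN1r => gNE.
  by move: gN; rewrite gNE => gN; apply/eqP; rewrite eq_le g1 /=; lra.
- move=> n Nn; apply: le_trans (gs n) _; apply: le_trans (Sle n 0 _ Nn) _.
  by rewrite scale0r subr0 subrr rnorm0 addr0.
Qed.

Section Trace.
Variables (R : realType) (A : cstarAlgType R) (e : A).
Local Notation C := R[i].

Lemma pseudocompact_identity_neq0 : pseudocompact A -> is_identity e -> e != 0.
Proof.
move=> Apc e1.
have := @pseudocompact_cone_distance _ A e 0 (fun=> 0) (fun=> 0) (fun=> 0) (fun=> 0) Apc e1.
rewrite big_ord0 subr0; apply: contraTneq => ->.
by rewrite rnorm0 ler10.
Qed.

(** A separating real functional g is the real part
of the complex functional that sends x to g x - i g (i x). The conditions on a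
trace are those given by the cone: it contains the commutators and the
skew-adjoint elements with both signs, and - star u u. *)
Lemma pseudocompact_tracial_state : pseudocompact A -> is_identity e ->
  exists tau : {scalar A}, tracial_state e tau.
Proof.
move=> Apc e1; have e0 := pseudocompact_identity_neq0 Apc e1.
pose celt (t : A * A * A * A) := cone_elt t.1.1.1 t.1.1.2 t.1.2 t.2.
pose N := [set n : A | exists s, n = \sum_(t <- s) celt t].
have Nelt x y w u : N (cone_elt x y w u).
  by exists [:: (x, y, w, u)]; rewrite big_seq1.
have [|||||g [gD gZ ge gN]] := @cone_separation R A e N.
- by exists [::]; rewrite big_nil.
- by move=> x y [s ->] [s' ->]; exists (s ++ s'); rewrite big_cat.
- move=> r x r0 [s ->].
  pose sr := (Num.sqrt r)%:C.
  exists [seq (r%:C *: t.1.1.1, t.1.1.2, r%:C *: t.1.2, sr *: t.2) | t <- s].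
  rewrite big_map scaler_sumr; apply: eq_bigr => t _.
  rewrite /celt /cone_elt /= cs_mulZl cs_mulZr !starZ cs_mulZl cs_mulZr scalerA.
  have cr (z : R) : conjc z%:C = z%:C by exact: conjc_real.
  rewrite !cr -rmorphM -expr2 sqr_sqrtr ?ltW//.
  by rewrite -!scalerBr -scalerDr -scalerBr.
- by rewrite (rnorm1 e1 e0).
- move=> _ [s ->].
  have := @pseudocompact_cone_distance _ A e (size s)
    (fun i => (tnth (in_tuple s) i).1.1.1) (fun i => (tnth (in_tuple s) i).1.1.2)
    (fun i => (tnth (in_tuple s) i).1.2) (fun i => (tnth (in_tuple s) i).2) Apc e1.
  by rewrite (big_tnth _ _ s).
have g0 : g 0 = 0 by have := gZ 0 0; rewrite scale0r mul0r.
have gNE x : g (- x) = - g x.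
  by have := gZ (-1) x; rewrite rmorphN rmorph1 scaleN1r mulN1r.
have gC x y : g (x ** y) = g (y ** x).
  have h a b : g (a ** b) <= g (b ** a).
    have := gN _ (Nelt a b 0 0); rewrite /cone_elt cstar0 cs_mul0l !subr0 addr0.
    by rewrite gD gNE subr_le0.
  by apply/eqP; rewrite eq_le !h.
have gi h : star h = h -> g ('i%C *: h) = 0.
  have le0 k : star k = k -> g ('i%C *: k) <= 0.
    move=> sk; have := gN _ (Nelt 0 0 (('i%C / 2) *: k) 0).
    rewrite /cone_elt cstar0 !cs_mul0l !subr0 add0r starZ sk -scalerBl.
    have conjM (z w : C) : conjc (z * w) = conjc z * conjc w by exact: rmorphM.
    have -> : 'i%C / 2 - conjc ('i%C / 2) = 'i%C :> C.
      rewrite conjM conj_half -mulrBl.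
      have -> : 'i%C - conjc 'i%C = 'i%C * 2 :> C by rewrite mulr_natr mulr2n; simpc.
      by rewrite mulfK// pnatr_eq0.
    by [].
  move=> sh; apply/eqP; rewrite eq_le le0//=.
  have := le0 (- h); rewrite -[star (- h)]/(_) -scaleN1r starZ sh rmorphN rmorph1.
  by move=> /(_ erefl); rewrite scaleN1r scalerN gNE oppr_le0.
pose tau (x : A) : C := (g x)%:C - 'i%C * (g ('i%C *: x))%:C.
have taulin : scalar tau.
  move=> k x y; rewrite /tau; case: k => a b.
  have kx (z : A) : (a +i* b)%C *: z = a%:C *: z + b%:C *: ('i%C *: z).
    rewrite scalerA -scalerDl; congr (_ *: _); by simpc.
  have ix (z : A) : 'i%C *: ('i%C *: z) = - z.
    by rewrite scalerA -expr2 sqr_i scaleN1r.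
  rewrite kx !scalerDr !gD.
  have -> : 'i%C *: (a%:C *: x) = a%:C *: ('i%C *: x) by rewrite !scalerA mulrC.
  have -> : 'i%C *: (b%:C *: ('i%C *: x)) = b%:C *: - x.
    by rewrite -ix !scalerA; congr (_ *: _); rewrite mulrCA mulrA.
  rewrite !gZ gNE; simpc; congr (_ +i* _)%C; lra.
pose tauL : {scalar A} := HB.pack tau (GRing.isLinear.Build C A C *%R tau taulin).
exists tauL; split=> [a||a b] /=; rewrite /tau.
- rewrite gi ?starM ?starK// mulr0 subr0 ler0c.
  have := gN _ (Nelt 0 0 0 a).
  by rewrite /cone_elt cstar0 cs_mul0l !subr0 !add0r gNE oppr_le0.
- rewrite gi ?ge ?mulr0 ?subr0//.
  exact: (star1 e1 e0).
- by rewrite (gC a b) -cs_mulZl (gC ('i%C *: a) b) cs_mulZr.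
Qed.

End Trace.

(** * Newton iteration in a unital C*-algebra *)

Lemma comp_taylor (F : comNzRingType) (p h : {poly F}) :
  exists w, p \Po ('X + h) = p + p^`() * h + h ^+ 2 * w.
Proof.
elim/poly_ind: p => [|p c [w pE]].
  by exists 0; rewrite comp_poly0 deriv0 mul0r mulr0 !addr0.
exists (p^`() + w * ('X + h)).
rewrite comp_polyD comp_polyM comp_polyX comp_polyC pE derivD derivM derivX derivC.
by ring.
Qed.

(** Since q has simple roots, v q + u q' = 1 for some u and v.
The Newton step X - q u then has a polynomial form, and by Taylor's formula the
value of q at it is q (1 - u q') = q^2 v up to a multiple of q^2. *)
Lemma newton_polynomial (R : realType) (G : seq R) : uniq G ->
  exists u w : {poly R}, let q := \prod_(g <- G) ('X - g%:P) in
    q \Po ('X - q * u) = q ^+ 2 * w.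
Proof.
move=> uG; set q := \prod_(g <- G) _.
have : separable.separable_poly q by rewrite separable.separable_prod_XsubC.
rewrite separable.separable_poly.unlock.
move=> /Bezout_eq1_coprimepP[[v u] /= vu].
have [w wE] := comp_taylor q (- (q * u)).
exists u, (v + u ^+ 2 * w); rewrite /= wE.
have vE : q = q * (v * q + u * q^`()) by rewrite vu mulr1.
rewrite {1}vE; ring.
Qed.

Section Newton.
Variables (R : realType) (A : cstarAlgType R) (e : A).
Hypotheses (e1 : is_identity e) (e0 : e != 0).
Local Notation U := (unital_alg e1 e0).
Local Notation C := R[i].
Implicit Types b x y : U.

(** Real coefficients preserve self-adjointness. *)
Definition real_horner (b : U) (f : {poly R}) : U :=
  horner_alg b (map_poly (real_complex R) f).

Lemma real_hornerX b : real_horner b 'X = b.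
Proof. by rewrite /real_horner map_polyX horner_algX. Qed.

Lemma real_hornerM b f g : real_horner b (f * g) = real_horner b f * real_horner b g.
Proof. by rewrite /real_horner !rmorphM. Qed.

Lemma real_hornerB b f g : real_horner b (f - g) = real_horner b f - real_horner b g.
Proof. by rewrite /real_horner !rmorphB. Qed.

Lemma real_horner_MXaddC b f (c : R) :
  real_horner b (f * 'X + c%:P) = real_horner b f * b + c%:C%:A.
Proof.
rewrite /real_horner !rmorphD !rmorphM /= map_polyX map_polyC/=.
by rewrite horner_algX horner_algC.
Qed.

Lemma real_horner0 b : real_horner b 0 = 0.
Proof. by rewrite /real_horner !rmorph0. Qed.

Lemma real_horner_comp b f g :
  real_horner b (f \Po g) = real_horner (real_horner b g) f.
Proof.
elim/poly_ind: f => [|f c ih]; first by rewrite comp_poly0 !real_horner0.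
rewrite real_horner_MXaddC -ih -real_hornerM comp_polyD comp_polyM comp_polyX comp_polyC.
by rewrite /real_horner rmorphD /= rmorphD /= map_polyC/= horner_algC.
Qed.

Lemma star_real_horner b f : star b = b ->
  star (real_horner b f) = real_horner b f.
Proof.
move=> sb; elim/poly_ind: f => [|f c ih]; first by rewrite real_horner0 star0.
rewrite real_horner_MXaddC starD ustarM ih sb starZ star1 conjc_real.
congr (_ + _); rewrite -{1 4}(real_hornerX b) -!real_hornerM.
by rewrite mulrC.
Qed.

Lemma real_horner_bounded f : exists2 K : R, 0 <= K &
  forall b, rnorm b <= 2 -> rnorm (real_horner b f) <= K.
Proof.
elim/poly_ind: f => [|f c [K K0 fK]].
  by exists 0 => // b _; rewrite real_horner0 rnorm0.
exists (K * 2 + `|c|) => [|b b2]; first by rewrite addr_ge0// mulr_ge0.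
rewrite real_horner_MXaddC (le_trans (rnormD _ _))// lerD//.
  by rewrite (le_trans (urnormM _ _))// ler_pM ?rnorm_ge0 ?fK.
by rewrite rnormZr rnorm1 mulr1.
Qed.

Lemma real_horner_lipschitz f : exists2 L : R, 0 <= L &
  forall x y, rnorm x <= 2 -> rnorm y <= 2 ->
    rnorm (real_horner x f - real_horner y f) <= L * rnorm (x - y).
Proof.
elim/poly_ind: f => [|f c [L L0 fL]].
  by exists 0 => // x y _ _; rewrite !real_horner0 subrr rnorm0 mul0r.
have [K K0 fK] := real_horner_bounded f.
exists (L * 2 + K) => [|x y x2 y2]; first by rewrite addr_ge0// mulr_ge0.
rewrite !real_horner_MXaddC opprD addrACA subrr addr0.
have -> : real_horner x f * x - real_horner y f * y =
  (real_horner x f - real_horner y f) * x + real_horner y f * (x - y).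
  by rewrite mulrBl mulrBr addrA subrK.
rewrite (le_trans (rnormD _ _))// [in leRHS]mulrDl lerD//.
  rewrite (le_trans (urnormM _ _))// mulrAC.
  by rewrite ler_pM ?rnorm_ge0 ?fL.
by rewrite (le_trans (urnormM _ _))// ler_wpM2r ?rnorm_ge0 ?fK.
Qed.

(** Along the Newton iteration the norm of the value of q is at least
halved at each step, by the quadratic estimate of [newton_polynomial], so the
iterates converge. *)
Lemma newton_zero (G : seq R) (eps : R) : uniq G -> 0 < eps ->
  exists2 eta : R, 0 < eta & forall b, star b = b -> rnorm b <= 1 ->
    rnorm (real_horner b (\prod_(g <- G) ('X - g%:P))) <= eta ->
    exists b', [/\ star b' = b',
      real_horner b' (\prod_(g <- G) ('X - g%:P)) = 0 & rnorm (b' - b) <= eps].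
Proof.
move=> uG eps0; have [u [w]] := newton_polynomial uG.
set q := \prod_(g <- G) _ => /= qN.
have [Ku Ku0 uK] := real_horner_bounded u.
have [Kw Kw0 wK] := real_horner_bounded w.
have [L L0 qL] := real_horner_lipschitz q.
pose K := 1 + Ku + Kw; have K0 : 0 < K by rewrite /K; lra.
pose d := Num.min eps 1; have d0 : 0 < d by rewrite /d lt_min eps0/=.
have [d1 deps] : d <= 1 /\ d <= eps by rewrite /d !ge_min !lexx orbT.
(* K bounds the values of u and w on the ball of radius 2; then the n-th step has
   norm at most (d / 2) 2^-n and the iterates stay within d of b *)
exists (d / (2 * K)) => [|b sb b1 qb]; first by rewrite divr_gt0// mulr_gt0.
set eta := d / (2 * K) in qb.
have eta0 : 0 < eta by rewrite divr_gt0// mulr_gt0.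
have Keta : K * eta = d / 2 by rewrite /eta; field; rewrite gt_eqF.
pose step x := real_horner x ('X - q * u).
pose y n := iter n step b.
pose r n : R := 2^-1 ^+ n.
have r0 n : 0 < r n by rewrite exprn_gt0.
have rS n : r n = r n.+1 + r n.+1 by rewrite /r exprS; lra.
have sy n : star (y n) = y n.
  by elim: n => [//|n ih]; rewrite /y iterS star_real_horner.
have yS n : y n.+1 - y n = - (real_horner (y n) q * real_horner (y n) u).
  by rewrite /y iterS -/(y n) /step real_hornerB real_hornerX real_hornerM addrAC subrr add0r.
have inv n : rnorm (y n - b) <= d * (1 - r n) /\ rnorm (real_horner (y n) q) <= eta * r n.
  elim: n => [|n [yb yq]].
    by rewrite /y /= subrr rnorm0 /r expr0 subrr mulr0 mulr1.
  have y2 : rnorm (y n) <= 2.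
    rewrite -(subrK b (y n)) (le_trans (rnormD _ _))//.
    have : d * (1 - r n) <= 1 by have := r0 n; nra.
    by move: yb b1; lra.
  have stepn : rnorm (y n.+1 - y n) <= d / 2 * r n.
    rewrite yS rnormN (le_trans (urnormM _ _))// -Keta mulrC -mulrA.
    apply: ler_pM; rewrite ?rnorm_ge0//.
    by rewrite (le_trans (uK _ y2))// /K; lra.
  split.
    rewrite -(subrK (y n) (y n.+1)) -addrA (le_trans (rnormD _ _))//.
    by move: stepn yb; rewrite (rS n); lra.
  have -> : real_horner (y n.+1) q = real_horner (y n) q ^+ 2 * real_horner (y n) w.
    by rewrite /y iterS -/(y n) /step -real_horner_comp qN real_hornerM expr2 real_hornerM.
  have r1 : r n <= 1 by apply: exprn_ile1; lra.
  apply: (@le_trans _ _ ((eta * r n) ^+ 2 * K)).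
    rewrite (le_trans (urnormM _ _))// ler_pM ?rnorm_ge0//.
      rewrite expr2 (le_trans (urnormM _ _))//.
      by rewrite expr2 ler_pM ?rnorm_ge0.
    by rewrite (le_trans (wK _ y2))// /K; lra.
  have -> : (eta * r n) ^+ 2 * K = (K * eta) * eta * r n ^+ 2 by ring.
  rewrite Keta; have := rS n; move: (r0 n) (r0 n.+1) r1.
  set s := r n; set s' := r n.+1 => s0 s'0 s1 ss.
  have : d / 2 * eta * s ^+ 2 <= 2^-1 * eta * s ^+ 2.
    by rewrite ler_wpM2r ?sqr_ge0// ler_wpM2r ?(ltW eta0)//; lra.
  have : 2^-1 * eta * s ^+ 2 <= 2^-1 * eta * s.
    apply: ler_wpM2l; first by rewrite mulr_ge0 ?(ltW eta0).
    by rewrite expr2 ler_piMr ?(ltW s0).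
  by nra.
have y_le n : rnorm (y n - b) <= d.
  by have [h _] := inv n; apply: le_trans h _; have := r0 n; nra.
have y2 n : rnorm (y n) <= 2.
  by rewrite -(subrK b (y n)) (le_trans (rnormD _ _))//; have := y_le n; lra.
have [|z zy] := @telescope_lim R U y.
  move=> n; rewrite yS rnormN (le_trans (urnormM _ _))//.
  have [_ yq] := inv n.
  apply: (@le_trans _ _ (eta * r n * K)).
    by apply: ler_pM; rewrite ?rnorm_ge0// (le_trans (uK _ (y2 n)))// /K; lra.
  have -> : eta * r n * K = K * eta * r n by ring.
  by rewrite Keta -/(r n); have := r0 n; nra.
have zb : rnorm (z - b) <= d.
  rewrite -subr_le0; apply: (@le0_of_geometric _ _ 4) => n.
  have := rnormD (z - y n) (y n - b); rewrite subrKA.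
  have := zy n; have := y_le n => /=; lra.
have z2 : rnorm z <= 2.
  by rewrite -(subrK b z) (le_trans (rnormD _ _))//; lra.
have lim0 x (M : R) : (forall n, rnorm x <= M * r n) -> x = 0.
  move=> xM; apply: rnorm0_eq0; apply/eqP; rewrite eq_le rnorm_ge0 andbT.
  exact: (@le0_of_geometric _ _ M).
exists z; split; last exact: le_trans zb _.
- apply/eqP; rewrite -subr_eq0; apply/eqP/(lim0 _ 8) => n.
  rewrite -(subrKA (y n)) (le_trans (rnormD _ _))//.
  rewrite -{1}(sy n) -starB rnorm_star (rnormB (y n)).
  by have := zy n => /=; rewrite -/(r n); lra.
- apply: (lim0 _ (L * 4 + eta)) => n; have [_ yq] := inv n.
  rewrite -(subrK (real_horner (y n) q) (real_horner z q)) (le_trans (rnormD _ _))//.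
  rewrite [in leRHS]mulrDl lerD// (le_trans (qL _ _ z2 (y2 n)))// -mulrA ler_wpM2l//.
Qed.

End Newton.

Section FiniteSpectrum.
Variables (R : realType) (A : cstarAlgType R) (e : A).
Hypotheses (e1 : is_identity e) (e0 : e != 0).
Local Notation U := (unital_alg e1 e0).
Local Notation C := R[i].

Lemma spectrum_finite (b : U) (q : {poly C}) (k : C) : k != 0 -> q != 0 ->
  horner_alg b q = 0 -> finite_set (spectrum e (k *: b : A)).
Proof.
move=> k0 q0 qb; have [r qE] := closed_field_poly_normal q.
apply: (@sub_finite_set _ _ [set` [seq k * x | x <- r]]); last exact: finite_seq.
move=> z /= zsp; apply/mapP; exists (k^-1 * z); last by rewrite mulrA mulfV// mul1r.
apply/negPn/negP => zr; apply: zsp.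
have qz : q.[k^-1 * z] != 0.
  have := root_prod_XsubC r (k^-1 * z); rewrite (negPf zr) => /negbT rz.
  by rewrite qE hornerZ mulf_neq0 ?lead_coef_eq0.
have [y [by1 yb1]] := invertible_of_nonroot qb qz.
have bE : (k *: b : A) - z *: e = k *: (b - (k^-1 * z)%:A).
  by rewrite scalerBr scalerA mulrA mulfV// mul1r.
exists (k^-1 *: y); rewrite bE; split.
- by rewrite cs_mulZl cs_mulZr scalerA mulfV// scale1r; exact: by1.
- by rewrite cs_mulZl cs_mulZr scalerA mulVf// scale1r; exact: yb1.
Qed.

End FiniteSpectrum.

Lemma finite_net (R : realType) (eps : R) : 0 < eps -> exists G : seq R,
  [/\ uniq G, {in G, forall g, `|g| <= 1} &
    forall t, `|t| <= 1 -> exists2 g, g \in G & `|g - t| <= eps].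
Proof.
move=> eps0; pose m := (Num.bound `|eps^-1|).+1.
have m0 : 0 < m%:R :> R by rewrite ltr0n.
have meps : m%:R^-1 <= eps.
  rewrite -(invrK eps) lef_pV2 ?posrE ?invr_gt0//.
  apply: le_trans (ler_norm _) _; apply: ltW.
  apply: (@lt_trans _ _ (Num.bound `|eps^-1|)%:R); first by rewrite archi_boundP.
  by rewrite ltr_nat.
exists [seq k%:R / m%:R - 1 | k <- iota 0 (2 * m).+1]; split.
- rewrite map_inj_uniq ?iota_uniq// => j k /addIr /(mulIf _).
  by rewrite invr_eq0 gt_eqF// => /(_ isT) /eqP; rewrite eqr_nat => /eqP.
- move=> g /mapP[k]; rewrite mem_iota add0n ltnS => /andP[_ km] ->.
  have kb : k%:R <= 2 * m%:R :> R by rewrite -natrM ler_nat.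
  have h0 : 0 <= k%:R / m%:R :> R by rewrite divr_ge0// ltW.
  have h2 : k%:R / m%:R <= 2 :> R by rewrite ler_pdivrMr.
  by rewrite ler_norml; apply/andP; split; lra.
- move=> t; rewrite ler_norml => /andP[t1 t2].
  have tm0 : 0 <= (t + 1) * m%:R by apply: mulr_ge0; [lra|exact: ltW].
  have /andP[k1 k2] := truncn_itv tm0; set k := Num.truncn _ in k1 k2.
  exists (k%:R / m%:R - 1).
    apply/mapP; exists k => //; rewrite mem_iota /= add0n ltnS.
    rewrite -(ler_nat R) (le_trans k1)// natrM.
    by apply: ler_wpM2r; [exact: ltW|lra].
  apply: le_trans meps.
  have -> : k%:R / m%:R - 1 - t = - (((t + 1) * m%:R - k%:R) / m%:R).
    by field; rewrite gt_eqF.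
  rewrite normrN normrM (ger0_norm (_ : 0 <= m%:R^-1)) ?invr_ge0 ?(ltW m0)//.
  rewrite ger0_norm ?subr_ge0// ler_piMl ?invr_ge0 ?(ltW m0)//.
  by move: k2; rewrite -natr1; lra.
Qed.

(** * Real rank zero and stable rank one *)

Section RealRankStableRank.
Variables (R : realType) (A : cstarAlgType R) (e : A).
Hypotheses (Apc : pseudocompact A) (e1 : is_identity e) (e0 : e != 0).
Local Notation U := (unital_alg e1 e0).
Local Notation C := R[i].

(** After scaling to the unit ball, the
element given by [pseudocompact_quantize] is moved to a zero of q by
[newton_zero]. *)
Lemma pseudocompact_approx_finite_spectrum (a : A) (eps : R) :
  star a = a -> 0 < eps ->
  exists b : A, [/\ star b = b, finite_set (spectrum e b) & rnorm (a - b) < eps].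
Proof.
move=> sa eps0; pose K := rnorm a + 1.
have K0 : 0 < K by rewrite ltr_wpDl ?rnorm_ge0.
have KC : K%:C != 0.
  by rewrite -(rmorph0 (real_complex R)) (inj_eq (@complexI R)) gt_eqF.
have [a' a'1 aE] : exists2 a' : A, rnorm a' <= 1 & a = K%:C *: a'.
  by apply: scale_to_ball => //; rewrite lerDl.
have sa' : star a' = a'.
  apply: (scalerI KC); rewrite -aE -[RHS]sa aE starZ.
  by congr (_ *: _); rewrite conjc_real.
pose d := eps / (4 * K); have d0 : 0 < d by rewrite divr_gt0// mulr_gt0.
have [G [uG G1 netG]] := finite_net d0.
have [eta eta0 newton] := newton_zero e1 e0 uG d0.
set q := \prod_(g <- G) _ in newton.
(* with this weight a total error of 2 * d leaves eta for the value of q *)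
pose N := 2 * d / eta; have N0 : 0 < N by rewrite divr_gt0// mulr_gt0.
have [b b1 bP] := pseudocompact_quantize N Apc d0 netG G1 a'1.
set qC := \prod_(g <- G) _ in bP.
have qCE : map_poly (real_complex R) q = qC.
  by rewrite rmorph_prod; apply: eq_bigr => g _; rewrite /= map_polyXsubC.
have {bP} := bP e; rewrite (rnorm1 e1 e0) => /(_ (lexx _)).
have -> : poly_act qC (repart b) e = real_horner (repart b : U) q.
  rewrite /real_horner qCE.
  by apply: etrans (@poly_actE _ _ _ e1 e0 _ _ _) _; rewrite mulr1.
rewrite (repart_sa sa') => bP.
have qb : rnorm (real_horner (repart b : U) q) <= eta.
  rewrite -(ler_pM2l N0); have -> : N * eta = 2 * d by rewrite /N divfK ?gt_eqF.
  by apply: le_trans bP; rewrite lerDl rnorm_ge0.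
have ba : rnorm (repart b - a') <= 2 * d.
  by apply: le_trans bP; rewrite lerDr mulr_ge0 ?rnorm_ge0 ?(ltW N0).
have rb1 : rnorm (repart b) <= 1 := le_trans (rnorm_repart b) b1.
have [c [sc qc cb]] := newton (repart b) (star_repart b) rb1 qb.
exists (K%:C *: c : A); split.
- by rewrite starZ conjc_real; congr (_ *: _); exact: sc.
- apply: (@spectrum_finite _ _ _ e1 e0 c qC) => //; last by rewrite -qCE; exact: qc.
  by rewrite monic_neq0// monic_prod_XsubC.
- have -> : a - (K%:C *: c : A) = K%:C *: (a' - c) by rewrite scalerBr -aE.
  rewrite rnormZr gtr0_norm//.
  have ac : rnorm (a' - (c : A)) <= 3 * d.
    rewrite rnormB -(subrKA (repart b)) (le_trans (rnormD _ _))//.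
    have : rnorm ((c : A) - repart b) <= d := cb.
    by move: ba; lra.
  have Kd : K * d = eps / 4 by rewrite /d; field; rewrite gt_eqF.
  have := ler_wpM2l (ltW K0) ac; have -> : K * (3 * d) = 3 * (K * d) by ring.
  by rewrite Kd; lra.
Qed.

Lemma pseudocompact_real_rank_zero : real_rank_zero e.
Proof.
move=> a /= sa B /nbhs_rnorm[r r0 aB].
have [b [sb fb ab]] := pseudocompact_approx_finite_spectrum sa r0.
by exists b; split=> //; exact: aB.
Qed.

(** Both x y and y x are close to a multiple of e,
so that x has a right inverse and a left inverse. *)
Lemma pseudocompact_stable_rank_one : stable_rank_one e.
Proof.
move=> O [a Oa] Oopen.
have [r r0 aO] : exists2 r : R, 0 < r & forall b, rnorm (a - b) < r -> O b.
  by apply: nbhs_rnorm; exact: open_nbhs_nbhs.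
pose K := rnorm a + 1; have K0 : 0 < K by rewrite ltr_wpDl ?rnorm_ge0.
have [a' a'1 aE] : exists2 a' : A, rnorm a' <= 1 & a = K%:C *: a'.
  by apply: scale_to_ball => //; rewrite lerDl.
(* the error 3 * d is less than 1/2, as the Neumann series requires, and less
   than r after scaling back by 2 * K *)
pose d := Num.min (8^-1) (r / (8 * K)).
have d0 : 0 < d by rewrite /d lt_min invr_gt0 ltr0n/= divr_gt0// mulr_gt0.
have [d8 dr] : d <= 8^-1 /\ d <= r / (8 * K) by rewrite /d !ge_min !lexx orbT.
have d2 : d <= 2^-1 by lra.
have [x [y xyP]] := pseudocompact_invertible_approx Apc d0 d2 a'1.
have {xyP} := xyP e; rewrite (rnorm1 e1 e0) => /(_ (lexx _)).
rewrite !(e1 _).2; set k := (2 / d)%:C => xyP.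
have ax : rnorm (2^-1 *: a' - x) <= 3 * d.
  by apply: le_trans xyP; rewrite lerDl addr_ge0 ?rnorm_ge0.
have xyk : rnorm (k *: (x ** y) - e) <= 2^-1.
  have : rnorm (k *: (x ** y) - e) <= 3 * d.
    by apply: le_trans xyP; rewrite addrCA lerDl addr_ge0 ?rnorm_ge0.
  by lra.
have yxk : rnorm (k *: (y ** x) - e) <= 2^-1.
  have : rnorm (k *: (y ** x) - e) <= 3 * d.
    by apply: le_trans xyP; rewrite addrA lerDr addr_ge0 ?rnorm_ge0.
  by lra.
have [u [xyu _]] : exists u : A, (k *: (x ** y)) ** u = e /\ u ** (k *: (x ** y)) = e.
  by apply: (@near_one_invertible _ _ _ e1 e0 (k *: (x ** y))); rewrite rnormB.
have [v [_ vyx]] : exists v : A, (k *: (y ** x)) ** v = e /\ v ** (k *: (y ** x)) = e.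
  by apply: (@near_one_invertible _ _ _ e1 e0 (k *: (y ** x))); rewrite rnormB.
pose x1 := k *: (y ** u); pose x2 := k *: (v ** y).
have xx1 : x ** x1 = e by rewrite /x1 cs_mulZr cs_mulA -cs_mulZl xyu.
have x2x : x2 ** x = e by rewrite /x2 cs_mulZl -cs_mulA -cs_mulZr vyx.
have x12 : x1 = x2 by rewrite -[LHS](e1 _).1 -x2x -cs_mulA xx1 (e1 _).2.
pose t : R := 2 * K; have t0 : 0 < t by rewrite mulr_gt0.
have tt : t%:C * t^-1%:C = 1 by rewrite -rmorphM mulfV ?gt_eqF// rmorph1.
exists (t%:C *: x); split.
  apply: aO; have -> : a = t%:C *: (2^-1 *: a').
    rewrite aE scalerA /t; congr (_ *: _).
    by rewrite mulrC rmorphM rmorph_nat mulKf// pnatr_eq0.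
  rewrite -scalerBr rnormZr gtr0_norm//.
  have := ler_wpM2l (ltW t0) ax; have := ler_wpM2l (ltW K0) dr.
  have -> : K * (r / (8 * K)) = r / 8 by field; rewrite gt_eqF.
  by rewrite /t; move: r0; lra.
exists (t^-1%:C *: x1); split.
- by rewrite cs_mulZl cs_mulZr scalerA tt scale1r.
- by rewrite cs_mulZl cs_mulZr scalerA mulrC tt scale1r x12.
Qed.

End RealRankStableRank.

Theorem proposition4p3 (R : realType) (A : cstarAlgType R)
    (A_pseudocompact : pseudocompact A) :
  exists e : A,
    [/\ is_identity e,
        real_rank_zero e,
        stable_rank_one e,
        stably_finite e
      & exists tau : {scalar A}, tracial_state e tau].
Proof.
have [e e1] := pseudocompact_unital A_pseudocompact.
have e0 := pseudocompact_identity_neq0 A_pseudocompact e1.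
exists e; split=> //.
- exact: pseudocompact_real_rank_zero e0.
- exact: pseudocompact_stable_rank_one e0.
- exact: pseudocompact_stably_finite.
- exact: pseudocompact_tracial_state.
Qed.
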